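(* Let $F=P_{\ell_1}\cup\cdots\cup P_{\ell_k}$ be a linear forest with $k\ge 2$, $\ell_1\ge\cdots\ge\ell_k\ge 2$ and $\ell_i\neq 3$ for all $1\le i\le k$. Let $s$ be a positive integer with $s\le \delta_F+1$, and let $n$ be an integer with $$n\ \ge\ \frac{5\binom{|F|-1}{s}^2}{(|F|-1)\binom{\delta_F}{s-1}}+\delta_F .$$ If $F$ is not of the form $2P_\ell$ with $\ell$ odd, then $$ex(n,K_s,F)=\max\left\{\mathcal{N}_s(G_F(n)),\ ex(n,K_s,P_{\ell_1})\right\}.$$ If $F=2P_\ell$ with $\ell$ odd, then $ex(n,K_s,F)=\mathcal{N}_s(G_F(n))$ when $s\le\delta_F$, and $$ex(n,K_s,F)=\left\lfloor\frac{n-1}{\ell-1}\right\rfloor\ell+\mu\quad\text{when } s=\delta_F+1,$$ where $\mu=1$ if $n-1\equiv \ell-2 \pmod{\ell-1}$ and $\mu=0$ otherwise.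
   Context: $P_m$, $K_m$, $E_m$ denote the path, complete graph and edgeless graph on $m$ vertices. $G\cup H$ is the disjoint union, $tG$ is $t$ disjoint copies of $G$, and $G+H$ (join) is obtained from $G\cup H$ by adding all edges between $V(G)$ and $V(H)$. A linear forest is written $F=P_{\ell_1}\cup\cdots\cup P_{\ell_k}$ with $\ell_1\ge\cdots\ge\ell_k\ge 2$, and $|F|=\sum_{i=1}^k\ell_i$ is its number of vertices. Define $\delta_F=\sum_{i=1}^k\lfloor \ell_i/2\rfloor-1$. Define the $n$-vertex graph $G_F(n)=K_{\delta_F}+E_{n-\delta_F}$ if some $\ell_i$ is even, and $G_F(n)=K_{\delta_F}+(E_{n-\delta_F-2}\cup K_2)$ if all $\ell_i$ are odd. A graph is $H$-free if it has no subgraph isomorphic to $H$. $\mathcal{N}_s(G)$ denotes the number of copies of $K_s$ in $G$ (i.e. the number of $s$-element cliques), and $ex(n,K_s,H)$ is the maximum of $\mathcal{N}_s(G)$ over all $H$-free graphs $G$ on $n$ vertices. *)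

(* Defs.v *)
From mathcomp Require Import all_boot all_order all_algebra.
Set Implicit Arguments. Unset Strict Implicit. Unset Printing Implicit Defensive.
Import Order.TTheory GRing.Theory Num.Theory.

Definition simpleb (T : finType) (e : rel T) : bool :=
  [forall x, ~~ e x x] && [forall x, forall y, e x y == e y x].

Definition containsb (T U : finType) (eG : rel T) (eH : rel U) : bool :=
  [exists f : {ffun U -> T}, injectiveb f &&
     [forall x, forall y, eH x y ==> eG (f x) (f y)]].

Definition Ncliques (T : finType) (e : rel T) (s : nat) : nat :=
  #|[set A : {set T} | (#|A| == s) &&
       [forall x in A, forall y in A, (x != y) ==> e x y]]|.

Definition ex (n s : nat) (U : finType) (eH : rel U) : nat :=
  \max_(g : {ffun 'I_n * 'I_n -> bool} |
          simpleb (fun x y => g (x, y)) && ~~ containsb (fun x y => g (x, y)) eH)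
     Ncliques (fun x y => g (x, y)) s.

Definition lf_bounds (ls : seq nat) : seq nat :=
  [seq sumn (take i ls) | i <- iota 1 (size ls)].

(* The linear forest P_{l_1} u ... u P_{l_k} on vertex set 'I_(l_1+...+l_k):
   the i-th path occupies a consecutive block of vertices. *)
Definition lf_graph (ls : seq nat) : rel 'I_(sumn ls) :=
  fun u v => ((u.+1 == v :> nat) || (v.+1 == u :> nat)) &&
             (maxn u v \notin lf_bounds ls).

Definition path_graph (m : nat) : rel 'I_(sumn [:: m]) := @lf_graph [:: m].

Definition lf_order (ls : seq nat) : nat := sumn ls.
Definition deltaF (ls : seq nat) : nat := sumn [seq l./2 | l <- ls] - 1.

(* G_F(n): vertices 0..delta_F-1 form K_{delta_F}, joined to everything;
   if all l_i are odd, additionally the edge {delta_F, delta_F+1}. *)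
Definition GF (ls : seq nat) (n : nat) : rel 'I_n :=
  fun u v => (u != v) &&
    ((minn u v < deltaF ls) ||
     [&& all odd ls, minn u v == deltaF ls & maxn u v == (deltaF ls).+1]).

Arguments lf_graph ls : clear implicits.
Arguments path_graph m : clear implicits.
Arguments GF ls n : clear implicits.

(* Main.v *)
(** For [s = 1] both sides are [n].  For [s >= 2], let [G] be [F]-free.  Repeatedly delete vertices
    of degree less than [delta_F] and pairs of adjacent vertices of degree [delta_F]: each deleted
    vertex accounts for at most [C(delta_F, s-1)] copies of [K_s].  If fewer than [4(|F| - 1)]
    vertices survive, Luo's bound for graphs without a path on [|F|] vertices and the hypothesis
    on [n] show that [G] has at most as many copies of [K_s] as [G_F(n)].

    Otherwise, call [U] the set of surviving vertices.  If all components of [U] are small, a copy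
    of [P_(l_1)] in [G] could be rerouted so as to meet only two of them, and the others would
    contain the remaining paths of [F]; hence [G] is [P_(l_1)]-free.  If some component is large,
    it has so long a path that any second component would complete it to a copy of [F]; so [U] is
    connected.  Let [w] be a longest path of [U] and [Q] a longest path off [w].  A [Q] with at
    least [delta_F + 1] vertices yields [F], unless [F = 2P_l] with [l] odd and all paths on [l] vertices pass through one
    vertex [c].  A shorter [Q] with at least two vertices forces [w] to be so long that it contains
    [F].  So the vertices off [w] are independent; cutting [w] into pieces and inserting these
    vertices shows that they have a common neighbourhood [A] of size [delta_F], and then [U \ A]
    spans no edge, or a single one when all [l_i] are odd, which is the structure of [G_F(n)].

    In the case of the vertex [c], [G - c] is [P_l]-free and
    [N_s(G) <= N_s(G - c) + N_(s-1)(G - c)]; the induction behind Luo's bound applies to this sum.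
    The extremal graph for [s = delta_F + 1] consists of copies of [K_l] sharing one vertex. *)

Require Import Defs.
From mathcomp Require Import all_boot all_order all_algebra.
From mathcomp Require Import zify.
Set Implicit Arguments. Unset Strict Implicit. Unset Printing Implicit Defensive.

(** * Cliques in vertex sets *)

(** In the counting parts [s = j + 2] and [delta_F = d + 1]; elsewhere [h = delta_F + 1] is the sum
    of the [l./2]. Each further vertex of G_F(n) brings C(delta_F, s-1) copies of K_s, whereas a
    deletion costs on average at most C(d, j+1) + C(d, j)/2, which is C(d, j)/2 less. Summed over
    the deletions, this surplus outweighs Luo's bound on few survivors and dictates the size of n.
    Deleting low-degree vertices alone would leave components K_h. After the deletion of pairs every
    edge has an end of degree at least h; this excludes components on only h vertices and the case
    that both ends of a side path have degree h - 1. Without P_3 every odd length contributes at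
    least 2 to h. So |F| = 2h + o with 2o <= h, where o counts the odd lengths; this slack carries
    both the packing of F into two disjoint paths and the contradiction from a too long path w. *)

Section CliqueCount.
Variables (T : finType) (e : rel T).
Implicit Types (U S A B : {set T}) (x y : T).

Definition clique A := [forall x in A, forall y in A, (x != y) ==> e x y].
Definition cl U s := #|[set A : {set T} | [&& A \subset U, #|A| == s & clique A]]|.
Definition nbr U x := [set y in U | e x y].

Lemma cliqueP A : reflect {in A &, forall x y, x != y -> e x y} (clique A).
Proof.
apply: (iffP forall_inP) => [H x y xA yA xy | H x xA].
  by move/forall_inP: (H x xA) => /(_ y yA) /implyP; apply.
by apply/forall_inP => y yA; apply/implyP; apply: H.
Qed.

Lemma Ncliques_cl s : Ncliques e s = cl setT s.
Proof. by rewrite /Ncliques /cl; congr #|pred_of_set _|; apply/setP => A; rewrite !inE subsetT. Qed.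

Lemma sub_clique A B : A \subset B -> clique B -> clique A.
Proof.
move=> /subsetP AB /cliqueP cB; apply/cliqueP => x y xA yA; exact: (cB x y (AB x xA) (AB y yA)).
Qed.

Lemma cl_le U s : cl U s <= 'C(#|U|, s).
Proof.
rewrite -cards_draws; apply: subset_leq_card; apply/subsetP => A.
by rewrite !inE => /and3P[-> -> _].
Qed.

Lemma cl_clique U s : clique U -> cl U s = 'C(#|U|, s).
Proof.
move=> cU; rewrite -cards_draws; apply: eq_card => A; rewrite !inE.
apply/and3P/andP => [[-> ->]//|[AU ->]]; split=> //.
exact: sub_clique AU cU.
Qed.

Lemma cl_mono U S s : S \subset U -> cl S s <= cl U s.
Proof.
move=> SU; apply: subset_leq_card; apply/subsetP => A.
by rewrite !inE => /and3P[AS -> ->]; rewrite (subset_trans AS SU).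
Qed.

Lemma cl_super A B s : #|A :&: B| < s -> cl A s + cl B s <= cl (A :|: B) s.
Proof.
move=> ABs; rewrite /cl.
set CA := [set X : {set T} | [&& X \subset A, _ & _]]; set CB := [set X : {set T} | [&& X \subset B, _ & _]].
have dis : CA :&: CB = set0.
  apply/setP => X; rewrite !inE; apply/negP => /andP[/and3P[XA /eqP Xs _] /and3P[XB _ _]].
  have : #|X| <= #|A :&: B| by apply: subset_leq_card; rewrite subsetI XA.
  by rewrite Xs leqNgt ABs.
rewrite -cardsUI dis cards0 addn0; apply: subset_leq_card; apply/subsetP => X.
rewrite !inE => /orP[]/and3P[XA -> ->]; rewrite !andbT.
  exact: subset_trans XA (subsetUl _ _).
exact: subset_trans XA (subsetUr _ _).
Qed.

Hypothesis esym : symmetric e.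

Lemma cl_del U x s : x \in U -> ~~ e x x -> cl U s.+1 = cl (U :\ x) s.+1 + cl (nbr U x) s.
Proof.
move=> xU exx; rewrite /cl.
set C := [set A : {set T} | [&& A \subset U, _ & _]].
set D := [set A : {set T} | [&& A \subset U :\ x, _ & _]].
set E := [set A : {set T} | [&& A \subset nbr U x, _ & _]].
rewrite -(cardsID D C); congr (_ + _).
  apply: eq_card => A; rewrite !inE; case: (boolP (A \subset U :\ x)) => AU; last by rewrite /= andbF.
  by rewrite (subset_trans AU (subD1set _ _)) /= andbb.
have inj : {in E &, injective (fun A => x |: A)}.
  move=> A B; rewrite !inE => /and3P[/subsetP AN _ _] /and3P[/subsetP BN _ _] /setP AB.
  have xA : x \notin A by apply/negP => /AN; rewrite inE (negPf exx) andbF.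
  have xB : x \notin B by apply/negP => /BN; rewrite inE (negPf exx) andbF.
  apply/setP => y; case: (eqVneq y x) => [->|yx]; first by rewrite (negPf xA) (negPf xB).
  by move: (AB y); rewrite !inE (negPf yx).
rewrite -(card_in_imset inj); apply: eq_card => A; rewrite !inE.
apply/andP/imsetP => [[nD /and3P[AU /eqP As cA]]|[B]].
  have xA : x \in A.
    by apply: contraNT nD => xA; rewrite subsetD1 AU xA As eqxx cA.
  exists (A :\ x); last by rewrite setD1K.
  rewrite inE; apply/and3P; split.
  - apply/subsetP => y; rewrite !inE => /andP[yx yA].
    by rewrite (subsetP AU) //=; move/cliqueP: cA; apply=> //; rewrite eq_sym.
  - by move: As; rewrite (cardsD1 x) xA add1n => -[->].
  - exact: sub_clique (subD1set _ _) cA.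
rewrite inE => /and3P[/subsetP BN /eqP Bs cB] ->.
have xB : x \notin B by apply/negP => /BN; rewrite inE (negPf exx) andbF.
split.
  by rewrite subsetD1 !inE eqxx /= andbF.
apply/and3P; split.
- apply/subsetP => y; rewrite !inE => /orP[/eqP->//|/BN]; by rewrite inE => /andP[].
- by rewrite cardsU1 xB Bs.
- apply/cliqueP => y z; rewrite !inE => /orP[/eqP->|yB] /orP[/eqP->|zB] yz.
  + by rewrite eqxx in yz.
  + by move: (BN z zB); rewrite inE => /andP[].
  + by move: (BN y yB); rewrite inE esym => /andP[].
  + by move/cliqueP: cB; apply.
Qed.

Definition detached S U := forall x y, x \in S -> y \in U :\: S -> ~~ e x y.

Lemma cl_detached S U s : detached S U -> 0 < s -> S \subset U ->
  cl U s = cl S s + cl (U :\: S) s.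
Proof.
move=> det s0 SU; rewrite /cl.
set C := [set A : {set T} | [&& A \subset U, _ & _]].
set D := [set A : {set T} | [&& A \subset S, _ & _]].
set E := [set A : {set T} | [&& A \subset U :\: S, _ & _]].
have dis : D :&: E = set0.
  apply/setP => A; rewrite !inE; apply/negP => /andP[/and3P[AS /eqP As _] /and3P[AE _ _]].
  have : #|A| <= 0.
    rewrite leqn0 cards_eq0 -subset0; apply/subsetP => z zA.
    by move: (subsetP AE z zA); rewrite inE (subsetP AS).
  by rewrite As leqNgt s0.
rewrite -cardsUI dis cards0 addn0; apply: eq_card => A; rewrite !inE.
apply/and3P/orP => [[AU As cA]|[]/and3P[AS -> ->]]; last 2 first.
- by rewrite (subset_trans AS SU).
- by rewrite (subset_trans AS (subsetDl _ _)).
have [AS|/subsetPn[x xA xS]] := boolP (A \subset S); first by left; rewrite As.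
right; rewrite As cA subsetD AU !andbT /=.
rewrite disjoint_subset; apply/subsetP => y yA; rewrite !inE; apply/negP => yS.
have yx : y != x by apply: contraNneq xS => <-.
move/cliqueP: cA => /(_ y x yA xA yx); apply/negP; apply: det => //.
by rewrite inE xS (subsetP AU).
Qed.

Lemma nbr_sub U x : nbr U x \subset U.
Proof. by apply/subsetP => y; rewrite inE => /andP[]. Qed.

Lemma nbr_mono U S x : S \subset U -> nbr S x \subset nbr U x.
Proof. by move=> /subsetP SU; apply/subsetP => y; rewrite !inE => /andP[/SU -> ->]. Qed.

End CliqueCount.

(** Connectedness by cuts instead of walks: its failure hands over the set at which an induction
    splits [U]. The empty set is connected. *)
Definition conn (T : finType) (e : rel T) (U : {set T}) :=
  forall S : {set T}, S \subset U -> S != set0 -> detached e S U -> S = U.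

Lemma conn_or_split (T : finType) (e : rel T) (U : {set T}) :
  conn e U \/ exists S : {set T}, [/\ S \subset U, S != set0, S != U & detached e S U].
Proof.
pose P := [pred S : {set T} | [&& S \subset U, S != set0, S != U &
   [forall x in S, forall y in U :\: S, ~~ e x y]]].
have [/existsP[S /and4P[SU S0 SnU /forall_inP H]]|no] := boolP [exists S, P S].
  right; exists S; split=> // x y xS yS; exact: (forall_inP (H x xS)).
left=> S SU S0 det; apply/eqP; apply: contraNT no => SnU.
apply/existsP; exists S; rewrite /= SU S0 SnU /=.
by apply/forall_inP => x xS; apply/forall_inP => y yS; apply: det.
Qed.

(** * Paths *)

Section SeqLemmas.
Variables (T : Type).
Implicit Types (r : rel T) (s t w : seq T).

Lemma sorted_catI r x0 s t :
  sorted r s -> sorted r t -> r (last x0 s) (head x0 t) -> sorted r (s ++ t).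
Proof.
case: s => [//|x s] /=; case: t => [|y t] /=; first by rewrite cats0.
by move=> ps pt rl; rewrite cat_path ps /= rl.
Qed.

Lemma sorted_cat_consE r s a t :
  sorted r (s ++ a :: t) = sorted r (rcons s a) && sorted r (a :: t).
Proof. by case: s => [//|x s] /=; rewrite cat_path rcons_path /= andbA. Qed.

Lemma sorted_rcons2 r s a b : sorted r (rcons (rcons s a) b) = sorted r (rcons s a) && r a b.
Proof. by case: s => [|x s] /=; rewrite ?andbT // !rcons_path last_rcons. Qed.

Lemma sorted_mid r s a b t : sorted r (s ++ a :: b :: t) ->
  [/\ sorted r (rcons s a), r a b & sorted r (b :: t)].
Proof. by rewrite sorted_cat_consE /= => /and3P[]. Qed.

Lemma sorted_revE r s : symmetric r -> sorted r (rev s) = sorted r s.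
Proof. by move=> rs; rewrite rev_sorted; apply: eq_sorted => x y; rewrite rs. Qed.

Lemma head_rev x0 s : head x0 (rev s) = last x0 s.
Proof. by case/lastP: s => [//|s x]; rewrite rev_rcons last_rcons. Qed.

Lemma last_rev x0 s : last x0 (rev s) = head x0 s.
Proof. by rewrite -head_rev revK. Qed.

Lemma sorted_splitI r w :
  (forall s1 a b s2, w = s1 ++ a :: b :: s2 -> r a b) -> sorted r w.
Proof.
case: w => [//|x w] /=; elim: w x => [//|y w IH] x H /=.
rewrite (H [::] x y w) //=; apply: IH => s1 a b s2 E.
by apply: (H (x :: s1) a b s2); rewrite E.
Qed.

Definition noconsec (B : pred T) w := sorted (fun a b => ~~ (B a && B b)) w.

Lemma noconsec_count (B : pred T) w : noconsec B w -> count B w <= uphalf (size w).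
Proof.
have [n] := ubnP (size w); elim: n w => [//|n IH] [//|x [|y w]] /=.
  by move=> _ _; case: (B x).
rewrite ltnS => sz /andP[nxy pw].
have pw' : noconsec B w by case: w pw {sz IH} => [//|z w] /= /andP[].
have := IH w _ pw'; rewrite (leq_trans _ sz) // => /(_ isT).
by move: nxy; case: (B x); case: (B y) => //= _; lia.
Qed.

Lemma noconsec_cat (B : pred T) s t : noconsec B (s ++ t) -> noconsec B s /\ noconsec B t.
Proof. by move/cat_sorted2 => -[]. Qed.

Lemma noconsec_count_rcons (B : pred T) s z : noconsec B (rcons s z) -> ~~ B z ->
  count B (rcons s z) <= uphalf (size s).
Proof.
rewrite -cats1 => /noconsec_cat[ns _] nz; rewrite count_cat /= (negPf nz) !addn0.
exact: noconsec_count.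
Qed.

(** Pigeonhole on the [size s] pairs of consecutive entries of [x :: s]: [f] marks a pair by its
    right entry, [g] by its left one. *)
Lemma count_cross (f g : pred T) x s : size s < count f s + count g (belast x s) ->
  exists s1 a b s2, [/\ x :: s = s1 ++ a :: b :: s2, f b & g a].
Proof.
elim: s x => [//|y s IH] x /= lt.
have [/andP[fy gx]|nfg] := boolP (f y && g x); first by exists [::], x, y, s.
have [|s1 [a [b [s2 [-> fb ga]]]]] := IH y; last by exists (x :: s1), a, b, s2.
by move: lt nfg; case: (f y); case: (g x) => //= lt _; lia.
Qed.

End SeqLemmas.

Lemma longest_seq (T : finType) (P : pred (seq T)) b w0 :
  P w0 -> (forall w, P w -> size w <= b) ->
  exists2 w, P w & forall w', P w' -> size w' <= size w.
Proof.
move=> P0 Pb; pose Q n := [exists t : n.-tuple T, P t].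
have exQ : exists n, Q n by exists (size w0); apply/existsP; exists (in_tuple w0).
have Qb n : Q n -> n <= b by case/existsP => t /Pb; rewrite size_tuple.
case: (ex_maxnP exQ Qb) => n /existsP[t Pt] nmax; exists t => // w' Pw'.
by rewrite size_tuple; apply: nmax; apply/existsP; exists (in_tuple w').
Qed.

Section Paths.
Variables (T : finType) (e : rel T).
Hypotheses (esym : symmetric e) (eirr : irreflexive e).
Implicit Types (U S A B D : {set T}) (x y z : T) (w s : seq T).

Definition pth U w := [&& sorted e w, uniq w & all (mem U) w].
Definition maxpth U w := pth U w /\ forall w', pth U w' -> size w' <= size w.

Lemma pthP U w : reflect [/\ sorted e w, uniq w & {subset w <= U}] (pth U w).
Proof. by apply: (iffP and3P) => -[s1 u1 /allP a1]; split=> //; apply/allP. Qed.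

Lemma pth_size U w : pth U w -> size w <= #|U|.
Proof.
case/pthP => _ uw wU; rewrite -(card_uniqP uw); apply: subset_leq_card.
by apply/subsetP => z /wU.
Qed.

Lemma pth_cat U s t : pth U (s ++ t) -> pth U s /\ pth U t.
Proof.
rewrite /pth cat_uniq all_cat => /and3P[/cat_sorted2[-> ->]].
by move=> /and3P[-> _ ->] /andP[-> ->].
Qed.

Lemma pth_rev U w : pth U (rev w) = pth U w.
Proof. by rewrite /pth sorted_revE // rev_uniq all_rev. Qed.

Lemma pth_sub U S w : U \subset S -> pth U w -> pth S w.
Proof. by move=> /subsetP US /pthP[s1 u1 a1]; apply/pthP; split=> // z /a1 /US. Qed.

Lemma pth_take U n w : pth U w -> pth U (take n w).
Proof. by rewrite -{1}(cat_take_drop n w) => /pth_cat[]. Qed.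

Lemma maxpth_exists U : exists w, maxpth U w.
Proof.
have [w Pw mw] := @longest_seq T (pth U) #|U| [::] isT (@pth_size U).
by exists w.
Qed.

Lemma maxpth_rev U w : maxpth U w -> maxpth U (rev w).
Proof. by case=> pw mw; split; rewrite ?pth_rev // size_rev. Qed.

Lemma maxpth_nbr U x s z : maxpth U (x :: s) -> z \in U -> e x z -> z \in x :: s.
Proof.
case=> /pthP[ss us ws] mw zU exz; apply: contraT => zw.
have : size (z :: x :: s) <= size (x :: s).
  apply: mw; apply/pthP; split; first by rewrite /= esym exz.
    by rewrite cons_uniq zw.
  by move=> y; rewrite inE => /orP[/eqP->//|/ws].
by rewrite ltnn.
Qed.

Lemma card_nbr U w x : uniq w -> {subset w <= U} -> {subset nbr e U x <= w} ->
  #|nbr e U x| = count (e x) w.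
Proof.
move=> uw wU nw; rewrite -size_filter -(card_uniqP (filter_uniq _ uw)).
apply: eq_card => y; rewrite inE mem_filter andbC; apply/andP/andP => -[h1 h2]; split=> //.
  by apply: nw; rewrite inE h1 h2.
exact: wU.
Qed.

Lemma maxpth_deg U x s : maxpth U (x :: s) -> #|nbr e U x| = count (e x) s.
Proof.
move=> mw; have /pthP[_ uw wU] := proj1 mw.
rewrite (@card_nbr U (x :: s)) //= ?eirr // => z; rewrite inE => /andP[zU exz].
exact: maxpth_nbr mw zU exz.
Qed.

Lemma conn_edge U S : conn e U -> S \subset U -> S != set0 -> S != U ->
  exists x y, [/\ x \in S, y \in U :\: S & e x y].
Proof.
move=> cU SU S0 SnU.
have [/existsP[x /andP[xS /existsP[y /andP[yS exy]]]]|no] :=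
  boolP [exists x, (x \in S) && [exists y, (y \in U :\: S) && e x y]].
  by exists x, y.
case/eqP: SnU; apply: cU => // x y xS yS; apply: contra no => exy.
by apply/existsP; exists x; rewrite xS; apply/existsP; exists y; rewrite yS.
Qed.

(** If a longest path closed to a cycle, the cycle could be opened next to an edge leaving its
    vertex set, which exists by connectedness, and prolonged along that edge. *)
Lemma maxpth_no_cycle U c : conn e U -> maxpth U c -> size c < #|U| -> 0 < size c -> ~~ cycle e c.
Proof.
move=> cU [/pthP[sc uc cs] mc] szc c0; apply/negP => cyc.
pose S := [set z in c].
have SU : S \subset U by apply/subsetP => z; rewrite inE => /cs.
have cS : #|S| = size c by rewrite cardsE; apply/card_uniqP.
have [v [z [vS zS evz]]] : exists x y, [/\ x \in S, y \in U :\: S & e x y].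
  apply: conn_edge => //; first by rewrite -card_gt0 cS.
  by apply: contraTneq szc => <-; rewrite cS ltnn.
move: vS; rewrite inE => /rot_to[i c' E].
have cyc' : cycle e (v :: c') by rewrite -E rot_cycle.
move: zS; rewrite !inE => /andP[zc zU].
have : size (z :: v :: c') <= size c.
  apply: mc; apply/pthP; split.
  - rewrite /= esym evz /=; move: cyc'; rewrite /= rcons_path => /andP[] //.
  - by rewrite cons_uniq -E rot_uniq uc mem_rot zc.
  - by move=> y; rewrite inE -E mem_rot => /orP[/eqP->//|/cs].
by rewrite -[size c](size_rot i) E /= ltnn.
Qed.

(* Ore's crossing argument. *)
Lemma maxpth_crossing U x s : maxpth U (x :: s) ->
  size s < #|nbr e U x| + #|nbr e U (last x s)| ->
  exists2 c, perm_eq c (x :: s) & cycle e c.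
Proof.
move=> mw; set y := last x s.
have mwr : maxpth U (y :: rev (belast x s)).
  by rewrite -rev_rcons -lastI; apply: maxpth_rev.
rewrite (maxpth_deg mw) (maxpth_deg mwr) count_rev => cc.
have [s1 [a [b [s2 [E exb eya]]]]] := count_cross cc.
have [pw mx] := mw; have /pthP[sw uw wU] := pw.
have yE : y = last b s2 by rewrite /y -[last x s]/(last x (x :: s)) E last_cat.
(* From [x] to [a], across to the other end [y], and back along the path to [b], a neighbour of
   [x]. *)
pose c := rcons s1 a ++ rev (b :: s2).
have pc : perm_eq c (x :: s) by rewrite E /c -cat_rcons perm_cat2l perm_rev.
have [sa eab sb] : [/\ sorted e (rcons s1 a), e a b & sorted e (b :: s2)].
  by apply: sorted_mid; rewrite -E.
have sc : sorted e c.
  apply: (@sorted_catI _ _ x) => //; first by rewrite sorted_revE.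
  by rewrite last_rcons head_rev /= -yE esym.
exists c => //.
have hc : head x c = x by rewrite /c; case: s1 E {pc sa sc c} => [|x' s1] /= [-> _].
have lc : last x c = b by rewrite /c last_cat rev_cons last_rcons.
case: c sc hc lc {pc} => [//|z c] /= sc zx lc.
by rewrite rcons_path sc lc zx esym exb.
Qed.

Lemma maxpth_ends U x s : conn e U -> maxpth U (x :: s) -> size (x :: s) < #|U| ->
  #|nbr e U x| + #|nbr e U (last x s)| <= size s.
Proof.
move=> cU mw szw; rewrite leqNgt; apply/negP => /(maxpth_crossing mw)[c pc].
move=> cyc; have [pw mx] := mw; have /pthP[sw uw wU] := pw.
have mc : maxpth U c.
  split; last by rewrite (perm_size pc).
  apply/pthP; split; last by move=> z; rewrite (perm_mem pc) => /wU.
    by case: (c) cyc => [//|z c'] /=; rewrite rcons_path => /andP[].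
  by rewrite (perm_uniq pc).
have := maxpth_no_cycle cU mc; rewrite (perm_size pc) => /(_ szw isT).
by rewrite cyc.
Qed.

(** Dirac's argument: unless a longest path covers [U], the degrees of its two ends add up to at
    most its number of edges. *)
Lemma conn_long_path U d : conn e U -> {in U, forall x, d <= #|nbr e U x|} ->
  exists2 w, pth U w & size w = minn #|U| d.*2.+1.
Proof.
move=> cU dU; have [w mw] := maxpth_exists U; have [pw mx] := mw.
have big : minn #|U| d.*2.+1 <= size w.
  have [le|lt] := leqP #|U| (size w); first by rewrite geq_min le.
  case: w mw pw mx lt => [|x s] mw pw mx lt.
    have [z zU] : exists z, z \in U by apply/set0Pn; rewrite -card_gt0.
    have : size [:: z] <= 0 by apply: mx; apply/pthP; split=> // y; rewrite inE => /eqP->.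
    by [].
  have := maxpth_ends cU mw lt; have /pthP[_ _ sU] := pw.
  have := dU x (sU x (mem_head _ _)); have := dU (last x s) (sU _ (mem_last _ _)).
  by rewrite /=; lia.
exists (take (minn #|U| d.*2.+1) w); first exact: pth_take.
by rewrite size_takel.
Qed.

(** A path from [x] that cannot be prolonged contains all neighbours of its last vertex. *)
Lemma greedy_path U x d : x \in U -> {in U, forall y, d <= #|nbr e U y|} ->
  exists2 s, pth U (x :: s) & size s = d.
Proof.
move=> xU dU.
pose P w := pth U (x :: w).
have P0 : P [::] by apply/pthP; split=> // y; rewrite inE => /eqP->.
have [s Ps ms] := @longest_seq T P #|U| [::] P0 (fun w Pw => ltnW (pth_size Pw)).
have /pthP[ss us sU] := Ps.
have big : d <= size s.
  apply: leq_trans (dU (last x s) (sU _ (mem_last _ _))) _.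
  have sub : {subset nbr e U (last x s) <= x :: s}.
    move=> z; rewrite inE => /andP[zU ez]; apply: contraT => zs.
    have : size (rcons s z) <= size s.
      apply: ms; apply/pthP; split.
      - by rewrite /= rcons_path ez andbT.
      - by rewrite -rcons_cons rcons_uniq zs us.
      - by move=> y; rewrite -rcons_cons mem_rcons inE => /orP[/eqP->//|/sU].
    by rewrite size_rcons ltnn.
  rewrite (card_nbr us sU sub) lastI -cats1 count_cat /= eirr !addn0.
  by apply: leq_trans (count_size _ _) _; rewrite size_belast.
exists (take d s); last by rewrite size_takel.
by have := pth_take d.+1 Ps.
Qed.

End Paths.

(** * Linear forests *)

(** This is [delta_F + 1], without the truncated subtraction of [deltaF]. *)
Definition halves (ls : seq nat) := sumn [seq l./2 | l <- ls].

Lemma halves_cons l ls : halves (l :: ls) = l./2 + halves ls.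
Proof. by []. Qed.

Lemma sumn_halves ls : sumn ls = (halves ls).*2 + count odd ls.
Proof.
elim: ls => [//|l ls IH] /=; rewrite halves_cons doubleD IH -{1}(odd_double_half l); lia.
Qed.

Lemma lf_bounds_cons l ls : lf_bounds (l :: ls) = l :: map (addn l) (lf_bounds ls).
Proof.
rewrite /lf_bounds /= take0 /= addn0; congr (_ :: _).
rewrite -(addn1 1) iotaDl -!map_comp; apply: eq_map => i /=.
by [].
Qed.

Section Forest.
Variables (T : finType) (e : rel T).
Hypotheses (esym : symmetric e) (eirr : irreflexive e).
Implicit Types (U S A B D : {set T}) (w s : seq T) (ws : seq (seq T)).

(** A list of disjoint paths in place of an embedding of the block-labelled [lf_graph];
    [containsb_forest] translates between the two. *)
Definition forest U ls := exists ws, [/\ [seq size w | w <- ws] = ls, all (sorted e) ws,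
  uniq (flatten ws) & {subset flatten ws <= U}].

Lemma forest_nil U : forest U [::].
Proof. by exists [::]; split. Qed.

Lemma forest_sub U S ls : U \subset S -> forest U ls -> forest S ls.
Proof. by move=> /subsetP US [ws [h1 h2 h3 h4]]; exists ws; split=> // z /h4 /US. Qed.

Lemma forest_cat U S l1 l2 : [disjoint U & S] -> forest U l1 -> forest S l2 ->
  forest (U :|: S) (l1 ++ l2).
Proof.
move=> dis [ws1 [s1 a1 u1 h1]] [ws2 [s2 a2 u2 h2]].
exists (ws1 ++ ws2); split.
- by rewrite map_cat s1 s2.
- by rewrite all_cat a1.
- rewrite flatten_cat cat_uniq u1 u2 andbT /=; apply/hasPn => z /h2 zS.
  by apply/negP => /h1 zU; move: (disjointFr dis zU); rewrite zS.
- by move=> z; rewrite flatten_cat mem_cat inE => /orP[/h1->//|/h2->]; rewrite orbT.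
Qed.

Lemma forest_pth U w ls : pth e U w -> sumn ls <= size w -> forest [set z in w] ls.
Proof.
move=> /pthP[sw uw wU] le; exists (reshape ls (take (sumn ls) w)).
have sz : size (take (sumn ls) w) = sumn ls by rewrite size_takel.
split.
- by rewrite -/(shape _) reshapeKl ?sz.
- have {}sw : sorted e (take (sumn ls) w).
    by move: sw; rewrite -{1}(cat_take_drop (sumn ls) w) => /cat_sorted2[].
  move: (take _ w) sz sw => v {uw wU le}; elim: ls v => [//|l ls IH] v /= sz.
  rewrite -{1}(cat_take_drop l v) => /cat_sorted2[-> sd] /=; apply: IH => //.
  by rewrite size_drop sz addKn.
- by rewrite reshapeKr ?sz // take_uniq.
- by rewrite reshapeKr ?sz // => z /mem_take; rewrite inE.
Qed.

Lemma forest_pth1 U w : pth e U w -> forest [set z in w] [:: size w].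
Proof. by move=> pw; apply: forest_pth pw _; rewrite /= addn0. Qed.

Lemma forest_perm U ls ls' : perm_eq ls ls' -> forest U ls -> forest U ls'.
Proof.
rewrite perm_sym => pe [ws [sz so un su]].
have /(perm_iotaP 0)[Is pI E] : perm_eq ls' [seq size w | w <- ws] by rewrite sz.
have pw : perm_eq [seq nth [::] ws i | i <- Is] ws.
  by apply/(perm_iotaP [::]); exists Is; rewrite ?size_map // in pI *.
have pf := perm_flatten pw.
exists [seq nth [::] ws i | i <- Is]; split.
- rewrite E -map_comp; apply/eq_in_map => i iI /=.
  rewrite (nth_map [::]) //; move: iI; rewrite (perm_mem pI) mem_iota size_map.
  by case/andP.
- by rewrite (perm_all _ pw).
- by rewrite (perm_uniq pf).
- by move=> z; rewrite (perm_mem pf) => /su.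
Qed.

(** Read on the concatenated list, an edge is demanded at every position except where a new path
    begins, which is how [lf_graph] describes the forest. *)
Lemma blocks_sorted x0 ws :
  all (sorted e) ws <-> (forall i, i.+1 < size (flatten ws) ->
    i.+1 \notin lf_bounds [seq size w | w <- ws] ->
    e (nth x0 (flatten ws) i) (nth x0 (flatten ws) i.+1)).
Proof.
elim: ws => [//|w ws IH] /=; rewrite lf_bounds_cons size_cat; split.
  move=> /andP[sw /IH H] i lt; rewrite inE negb_or => /andP[iw ib].
  rewrite !nth_cat; case: (ltngtP i.+1 (size w)) iw => // iw _.
    by apply: (sortedP x0 sw).
  rewrite subSn //; apply: H; first by lia.
  apply: contra ib => ib; apply/mapP; exists (i - size w).+1 => //; lia.
move=> H; apply/andP; split.
  apply/(sortedP x0) => i iw.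
  have := H i; rewrite !nth_cat iw (ltnW iw); apply; first by lia.
  rewrite inE negb_or neq_ltn iw /=; apply/negP => /mapP[j _ E]; lia.
apply/IH => i lt ib; have := H (size w + i).
have nr k : nth x0 (w ++ flatten ws) (size w + k) = nth x0 (flatten ws) k.
  by rewrite nth_cat ltnNge leq_addr /= addKn.
rewrite -addnS !nr; apply; first by lia.
rewrite inE negb_or -{2}[size w]addn0 eqn_add2l /= mem_map //; exact: addnI.
Qed.

Lemma containsb_forest ls : 0 < sumn ls -> containsb e (lf_graph ls) <-> forest setT ls.
Proof.
move=> pos; split.
  case/existsP => f /andP[/injectiveP finj /forallP H].
  pose x0 := f (Ordinal pos).
  pose w := [seq f i | i <- enum 'I_(sumn ls)].
  have sz : size w = sumn ls by rewrite size_map size_enum_ord.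
  have nthw i (lti : i < sumn ls) : nth x0 w i = f (Ordinal lti).
    rewrite (nth_map (Ordinal pos)) ?size_enum_ord //; congr (f _); apply: val_inj.
    by rewrite /= nth_enum_ord.
  have fl : flatten (reshape ls w) = w by rewrite reshapeKr ?sz.
  have sh : [seq size v | v <- reshape ls w] = ls by rewrite -/(shape _) reshapeKl ?sz.
  exists (reshape ls w); split=> //.
  - apply/(blocks_sorted x0); rewrite fl sh sz => i lt ib.
    rewrite (nthw _ (ltnW lt)) (nthw _ lt).
    have := forallP (H (Ordinal (ltnW lt))) (Ordinal lt) => /implyP; apply.
    rewrite /lf_graph /= eqxx /=; by rewrite (maxn_idPr _).
  - by rewrite fl map_inj_uniq // enum_uniq.
  - by move=> z _; rewrite inE.
case=> ws [sz so un _].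
have szf : size (flatten ws) = sumn ls by rewrite size_flatten /shape sz.
have [x0 _] : exists x : T, true by case: (flatten ws) szf pos => [<-//|x]; exists x.
move/(blocks_sorted x0): so; rewrite szf sz => H.
apply/existsP; exists [ffun i : 'I_(sumn ls) => nth x0 (flatten ws) i]; apply/andP; split.
  apply/injectiveP => i j; rewrite !ffunE => /eqP; rewrite nth_uniq ?szf //.
  by move/eqP/val_inj.
apply/forallP => u; apply/forallP => v; apply/implyP; rewrite /lf_graph !ffunE.
case/andP => /orP[]/eqP E; rewrite -E.
  by rewrite (maxn_idPr _) // => ib; apply: H => //; rewrite E.
by rewrite (maxn_idPl _) // => ib; rewrite esym; apply: H => //; rewrite E.
Qed.

(** Greedy filling, longest first: it stops at a length exceeding the room left, and this length is
    at most the first one taken, so more than half of [c] is filled. *)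
Lemma prefix_fill ls c : sorted geq ls -> all (fun l => l <= c) ls ->
  exists l1 l2, [/\ ls = l1 ++ l2, sumn l1 <= c & l2 = [::] \/ c < (sumn l1).*2].
Proof.
move=> so al.
have [l1 [l2 [E le mx]]] : exists l1 l2, [/\ ls = l1 ++ l2, sumn l1 <= c &
    if l2 is x :: _ then c < sumn l1 + x else true].
  elim: ls c {so al} => [|x ls IH] c; first by exists [::], [::].
  have [xc|cx] := leqP x c; last by exists [::], (x :: ls).
  have [l1 [l2 [-> le mx]]] := IH (c - x); exists (x :: l1), l2; split=> //=; first by lia.
  by case: l2 mx => //= y _; lia.
exists l1, l2; split=> //; case: l2 E mx => [|x l2] E mx; first by left.
right; case: l1 E le mx => [|y l1] E le mx.
  move: al; rewrite E /= => /andP[]; rewrite /= add0n in mx; lia.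
have xy : x <= y.
  have gt : transitive geq by move=> a b c' /= h1 h2; apply: leq_trans h2 h1.
  move: so; rewrite E /= (path_sortedE gt) => /andP[/allP al' _].
  by apply: al'; rewrite mem_cat mem_head orbT.
move: mx => /=; lia.
Qed.

(** Unless all of [ls] fits into [w2], a prefix of it fills more than half of the at least [h]
    vertices of [w2], hence more vertices than there are odd lengths. What is left of the total
    [2h + count odd] fits into the [2h - 1] vertices of [w1]. *)
Lemma forest_two_paths U w1 w2 l1 ls h :
  pth e U w1 -> pth e U w2 -> [disjoint [set z in w1] & [set z in w2]] ->
  sorted geq (l1 :: ls) -> h = halves (l1 :: ls) ->
  all (fun l => 2 <= l) (l1 :: ls) -> (count odd (l1 :: ls)).*2 <= h -> 0 < size ls ->
  h.*2 <= (size w1).+1 -> h <= size w2 -> all (fun l => l <= size w2) ls ->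
  forest U (l1 :: ls).
Proof.
move=> p1 p2 dis so hE a2 od k2 s1 s2 al.
have so' : sorted geq ls by move: so => /= /path_sorted.
have [I1 [I2 [E le mx]]] := prefix_fill so' al.
have hpos : 0 < halves ls.
  case: ls {so so' hE od al E} k2 a2 => [//|l ls] _ /= /and3P[_ l2 _].
  by rewrite halves_cons; lia.
have tot := sumn_halves (l1 :: ls).
move: od tot; rewrite -hE; set o := count _ _ => od tot.
have f1 : forest [set z in w1] (l1 :: I2).
  apply: forest_pth p1 _; case: mx => [I20|mx].
    rewrite I20 /=; move: hE; rewrite halves_cons; lia.
  move: tot; rewrite E /= sumn_cat; lia.
have f2 : forest [set z in w2] I1 by apply: forest_pth p2 _.
have /(forest_sub _) f := forest_cat dis f1 f2.
apply: (@forest_perm _ (l1 :: I2 ++ I1)).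
  by rewrite perm_cons E perm_catC.
apply: f; rewrite subUset; have /pthP[_ _ h1] := p1; have /pthP[_ _ h2] := p2.
by apply/andP; split; apply/subsetP => z; rewrite inE; [exact: h1|exact: h2].
Qed.

(** Every path is long enough for any single length, so the greedy filling uses more than half of
    each path until [ls] is exhausted; this explains the factor 2. *)
Lemma forest_bins ls (ws : seq (seq T)) U :
  sorted geq ls -> all (sorted e) ws -> uniq (flatten ws) -> {subset flatten ws <= U} ->
  all (fun w => head 0 ls <= size w) ws -> (sumn ls).*2 <= size (flatten ws) ->
  forest U ls.
Proof.
elim: ws ls U => [|w ws IH] ls U so aw uw sU hd tot.
  have := tot; rewrite /= leqn0 double_eq0 => /eqP s0.
  have p0 : pth e U [::] by [].
  by apply: forest_sub (forest_pth p0 _); rewrite ?s0 //; apply/subsetP => z; rewrite inE.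
move: aw hd => /= /andP[sw aws] /andP[hw hws].
have gt : transitive geq by move=> a b c' /= h1 h2; apply: leq_trans h2 h1.
have al : all (fun l => l <= size w) ls.
  case: ls so hw {hws tot} => [//|l ls] /=; rewrite (path_sortedE gt) => /andP[/allP al _] lw.
  by rewrite lw /=; apply/allP => x /al /= xl; apply: leq_trans lw.
have [I1 [I2 [E le mx]]] := prefix_fill so al.
have pw : pth e [set z in w] w.
  by apply/pthP; split=> // [|z]; [move: uw; rewrite /= cat_uniq => /andP[] | rewrite inE].
have f1 := forest_pth pw le.
move: uw; rewrite /= cat_uniq => /and3P[uw0 nh uws].
have f2 : forest [set z in flatten ws] I2.
  apply: IH => //.
  - by move: so; rewrite E => /cat_sorted2[].
  - by move=> z; rewrite inE.
  - apply: sub_all hws => v; apply: leq_trans; rewrite E in so *.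
    case: I2 {E mx} so => [//|b I2]; case: I1 {le f1} => [//|a I1] /=.
    by rewrite (path_sortedE gt) => /andP[/allP al' _]; apply: al'; rewrite mem_cat mem_head orbT.
  - case: mx => [->//|mx]; move: tot; rewrite /= size_cat E sumn_cat; lia.
rewrite E; apply: forest_sub (forest_cat _ f1 f2).
  by apply/subsetP => z; rewrite !inE -mem_cat => /sU.
rewrite disjoint_subset; apply/subsetP => z; rewrite !inE => zw; apply: contraNN nh => zf.
by apply/hasP; exists z.
Qed.

End Forest.

(** * Cleaning, components and rerouting *)

Section Decompose.
Variables (T : finType) (e : rel T).
Hypotheses (esym : symmetric e) (eirr : irreflexive e).
Implicit Types (U S A B D V : {set T}) (x y z : T) (w s : seq T).

Lemma detachedC S U : S \subset U -> detached e S U -> detached e (U :\: S) U.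
Proof.
move=> SU det x y; rewrite setDDr setDv set0U (setIidPr SU) => xS yS.
by rewrite esym; apply: det.
Qed.

Lemma nbr_detached S U x : S \subset U -> detached e S U -> x \in S -> nbr e S x = nbr e U x.
Proof.
move=> SU det xS; apply/setP => y; rewrite !inE; apply/andP/andP => -[h1 h2]; split=> //.
  exact: (subsetP SU).
apply: contraT => yS; suff : ~~ e x y by rewrite h2.
by apply: det => //; rewrite inE yS.
Qed.

Lemma card_split S U : S \subset U -> #|S| + #|U :\: S| = #|U|.
Proof. by move=> SU; rewrite -(cardsID S U) (setIidPr SU). Qed.

(* The induction of Kopylov and Luo: in a connected set on at least [l] vertices some end of a
   longest path has degree at most [(l - 2)./2] and can be deleted. *)
Lemma pathfree_bound (val : {set T} -> nat) (g : nat -> nat) l U : 1 < l ->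
  (forall S V, S \subset V -> detached e S V -> val V <= val S + val (V :\: S)) ->
  (forall V, #|V| < l -> val V <= g #|V|) ->
  (forall V x, x \in V -> l <= #|V| -> #|nbr e V x| <= (l - 2)./2 ->
     val (V :\ x) <= g #|V|.-1 -> val V <= g #|V|) ->
  (forall a b, g a + g b <= g (a + b)) ->
  (forall w, pth e U w -> size w < l) -> val U <= g #|U|.
Proof.
move=> l2 vsplit vsmall vdel gadd.
have [n] := ubnP #|U|; elim: n U => [//|n IH] U; rewrite ltnS => Un free.
have IH' V : V \subset U -> #|V| < #|U| -> val V <= g #|V|.
  move=> VU lt; apply: IH; first exact: leq_trans lt Un.
  by move=> w /(pth_sub VU); apply: free.
have [Ul|lU] := ltnP #|U| l; first exact: vsmall.
have [cU|[S [SU S0 SnU det]]] := conn_or_split e U; last first.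
  have cs := card_split SU.
  have lt1 : #|S| < #|U| by rewrite proper_card // properEneq SnU.
  have lt2 : #|U :\: S| < #|U| by move: S0; rewrite -card_gt0; lia.
  apply: leq_trans (vsplit _ _ SU det) _; rewrite -cs.
  by apply: leq_trans (gadd _ _); apply: leq_add; apply: IH' => //; apply: subsetDl.
have [w mw] := maxpth_exists e U; have [pw mx] := mw.
have wl := free _ pw.
case: w mw pw mx wl => [|x s] mw pw mx wl.
  have [z zU] : exists z, z \in U by apply/set0Pn; rewrite -card_gt0; lia.
  have : size [:: z] <= 0 by apply: mx; apply/pthP; split=> // y; rewrite inE => /eqP->.
  by [].
have ends := maxpth_ends esym eirr cU mw (leq_trans wl lU).
have /pthP[_ _ sU] := pw.
have [z zU zd] : exists2 z, z \in U & #|nbr e U z| <= (l - 2)./2.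
  move: ends wl => /= ends wl.
  have [h|h] := leqP #|nbr e U x| #|nbr e U (last x s)|.
    by exists x; [apply: sU; rewrite mem_head | lia].
  by exists (last x s); [apply: sU; rewrite mem_last | lia].
have c1 : #|U :\ z| = #|U|.-1 by rewrite (cardsD1 z U) zU.
have U0 : 0 < #|U| by lia.
apply: vdel zU lU zd _.
by rewrite -c1; apply: IH'; [apply: subsetDl | rewrite c1; lia].
Qed.

Lemma cl_del_le V x j d : x \in V -> #|nbr e V x| <= d ->
  cl e V j.+2 <= cl e (V :\ x) j.+2 + 'C(d, j.+1).
Proof.
move=> xV dx; rewrite (@cl_del _ _ esym V x) ?eirr // leq_add2l.
by apply: leq_trans (cl_le _ _ _) _; apply: leq_bin2l.
Qed.

(* [U] is left after repeatedly deleting a vertex of degree at most [d], or two adjacent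
   vertices of degree [d+1]; the factor 2 is the average over such a pair. *)
Lemma cleaning d j V : exists U, [/\ U \subset V,
  {in U, forall x, d.+1 <= #|nbr e U x|},
  {in U &, forall x y, e x y -> (d.+2 <= #|nbr e U x|) || (d.+2 <= #|nbr e U y|)} &
  (cl e V j.+2).*2 <= (cl e U j.+2).*2 + (#|V| - #|U|) * ('C(d, j.+1).*2 + 'C(d, j))].
Proof.
have [n] := ubnP #|V|; elim: n V => [//|n IH] V; rewrite ltnS => Vn.
have [/existsP[x /andP[xV dx]]|no1] := boolP [exists x, (x \in V) && (#|nbr e V x| <= d)].
  have c1 : #|V| = #|V :\ x|.+1 by rewrite (cardsD1 x V) xV.
  have [|U [UV dU pU cU]] := IH (V :\ x); first by rewrite -c1.
  exists U; split=> //; first by apply: subset_trans UV (subsetDl _ _).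
  have cl1 := cl_del_le j xV dx; have := subset_leq_card UV => UVc.
  have -> : #|V| - #|U| = (#|V :\ x| - #|U|).+1 by rewrite c1 subSn.
  rewrite mulSn; lia.
have [/existsP[x /existsP[y /and5P[xV yV exy dx dy]]]|no2] :=
  boolP [exists x, exists y, [&& x \in V, y \in V, e x y, #|nbr e V x| <= d.+1 &
     #|nbr e V y| <= d.+1]].
  have yx : y != x by apply: contraTneq exy => ->; rewrite eirr.
  have yV' : y \in V :\ x by rewrite !inE yx.
  have c1 : #|V| = #|V :\ x|.+1 by rewrite (cardsD1 x V) xV.
  have c2 : #|V :\ x| = #|V :\ x :\ y|.+1 by rewrite (cardsD1 y (V :\ x)) yV'.
  have [|U [UV dU pU cU]] := IH (V :\ x :\ y); first by move: Vn; rewrite c1 c2; lia.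
  exists U; split=> //; first by rewrite (subset_trans UV) // (subset_trans (subsetDl _ _)) ?subsetDl.
  have dy' : #|nbr e (V :\ x) y| <= d.
    rewrite -ltnS; apply: leq_trans dy; apply: proper_card; apply/properP; split.
      by apply: nbr_mono; apply: subsetDl.
    by exists x; rewrite !inE ?xV ?eqxx // esym.
  have cl1 := cl_del_le j xV dx; have cl2 := cl_del_le j yV' dy'.
  have := subset_leq_card UV => UVc.
  have -> : #|V| - #|U| = (#|V :\ x :\ y| - #|U|).+2 by rewrite c1 c2 subSn ?subSn // ltnW.
  (* By Pascal's rule the cost [C(d+1, j+1) + C(d, j+1)] of the pair is [2 C(d, j+1) + C(d, j)],
     twice the average of the statement. *)
  move: cl1; rewrite binS !mulSn; lia.
exists V; split=> //; last by lia.
  move=> x xV; rewrite ltnNge; apply: contra no1 => dx.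
  by apply/existsP; exists x; rewrite xV.
move=> x y xV yV exy; apply: contraNT no2; rewrite negb_or -!leqNgt => /andP[dx dy].
by apply/existsP; exists x; apply/existsP; exists y; rewrite xV yV exy dx.
Qed.

Definition disjoint_family (Ds : seq {set T}) :=
  uniq Ds /\ {in Ds &, forall D D', D != D' -> [disjoint D & D']}.

Lemma components U : exists Ds : seq {set T}, [/\ disjoint_family Ds,
  {in Ds, forall D, [/\ conn e D, D != set0, D \subset U & detached e D U]},
  {in U, forall x, exists2 D, D \in Ds & x \in D} &
  \sum_(D <- Ds) #|D| = #|U|].
Proof.
have [n] := ubnP #|U|; elim: n U => [//|n IH] U; rewrite ltnS => Un.
have [->|U0] := eqVneq U set0.
  by exists [::]; split=> // [x|]; rewrite ?inE // big_nil cards0.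
have [cU|[S [SU S0 SnU det]]] := conn_or_split e U.
  exists [:: U]; split; last by rewrite big_seq1.
  - by split=> // D D'; rewrite !inE => /eqP-> /eqP->; rewrite eqxx.
  - by move=> D; rewrite inE => /eqP->; split=> // x y _; rewrite setDv inE.
  - by move=> x xU; exists U; rewrite ?mem_head.
have cs := card_split SU.
have lt1 : #|S| < #|U| by rewrite proper_card // properEneq SnU.
have lt2 : #|U :\: S| < #|U| by move: S0; rewrite -card_gt0; lia.
have [Ds1 [[u1 d1] p1 c1 s1]] := IH S (leq_trans lt1 Un).
have [Ds2 [[u2 d2] p2 c2 s2]] := IH (U :\: S) (leq_trans lt2 Un).
have dS : [disjoint S & U :\: S] by rewrite -setI_eq0 setIDA setIC setDIl setDv setI0.
have dd D D' : D \in Ds1 -> D' \in Ds2 -> [disjoint D & D'].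
  move=> /p1[_ _ DS _] /p2[_ _ D'S _].
  by apply: disjointWl DS _; apply: disjointWr D'S _.
exists (Ds1 ++ Ds2); split; last by rewrite big_cat /= s1 s2.
  split.
    rewrite cat_uniq u1 u2 andbT; apply/hasPn => D D2; apply/negP => D1.
    have := dd _ _ D1 D2; have [_ D0 _ _] := p1 _ D1.
    by rewrite -setI_eq0 setIid (negPf D0).
  move=> D D'; rewrite !mem_cat => /orP[D1|D2] /orP[D1'|D2'] nD.
  - exact: d1.
  - exact: dd.
  - by rewrite disjoint_sym; apply: dd.
  - exact: d2.
have trans D V : V \subset U -> detached e V U -> D \subset V -> detached e D V -> detached e D U.
  move=> VU dV DV dD x y xD; rewrite inE => /andP[yD yU].
  have [yV|yV] := boolP (y \in V); first by apply: dD => //; rewrite inE yD.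
  by apply: dV; rewrite ?inE ?yV // (subsetP DV).
  move=> D; rewrite mem_cat => /orP[/p1[cD D0 DS dD]|/p2[cD D0 DS dD]]; split=> //.
- exact: subset_trans DS SU.
- exact: trans det DS dD.
- exact: subset_trans DS (subsetDl _ _).
- apply: (trans _ (U :\: S)) => //; [exact: subsetDl | exact: detachedC].
move=> x xU; have [xS|xS] := boolP (x \in S).
  by have [D DD xD] := c1 x xS; exists D; rewrite // mem_cat DD.
have [|D DD xD] := c2 x; first by rewrite inE xS.
by exists D; rewrite // mem_cat DD orbT.
Qed.

Lemma sum_card_le (Ds : seq {set T}) k : {in Ds, forall D, #|D| <= k} ->
  \sum_(D <- Ds) #|D| <= size Ds * k.
Proof.
elim: Ds => [|D Ds IH] H; first by rewrite big_nil.
rewrite big_cons mulSn leq_add ?H ?mem_head //; apply: IH => D' h.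
by apply: H; rewrite inE h orbT.
Qed.

Lemma family_paths (Ds : seq {set T}) : disjoint_family Ds ->
  {in Ds, forall D, exists2 w, pth e D w & size w = #|D|} ->
  exists ws, [/\ all (sorted e) ws, uniq (flatten ws),
    forall z, z \in flatten ws -> exists2 D, D \in Ds & z \in D,
    {in ws, forall w, exists2 D, D \in Ds & size w = #|D|} &
    size (flatten ws) = \sum_(D <- Ds) #|D|].
Proof.
elim: Ds => [|D Ds IH] [uD dD] pD; first by exists [::]; rewrite big_nil; split.
have [||ws [sw uw subw szw sumw]] := IH.
- split; first by case/andP: uD.
  by move=> A B AD BD; apply: dD; rewrite inE ?AD ?BD orbT.
- by move=> A AD; apply: pD; rewrite inE AD orbT.
have [w pw wD] := pD D (mem_head _ _); have /pthP[sw' uw' wU] := pw.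
exists (w :: ws); split.
- by rewrite /= sw'.
- rewrite /= cat_uniq uw' uw andbT; apply/hasPn => z /subw[D' D'Ds zD'].
  apply/negP => /wU zD; have nD : D != D' by apply: contraTneq uD => ->; rewrite /= D'Ds.
  have D'in : D' \in D :: Ds by rewrite inE D'Ds orbT.
  by have := disjointFr (dD D D' (mem_head _ _) D'in nD) zD; rewrite zD'.
- move=> z; rewrite /= mem_cat => /orP[/wU zD|/subw[D' D'Ds zD']].
    by exists D; rewrite ?mem_head.
  by exists D'; rewrite // inE D'Ds orbT.
- move=> v; rewrite inE => /orP[/eqP->|/szw[D' D'Ds E]]; first by exists D; rewrite ?mem_head.
  by exists D'; rewrite // inE D'Ds orbT.
- by rewrite big_cons /= size_cat wD sumw.
Qed.

(** A path that meets two members has a stretch from one to another with no vertex of the family in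
    between. In the first alternative [D1] need not belong to [Ds]. *)
Lemma family_first_crossing (Ds : seq {set T}) W : disjoint_family Ds ->
  (exists D1, forall v D, v \in W -> D \in Ds -> v \in D -> D = D1) \/
  (exists W1 a M b W2 Da Db, [/\ W = W1 ++ a :: M ++ b :: W2, Da \in Ds /\ Db \in Ds,
     Da != Db, a \in Da /\ b \in Db &
     forall v D, v \in M -> D \in Ds -> v \notin D]).
Proof.
move=> [_ dis].
have same D D' v : D \in Ds -> D' \in Ds -> v \in D -> v \in D' -> D = D'.
  move=> h1 h2 vD vD'; apply/eqP; apply: contraTT vD' => nD.
  by rewrite (disjointFr (dis _ _ h1 h2 nD) vD).
elim: W => [|v W IH]; first by left; exists set0.
case: IH => [[D1 H]|]; last first.
  move=> [W1 [a [M [b [W2 [Da [Db [-> h2 h3 h4 h5]]]]]]]]; right.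
  by exists (v :: W1), a, M, b, W2, Da, Db.
pose inD := [pred u | has (fun D : {set T} => u \in D) Ds].
have [vD|vD] := boolP (inD v); last first.
  left; exists D1 => u D; rewrite inE => /orP[/eqP->|]; last exact: H.
  by move=> DDs uD; case/hasP: vD; exists D.
have [D DDs vinD] := hasP vD.
have [hW|hW] := boolP (has inD W); last first.
  left; exists D => u D'; rewrite inE => /orP[/eqP->|uW] D'Ds uD'; first exact: same uD' vinD.
  by case/hasP: hW; exists u => //; apply/hasP; exists D'.
case/split_find: hW H => b M W2 bD Mno H.
have [Db DbDs bDb] := hasP bD.
have D1E : Db = D1.
  by apply: (H b) => //; rewrite mem_cat mem_rcons mem_head.
have [E|nD] := eqVneq D D1.
  left; exists D1 => u D'; rewrite inE => /orP[/eqP->|]; last exact: H.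
  by move=> D'Ds uD'; rewrite -E; apply: same uD' vinD.
right; exists [::], v, M, b, W2, D, Db; split=> //; first by rewrite /= cat_rcons.
  by rewrite D1E.
move=> u D' uM D'Ds; apply: contra Mno => uD'.
by apply/hasP; exists u => //; apply/hasP; exists D'.
Qed.

(* Take a subpath joining two members and otherwise disjoint from the family, and prolong it
   inside both of them. *)
Lemma reroute (Ds : seq {set T}) S d W : disjoint_family Ds ->
  {in Ds, forall D, D \subset S} ->
  {in Ds, forall D, {in D, forall x, exists2 s, pth e D (x :: s) & size s = d}} ->
  pth e S W -> size W <= d.+1.*2 ->
  exists W' D1 D2, [/\ pth e S W', size W' = size W &
    forall D, D \in Ds -> D != D1 -> D != D2 -> [disjoint D & [set z in W']]].
Proof.
move=> dDs DS long pW szW.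
case: (family_first_crossing W dDs) => [[D1 H]|].
  exists W, D1, D1; split=> // D DDs nD _; rewrite disjoint_sym disjoint_subset.
  apply/subsetP => z; rewrite inE => zW; apply: contra nD => zD.
  by rewrite (H z D).
move=> [W1 [a [M [b [W2 [Da [Db [E [DaDs DbDs] nD [aDa bDb] HM]]]]]]]].
have [sa pa za] := long _ DaDs _ aDa; have [sb pb zb] := long _ DbDs _ bDb.
have /pthP[ssa usa saD] := pa; have /pthP[ssb usb sbD] := pb.
have disab : [disjoint Da & Db] by case: dDs => _; apply.
have [pM pM'] : pth e S (a :: M ++ b :: W2) /\ pth e S (M ++ [:: b]).
  move: pW; rewrite E => /pth_cat[_ h]; split=> //; move: h.
  rewrite -cat1s => /pth_cat[_]; rewrite -cat_rcons -cats1 => /pth_cat[] //.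
have /pthP[sM uM MS] := pM.
pose W' := rev (a :: sa) ++ M ++ b :: sb.
have sW' : sorted e W'.
  move: sM; rewrite -[a :: _]cat1s catA sorted_cat_consE => /andP[sM _].
  rewrite /W' rev_cons cat_rcons.
  rewrite sorted_cat_consE -rev_cons sorted_revE // ssa /=.
  have -> : path e a (M ++ b :: sb) = sorted e ((a :: M) ++ b :: sb) by [].
  by rewrite sorted_cat_consE sM.
have uW' : uniq W'.
  rewrite /W' !cat_uniq rev_uniq usa usb andbT andTb.
  have uMM : uniq M by move: uM; rewrite /= cat_uniq => /and3P[_ ? _].
  apply/and3P; split=> //.
    apply/hasPn => z; rewrite mem_cat mem_rev => /orP[zM|/sbD zb'].
      by apply/negP => /saD; apply/negP; apply: HM.
    by apply/negP => /saD za'; have := disjointFr disab za'; rewrite zb'.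
  apply/hasPn => z /sbD zb'; apply/negP => zM; by have := HM z Db zM DbDs; rewrite zb'.
have W'S : {subset W' <= S}.
  move=> z; rewrite /W' mem_cat mem_rev mem_cat => /orP[/saD|/orP[zM|/sbD]].
  - exact: (subsetP (DS _ DaDs)).
  - by apply: MS; rewrite inE mem_cat zM orbT.
  - exact: (subsetP (DS _ DbDs)).
(* The two arms of [d + 1] vertices each already make up for all of [W], however short [M] is. *)
have szW' : size W <= size W'.
  apply: leq_trans szW _; by rewrite /W' !size_cat size_rev /= za zb -addnn leq_add2l leq_addl.
exists (take (size W) W'), Da, Db; split.
- by apply: pth_take; apply/pthP.
- by rewrite size_takel.
move=> D DDs nDa nDb; rewrite disjoint_sym disjoint_subset.
apply/subsetP => z; rewrite inE => /mem_take zW'; rewrite !inE.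
have [_ dis] := dDs.
move: zW'; rewrite /W' mem_cat mem_rev mem_cat => /orP[/saD zD|/orP[zM|/sbD zD]].
- by rewrite (disjointFl (dis _ _ DDs DaDs nDa) zD).
- exact: HM.
- by rewrite (disjointFl (dis _ _ DDs DbDs nDb) zD).
Qed.

End Decompose.

(** * Forests from a long path and independent vertices *)

Section Scan.
Variables (T : finType) (e : rel T).
Hypotheses (esym : symmetric e) (eirr : irreflexive e).
Implicit Types (U X : {set T}) (x y z : T) (w s : seq T) (B : pred T).

(** Satisfied when [B] consists of neighbours of vertices off a longest path [w], since the last
    vertex of [w] has no neighbour off it. *)
Definition last_out B w := forall s z, w = rcons s z -> ~~ B z.

Lemma noconsec_last_count B w : noconsec B w -> last_out B w -> count B w <= (size w)./2.
Proof.
case/lastP: w => [//|w z] nc lo.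
apply: leq_trans (noconsec_count_rcons nc (lo w z erefl)) _.
by rewrite size_rcons.
Qed.

Lemma last_out_cat B s t : last_out B (s ++ t) -> last_out B t.
Proof. by move=> lo t' z E; apply: (lo (s ++ t')); rewrite E rcons_cat. Qed.

Lemma count_none B s : (forall z, z \in s -> ~~ B z) -> count B s = 0.
Proof. by move=> H; apply/eqP; rewrite -leqn0 leqNgt -has_count; apply/hasPn. Qed.

Lemma noconsec_count3 B s g : noconsec B s -> size s = g.*2 -> 0 < g ->
  (forall z, z \in take 3 s -> ~~ B z) -> count B s < g.
Proof.
move=> nc sz g0 H.
rewrite -(cat_take_drop 3 s) count_cat (count_none H) add0n.
move: nc; rewrite -{1}(cat_take_drop 3 s) => /noconsec_cat[_ /noconsec_count].
rewrite size_drop sz; lia.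
Qed.

(** At most one vertex of [X] is used up per path. The first bound will keep a union of
    neighbourhoods of [X'] down to [delta_F] vertices. The second is better by one if the first
    three vertices of [w] avoid [B]; it will force each vertex of [X'] to have a neighbour among
    these three. *)
Definition scan_fail X X' ls w := [/\ X' \subset X, #|X| <= #|X'| + size ls &
  forall B, (forall b, B b -> exists2 x, x \in X' & e x b) -> noconsec B w -> last_out B w ->
   count B w < halves ls /\
   ((forall z, z \in take 3 w -> ~~ B z) -> 1 < size ls -> (count B w).+1 < halves ls)].

Lemma halves_gt0 ls : all (fun l => 2 <= l) ls -> 0 < size ls -> 0 < halves ls.
Proof. by case: ls => [//|l ls] /= /andP[l2 _] _; rewrite halves_cons; lia. Qed.

(* Cut [w] from left to right into pieces, one for each path of the forest. A piece for a path
   with [2g+1] vertices consists of [2g] vertices of [w] and a fresh vertex of [X] adjacent to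
   an end of the piece if there is one, and of [2g+1] vertices of [w] otherwise. When this gets
   stuck, the neighbourhoods of the unused part [X'] of [X] are tightly packed in [w]. *)
Lemma scan X ls w : all (fun l => 2 <= l) ls -> all (fun l => l != 3) ls ->
  pth e setT w -> (forall x, x \in X -> x \notin w) ->
  forest e (X :|: [set z in w]) ls \/ exists X', scan_fail X X' ls w.
Proof.
elim: ls X w => [|l ls IH] X w; first by left; apply: forest_nil.
move=> /= /andP[l2 a2] /andP[l3 a3] pw Xw.
have [g gE] : {g | l./2 = g} by exists l./2.
have g0 : 0 < g by lia.
have hpos := halves_gt0 a2.
have lE := odd_double_half l; rewrite gE in lE.
have [lt|ge] := ltnP (size w) g.*2.
  right; exists X; split=> //; first by lia.
  move=> B _ nc lo; have := noconsec_last_count nc lo; rewrite halves_cons gE => h.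
  by split=> [|_ /= k2]; [|have := hpos k2]; lia.
(* Common to all ways of serving [l]: the path [v] spends an initial segment [w1] of [w] and at most
   one vertex of [X], and [w1] contains at most [l./2] elements of [B]. *)
have step w1 w2 v X1 : w = w1 ++ w2 -> pth e setT v -> size v = l -> X1 \subset X ->
    #|X| <= #|X1|.+1 -> (forall z, z \in v -> [|| z \in w1 | (z \in X) && (z \notin X1)]) ->
    (forall B, (forall b, B b -> exists2 x, x \in X1 & e x b) -> noconsec B w1 ->
        (count B w1 <= g) /\ ((forall z, z \in take 3 w -> ~~ B z) -> count B w1 < g)) ->
    forest e (X :|: [set z in w]) (l :: ls) \/ exists X', scan_fail X X' (l :: ls) w.
  move=> E pv vl X1X cX vsub cB.
  have [_ pw2] : pth e setT w1 /\ pth e setT w2 by apply: pth_cat; rewrite -E.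
  have uw : uniq (w1 ++ w2) by rewrite -E; case/pthP: pw.
  have Xw2 x : x \in X1 -> x \notin w2.
    by move/(subsetP X1X)/Xw; rewrite E mem_cat negb_or => /andP[].
  case: (IH X1 w2 a2 a3 pw2 Xw2) => [f2|[X' [X'1 cX' H]]].
    left; rewrite -cat1s.
    have fv : forest e [set z in v] [:: l] by rewrite -vl; apply: forest_pth1 pv.
    apply: forest_sub (forest_cat _ fv f2).
      apply/subsetP => z; rewrite !inE E mem_cat => /or3P[/vsub|/(subsetP X1X)->|->].
      - by case/orP => [->|/andP[->]]; rewrite ?orbT.
      - by [].
      - by rewrite !orbT.
    rewrite disjoint_subset; apply/subsetP => z; rewrite !inE => /vsub /orP[zw1|/andP[zX zX1]].
      rewrite negb_or; apply/andP; split.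
        by apply: contraL zw1 => /(subsetP X1X)/Xw; rewrite E mem_cat negb_or => /andP[].
      by move: uw; rewrite cat_uniq => /and3P[_ /hasPn h _]; apply: contraL zw1 => /h.
    rewrite negb_or zX1; apply: contra (Xw z zX) => zw2; by rewrite E mem_cat zw2 orbT.
  right; exists X'; split.
  - exact: subset_trans X'1 X1X.
  - by rewrite /=; clear -cX cX'; lia.
  move=> B B1 nc lo; have [nc1 nc2] : noconsec B w1 /\ noconsec B w2.
    by apply: noconsec_cat; rewrite -E.
  have lo2 : last_out B w2 by apply: (@last_out_cat _ w1); rewrite -E.
  have [H1 _] := H B B1 nc2 lo2.
  have [c1 c2] : (count B w1 <= g) /\ ((forall z, z \in take 3 w -> ~~ B z) -> count B w1 < g).
    by apply: cB => // b /B1[x xX' exb]; exists x => //; apply: (subsetP X'1).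
  have cw : count B w = count B w1 + count B w2 by rewrite E count_cat.
  rewrite cw halves_cons gE; split; first by rewrite -addnS leq_add.
  by move=> /c2 h _; rewrite -addnS -addSn leq_add.
have [ol|el] := boolP (odd l); last first.
  have {}lE : l = g.*2 by move: lE; rewrite (negPf el).
  have szt : size (take g.*2 w) = g.*2 by rewrite size_takel.
  apply: (step (take g.*2 w) (drop g.*2 w) (take g.*2 w) X) => //.
  - by rewrite cat_take_drop.
  - exact: pth_take.
  - by rewrite szt.
  - by move=> z ->.
  - move=> B _ nc; split; first by have := noconsec_count nc; rewrite szt; lia.
    move=> H; apply: (noconsec_count3 nc) => // z zt; apply: H.
    rewrite -(cat_take_drop g.*2 w) take_cat szt; case: ltnP => // _.
    by rewrite mem_cat (mem_take zt).
have {}lE : l = g.*2.+1 by rewrite -lE ol.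
have g2 : 1 < g by move: l3; rewrite lE; lia.
have [a [mid [c [rest [E szm]]]]] : exists a mid c rest,
    w = a :: mid ++ c :: rest /\ size mid = (g.-1).*2.
  case: w ge {pw Xw step} => [|a w] /= ge; first by lia.
  have := cat_take_drop (g.-1).*2 w; case D : (drop _ w) => [|c rest] E.
    have := size_drop (g.-1).*2 w; rewrite D /=; lia.
  exists a, (take (g.-1).*2 w), c, rest; split; first by rewrite E.
  by rewrite size_takel //; lia.
have c1 B : noconsec B (a :: rcons mid c) -> (count B (a :: rcons mid c) <= g) /\
    ((forall z, z \in take 3 w -> ~~ B z) -> count B (a :: rcons mid c) < g).
  move=> nc; have sz1 : size (a :: rcons mid c) = g.*2 by rewrite /= size_rcons szm; lia.
  split; first by have := noconsec_count nc; rewrite sz1; lia.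
  move=> H; apply: (noconsec_count3 nc) => // z zt; apply: H.
  have -> : w = (a :: rcons mid c) ++ rest by rewrite E /= cat_rcons.
  rewrite take_cat sz1; case: ltnP => // _; by rewrite mem_cat (mem_take zt).
have E1 : w = (a :: rcons mid c) ++ rest by rewrite E /= cat_rcons.
have [p1 _] : pth e setT (a :: rcons mid c) /\ pth e setT rest by apply: pth_cat; rewrite -E1.
have [/existsP[x /andP[xX xac]]|none] := boolP [exists x, (x \in X) && (e x a || e x c)].
  have xw : x \notin a :: rcons mid c.
    by have := Xw x xX; rewrite E1 mem_cat negb_or => /andP[].
  have sub v : v =i x :: a :: rcons mid c ->
      forall z, z \in v -> [|| z \in a :: rcons mid c | (z \in X) && (z \notin X :\ x)].
    move=> vE z; rewrite vE inE => /orP[/eqP->|->//].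
    by rewrite xX !inE eqxx orbT.
  have cX : #|X| <= #|X :\ x|.+1 by rewrite (cardsD1 x X) xX.
  have [s1 u1 _] := pthP _ _ _ p1.
  case/orP: xac => xa.
    apply: (step (a :: rcons mid c) rest (x :: a :: rcons mid c) (X :\ x)) => //.
    - apply/pthP; split => [||z _]; last by rewrite inE.
        by rewrite /= xa.
      by rewrite cons_uniq xw.
    - by rewrite /= size_rcons szm lE; clear -g2; lia.
    - exact: subsetDl.
    - exact: sub.
    - by move=> B _; apply: c1.
  apply: (step (a :: rcons mid c) rest (rcons (a :: rcons mid c) x) (X :\ x)) => //.
  - apply/pthP; split => [||z _]; last by rewrite inE.
      by rewrite -rcons_cons sorted_rcons2 /= esym xa andbT.
    by rewrite rcons_uniq xw.
  - by rewrite size_rcons /= size_rcons szm lE; clear -g2; lia.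
  - exact: subsetDl.
  - by apply: sub => z; rewrite mem_rcons.
  - by move=> B _; apply: c1.
have out B X1 : X1 \subset X -> (forall b, B b -> exists2 x, x \in X1 & e x b) ->
    ~~ B a /\ ~~ B c.
  move=> X1X B1; split; apply: contra none => /B1[x xX1 ex]; apply/existsP; exists x.
    by rewrite (subsetP X1X) // ex.
  by rewrite (subsetP X1X) // ex orbT.
(* If only [2g] vertices are left, one too few, then fewer than [g] of them are in [B], because both
   ends [a] and [c] avoid [B]. *)
case: rest E E1 => [|d rest] E E1.
  right; exists X; split=> //; first by rewrite /=; lia.
  move=> B B1 nc _; have [nBa nBc] := out B X (subxx _) B1.
  have cnt : count B w < g.
    move: nc; rewrite E -cat1s => /noconsec_cat[_].
    rewrite -cat1s count_cat /= (negPf nBa) /= addn0 add0n cats1 => nc.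
    have := noconsec_count_rcons nc nBc; rewrite szm; clear -g2; lia.
  rewrite halves_cons gE; split=> [|_ k2]; [|have := hpos k2]; clear -cnt; lia.
have E2 : w = rcons (a :: rcons mid c) d ++ rest by rewrite E1 cat_rcons.
have sz2 : size (rcons (a :: rcons mid c) d) = l by rewrite size_rcons /= size_rcons szm lE; clear -g2; lia.
apply: (step (rcons (a :: rcons mid c) d) rest (rcons (a :: rcons mid c) d) X) => //.
- by have [] : pth e setT (rcons (a :: rcons mid c) d) /\ pth e setT rest by apply: pth_cat; rewrite -E2.
- by move=> z ->.
- move=> B B1 nc; have [nBa nBc] := out B X (subxx _) B1.
  (* Spending the extra vertex [d] keeps the bound [g]: [a] and [c] avoid [B], [mid] has at most
     [g - 1] elements of [B], and [d] may be one more. *)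
  have cE : count B (rcons (a :: rcons mid c) d) = count B mid + B d.
    by rewrite -!cats1 /= !count_cat /= (negPf nBa) (negPf nBc) !addn0.
  have ncm : noconsec B mid.
    move: nc; rewrite -cats1 => /noconsec_cat[h _].
    by move: h; rewrite -cat1s => /noconsec_cat[_]; rewrite -cats1 => /noconsec_cat[].
  rewrite cE; split.
    by have := noconsec_count ncm; rewrite szm; clear -g2; case: (B d) => /=; lia.
  move=> H.
  case: mid E szm ncm {E1 E2 sz2 p1 c1 cE nc} => [|m1 [|m2 mid]] /= E szm ncm.
  - by clear -szm g2; lia.
  - by clear -szm g2; lia.
  have B1' : ~~ B m1 by apply: H; rewrite E /= !inE eqxx orbT.
  have B2' : ~~ B m2 by apply: H; rewrite E /= !inE eqxx !orbT.
  rewrite (negPf B1') (negPf B2').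
  have ncm' : noconsec B mid.
    by have /noconsec_cat[] : noconsec B ([:: m1; m2] ++ mid) by exact: ncm.
  by have := noconsec_count ncm'; clear -szm g2; case: (B d) => /=; lia.
Qed.

End Scan.

(** * Forests between a set and its common neighbours *)

Fixpoint zigzag (T : Type) (s t : seq T) :=
  match s, t with a :: s', x :: t' => a :: x :: zigzag s' t' | _, _ => [::] end.

Lemma halves_le ls : halves ls <= sumn ls.
Proof. by rewrite sumn_halves; lia. Qed.

Section Bipartite.
Variables (T : finType) (e : rel T).
Hypotheses (esym : symmetric e) (eirr : irreflexive e).
Implicit Types (U A X S : {set T}) (x y z a : T) (w s t p : seq T).

Lemma perm_zigzag s t : size s = size t -> perm_eq (zigzag s t) (s ++ t).
Proof.
elim: s t => [|a s IH] [|x t] //= [sz]; rewrite perm_cons.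
by rewrite perm_sym (perm_catCA s [:: x] t) /= perm_cons perm_sym IH.
Qed.

Lemma zigzag_path y s t : size s = size t -> {in s & t, forall a x, e a x} ->
  (if s is a :: _ then e y a else true) -> path e y (zigzag s t).
Proof.
elim: s t y => [|a s IH] [|x t] y //= [sz] bip eya.
rewrite eya bip ?mem_head //=; apply: IH => //.
  by move=> a' x' h1 h2; apply: bip; rewrite inE ?h1 ?h2 orbT.
by case: s {sz} bip => [//|b s] bip; rewrite esym bip ?mem_head // inE mem_head orbT.
Qed.

Lemma zigzag_sorted s t : size s = size t -> {in s & t, forall a x, e a x} ->
  sorted e (zigzag s t).
Proof.
case: s t => [|a s] [|x t] //= [sz] bip; rewrite bip ?mem_head //=; apply: zigzag_path => //.
  by move=> a' x' h1 h2; apply: bip; rewrite inE ?h1 ?h2 orbT.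
by case: s {sz} bip => [//|b s] bip; rewrite esym bip ?mem_head // inE mem_head orbT.
Qed.

Lemma forest_cons_path w ls S : sorted e w -> uniq w ->
  forest e S ls -> (forall z, z \in w -> z \notin S) -> forest e ([set z in w] :|: S) (size w :: ls).
Proof.
move=> sw uw fS wS; rewrite -cat1s; apply: forest_cat => //.
  rewrite disjoint_subset; apply/subsetP => z; rewrite !inE; exact: wS.
by apply: (@forest_pth1 _ _ setT); apply/pthP; split=> // z; rewrite inE.
Qed.

(** Every path alternates between the sides and spends [l./2] vertices of [s]; one of odd order
    begins and ends in [t]. *)
Lemma forest_bip s t ls : uniq (s ++ t) -> {in s & t, forall a x, e a x} ->
  halves ls <= size s -> sumn ls <= halves ls + size t -> forest e [set z in s ++ t] ls.
Proof.
elim: ls s t => [|l ls IH] s t u bip hs ht; first exact: forest_nil.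
move: hs ht; rewrite halves_cons /=; set g := l./2 => hs ht; have lE := odd_double_half l.
have hls := halves_le ls.
have ht1 : odd l + g <= size t by rewrite /g; lia.
pose s1 := take g s; pose s2 := drop g s; pose t1 := take (odd l + g) t; pose t2 := drop (odd l + g) t.
have sE : s = s1 ++ s2 by rewrite cat_take_drop.
have tE : t = t1 ++ t2 by rewrite cat_take_drop.
have z1 : size s1 = g by rewrite size_takel //; lia.
have z2 : size t1 = odd l + g by rewrite size_takel.
have pst : perm_eq (s ++ t) ((s1 ++ t1) ++ (s2 ++ t2)).
  by rewrite {1}sE {1}tE -!catA perm_cat2l !catA perm_cat2r perm_catC.
have u' : uniq ((s1 ++ t1) ++ (s2 ++ t2)) by rewrite -(perm_uniq pst).
have [u1 nu u2] : [/\ uniq (s1 ++ t1), ~~ has (mem (s1 ++ t1)) (s2 ++ t2) & uniq (s2 ++ t2)].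
  by move: u'; rewrite cat_uniq => /and3P[].
have b1 : {in s1 & t1, forall a x, e a x}.
  by move=> a x h1 h2; apply: bip; rewrite ?sE ?tE mem_cat ?h1 ?h2.
have f2 : forest e [set z in s2 ++ t2] ls.
  apply: IH => //; first by move=> a x h1 h2; apply: bip; rewrite ?sE ?tE mem_cat ?h1 ?h2 orbT.
    by move: hs; rewrite sE size_cat z1; lia.
  by move: ht; rewrite tE size_cat z2 /g; lia.
have [w [sw pw]] : exists w, sorted e w /\ perm_eq w (s1 ++ t1).
  have [ol|el] := boolP (odd l); last first.
    exists (zigzag s1 t1); rewrite (negPf el) in z2.
    by split; [apply: zigzag_sorted | apply: perm_zigzag]; rewrite ?z1 ?z2.
  rewrite ol in z2; case: t1 z2 b1 {tE pst u' u1 nu} => [|x t1] //= [z2] b1.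
  exists (x :: zigzag s1 t1); split.
    rewrite /=; apply: zigzag_path; first by rewrite z1 z2.
      by move=> a y h1 h2; apply: b1; rewrite // inE h2 orbT.
    by case: s1 {sE z1} b1 => [//|a s1] b1; rewrite esym b1 ?mem_head.
  by rewrite perm_sym (perm_catCA s1 [:: x] t1) /= perm_cons perm_sym perm_zigzag // z1 z2.
have sz : size w = l by rewrite (perm_size pw) size_cat z1 z2 /g; clear -lE; lia.
rewrite -sz; apply: forest_sub (forest_cons_path sw _ f2 _).
- apply/subsetP => z; rewrite !inE (perm_mem pw) -!mem_cat => h.
  by rewrite (perm_mem pst).
- by rewrite (perm_uniq pw).
- move=> z; rewrite (perm_mem pw) inE => zst; apply: contraNN nu => h.
  by apply/hasP; exists z.
Qed.

(** The first path follows [y :: p] and then alternates through [j] vertices of [A] and [j] of [X];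
    [forest_bip] finds the others in what is left. *)
Lemma forest_prefix y p j ls U A X : sorted e (y :: p) -> uniq (y :: p) ->
  {subset y :: p <= U} -> A \subset U -> X \subset U ->
  (forall z, z \in y :: p -> (z \notin A) && (z \notin X)) -> [disjoint A & X] ->
  {in A & X, forall a x, e a x} -> (0 < j -> exists2 a, a \in A & e (last y p) a) ->
  j + halves ls <= #|A| -> j + (sumn ls - halves ls) <= #|X| ->
  forest e U (size (y :: p) + j.*2 :: ls).
Proof.
move=> sp up pU AU XU pAX dAX bip ea cA cX.
have hls := halves_le ls.
(* An enumeration of [A] that starts with a neighbour of the end of the prefix, so that the
   alternating part can be appended. *)
have [s [us sA s0]] : exists s, [/\ uniq s, s =i A & 0 < j -> if s is a :: _ then e (last y p) a else true].
  case: j ea {cA cX} => [|j] ea; first by exists (enum A); split=> //; [exact: enum_uniq|exact: mem_enum].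
  have [a aA ya] := ea isT; exists (a :: enum (A :\ a)); split=> //.
    by rewrite /= enum_uniq mem_enum !inE eqxx.
  move=> z; rewrite inE mem_enum !inE; case: eqVneq => [->|//]; by rewrite aA.
have szs : size s = #|A| by rewrite -(card_uniqP us); apply: eq_card.
pose t := enum X; have szt : size t = #|X| by rewrite -cardE.
pose s1 := take j s; pose s2 := drop j s; pose t1 := take j t; pose t2 := drop j t.
have sE : s = s1 ++ s2 by rewrite cat_take_drop.
have tE : t = t1 ++ t2 by rewrite cat_take_drop.
have z1 : size s1 = j by rewrite size_takel //; lia.
have z2 : size t1 = j by rewrite size_takel //; lia.
have ut : uniq t by exact: enum_uniq.
have inA z : z \in s -> z \in A by rewrite sA.
have inX z : z \in t -> z \in X by rewrite mem_enum.
have bst : {in s & t, forall a x, e a x} by move=> a x /inA h1 /inX h2; apply: bip.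
have dst z : z \in s -> z \notin t by move=> /inA zA; rewrite mem_enum (disjointFr dAX zA).
have f2 : forest e [set z in s2 ++ t2] ls.
  apply: forest_bip.
  - rewrite cat_uniq; move: us ut; rewrite sE tE !cat_uniq => /and3P[_ _ ->] /and3P[_ _ ->].
    rewrite andbT /=; apply/hasPn => z zt; apply/negP => zs.
    have := dst z; rewrite sE tE !mem_cat zs zt !orbT => /(_ isT) //.
  - by move=> a x h1 h2; apply: bst; rewrite ?sE ?tE mem_cat ?h1 ?h2 orbT.
  - by rewrite size_drop szs; lia.
  - by rewrite size_drop szt; lia.
have z12 : size s1 = size t1 by rewrite z1 z2.
have pz := perm_zigzag z12.
pose w := (y :: p) ++ zigzag s1 t1.
have wE : perm_eq w ((y :: p) ++ (s1 ++ t1)) by rewrite perm_cat2l.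
have szw : size w = size (y :: p) + j.*2.
  by rewrite (perm_size wE) !size_cat z1 z2 addnn.
have st z : z \in s1 ++ t1 -> z \in s ++ t.
  by rewrite sE tE !mem_cat => /orP[]->; rewrite ?orbT.
have pst z : z \in y :: p -> z \notin s ++ t.
  by move=> /pAX/andP[zA zX]; rewrite mem_cat sA mem_enum negb_or zA.
have u12 : uniq ((s1 ++ t1) ++ (s2 ++ t2)).
  rewrite -(perm_uniq (_ : perm_eq (s ++ t) _)); last first.
    by rewrite {1}sE {1}tE -!catA perm_cat2l !catA perm_cat2r perm_catC.
  by rewrite cat_uniq us ut andbT; apply/hasPn => z zt; apply/negP => /dst; rewrite zt.
have [u1 nu _] : [/\ uniq (s1 ++ t1), ~~ has (mem (s1 ++ t1)) (s2 ++ t2) & uniq (s2 ++ t2)].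
  by move: u12; rewrite cat_uniq => /and3P[].
have sw : sorted e w.
  rewrite /w /= cat_path; apply/andP; split; first exact: sp.
  apply: zigzag_path; first by rewrite z1.
    by move=> a x h1 h2; apply: bst; rewrite ?sE ?tE mem_cat ?h1 ?h2.
  rewrite /s1; case: (j) s0 => [|j']; first by rewrite take0.
  by case: (s) => [//|a s'] /= ->.
have uw : uniq w.
  rewrite (perm_uniq wE) cat_uniq up u1 andbT; apply/hasPn => z /st zst.
  by apply/negP => /pst; rewrite zst.
rewrite -szw; apply: forest_sub (forest_cons_path sw uw f2 _).
- have ww z : z \in w -> z \in y :: p \/ z \in s1 ++ t1.
    by rewrite (perm_mem wE) mem_cat => /orP.
  apply/subsetP => z; rewrite in_setU !in_set => /orP[/ww[/pU//|/st]|h].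
    by rewrite mem_cat => /orP[/inA/(subsetP AU)|/inX/(subsetP XU)].
  have : z \in s ++ t.
    by rewrite sE tE !mem_cat; move: h; rewrite mem_cat => /orP[]->; rewrite ?orbT.
  by rewrite mem_cat => /orP[/inA/(subsetP AU)|/inX/(subsetP XU)].
- move=> z; rewrite (perm_mem wE) mem_cat in_set => /orP[/pst|h].
    by apply: contra; rewrite mem_cat sE tE !mem_cat => /orP[]->; rewrite ?orbT.
  by apply: contraNN nu => h'; apply/hasP; exists z.
Qed.

End Bipartite.

(** * Edges outside a common neighbourhood *)

Section Structure.
Variables (T : finType) (e : rel T).
Hypotheses (esym : symmetric e) (eirr : irreflexive e).
Implicit Types (U A B X S Z : {set T}) (x y z a : T) (w s t p : seq T) (ls : seq nat).

Lemma edge_neq x y : e x y -> x != y.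
Proof. by apply: contraTneq => ->; rewrite eirr. Qed.

(** Any [l] of [ls] may be the path with the prescribed start, which may itself pass through
    vertices of [A] outside [B]. Its continuation needs [j] vertices of [B] where [forest_bip] would
    spend [l./2] of [A]; this is how a vertex of [A] gets saved. *)
Lemma forest_prefix_rem p l j ls U A B X y : l \in ls ->
  sorted e (y :: p) -> uniq (y :: p) ->
  {subset y :: p <= U} -> A \subset U -> X \subset U -> B \subset A ->
  (forall z, z \in y :: p -> z \notin B) -> [disjoint A & X] ->
  {in A & X, forall a x, e a x} -> (0 < j -> exists2 a, a \in B & e (last y p) a) ->
  l = size (y :: p) + j.*2 -> halves ls <= #|B| + (l./2 - j) -> j <= l./2 ->
  sumn ls + size [seq z <- y :: p | z \in X] + j + l./2 <= #|X| + l + halves ls ->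
  forest e U ls.
Proof.
move=> lls sp up pU AU XU BA pB dAX bip ea lE hB jl hX.
have pl := perm_to_rem lls.
have hE : halves ls = l./2 + halves (rem l ls).
  by rewrite /halves (perm_sumn (perm_map half pl)).
have sE : sumn ls = l + sumn (rem l ls) by rewrite (perm_sumn pl).
have hr := halves_le (rem l ls).
apply: (@forest_perm _ _ _ (l :: rem l ls)); first by rewrite perm_sym.
rewrite {1}lE; apply: (@forest_prefix _ _ esym _ _ _ _ _ B (X :\: [set z in y :: p])) => //.
- exact: subset_trans BA AU.
- exact: subset_trans (subsetDl _ _) XU.
- by move=> z zp; rewrite pB //= in_setD in_set zp.
- by apply: disjointWl BA _; apply: disjointWr (subsetDl _ _) _.
- by move=> a x aB; rewrite in_setD => /andP[_ xX]; apply: bip => //; apply: (subsetP BA).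
- clear -hB hE jl; lia.
have : #|X| <= #|X :\: [set z in y :: p]| + size [seq z <- y :: p | z \in X].
  rewrite -(cardsID [set z in y :: p] X) addnC leq_add2l -(card_uniqP (filter_uniq _ up)).
  by apply: subset_leq_card; apply/subsetP => z; rewrite !in_setI in_set mem_filter.
clear -hX hE sE hr; lia.
Qed.

(** [A] is one vertex too small for [forest_bip]. That vertex is saved by a path running partly
    outside [A]: along an edge if its length is even; if all lengths are odd, along a path on three
    vertices or along two disjoint edges linked through one vertex of [A]. Without the forest, only
    a single edge can remain. *)
Lemma bip_structure U A X ls : conn e U -> A \subset U -> X \subset U -> [disjoint A & X] ->
  {in A & X, forall a x, e a x} -> all (fun l => 2 <= l) ls -> all (fun l => l != 3) ls ->
  1 < size ls -> halves ls = #|A|.+1 -> {in U, forall x, #|A| <= #|nbr e U x|} ->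
  sumn ls < #|X| + halves ls ->
  forest e U ls \/ exists u v, {in U :\: A &, forall x y, e x y ->
     all odd ls && ((x == u) && (y == v) || (x == v) && (y == u))}.
Proof.
move=> cU AU XU dAX bip a2 a3 sz hE dU cX.
have A0 : 0 < #|A|.
  case: ls {a3 cX} a2 sz hE => [//|l1 [//|l2 ls]] /= /and3P[h1 h2 _] _.
  rewrite !halves_cons; clear -h1 h2; lia.
have [a0 a0A] : exists a, a \in A by apply/set0Pn; rewrite -card_gt0.
have inZ z : (z \in U :\: A) = (z \in U) && (z \notin A) by rewrite inE andbC.
have AUi a : a \in A -> a \in U by apply: (subsetP AU).
have XZ x : x \in X -> x \notin A by move=> xX; rewrite (disjointFl dAX xX).
have fsz (p : seq T) : size [seq z <- p | z \in X] <= size p by rewrite size_filter count_size.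
pose touch z := [exists a, (a \in A) && e z a].
have [/existsP[u0 /existsP[v0 /and3P[u0Z v0Z uv0]]]|noE] :=
  boolP [exists x, exists y, [&& x \in U :\: A, y \in U :\: A & e x y]]; last first.
  right; exists a0, a0 => x y xZ yZ exy; case/negP: noE.
  by apply/existsP; exists x; apply/existsP; exists y; rewrite xZ yZ.
have [/existsP[u /existsP[v /and4P[uZ vZ uv tu]]]|noT] := boolP [exists u, exists v,
   [&& u \in U :\: A, v \in U :\: A, e u v & touch u]]; last first.
  (* If no edge off [A] touched [A], the vertices on such edges would be detached, hence all of [U],
     although [a0] is not among them. *)
  pose S := [set z in U :\: A | [exists y, (y \in U :\: A) && e z y]].
  have SU : S = U.
    apply: cU.
    - by apply/subsetP => z; rewrite inE inZ => /andP[/andP[]].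
    - by apply/set0Pn; exists u0; rewrite inE u0Z; apply/existsP; exists v0; rewrite v0Z.
    - move=> x y; rewrite inE => /andP[xZ /existsP[y' /andP[y'Z exy']]] yS.
      apply: contra noT => exy; have := yS; rewrite !inE => /andP[nyS yU].
      have [yA|yA] := boolP (y \in A).
        apply/existsP; exists x; apply/existsP; exists y'; rewrite xZ y'Z exy' /=.
        by apply/existsP; exists y; rewrite yA.
      case/negP: nyS; rewrite yA yU /=; apply/existsP; exists x.
      by rewrite xZ esym.
  have : a0 \in S by rewrite SU AUi.
  by rewrite inE inZ a0A andbF.
have [a aA ua] : exists2 a, a \in A & e u a by case/existsP: tu => a /andP[]; exists a.
move: (uZ) (vZ); rewrite !inZ => /andP[uU uA] /andP[vU vA].
have [/allP odds|/allPn[l lls el]] := boolP (all odd ls); last first.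
  have lE := odd_double_half l; rewrite (negPf el) in lE.
  have l2 := allP a2 l lls.
  left; apply: (@forest_prefix_rem [:: u] l (l./2).-1 ls U A A X v) => //.
  - by rewrite /= esym uv.
  - by rewrite /= inE andbT esym in uv *; rewrite edge_neq // esym.
  - by move=> z; rewrite !inE => /orP[]/eqP->.
  - by move=> z; rewrite !inE => /orP[]/eqP->.
  - by exists a.
  - rewrite /=; clear -lE l2; lia.
  - rewrite hE; clear -lE l2; lia.
  - clear; lia.
  - have := fsz [:: v; u]; rewrite [size [:: v; u]]/=; clear -cX lE l2; lia.
(* There are at least two paths, and each length is odd and at least 5. *)
have {sz}A3 : 2 < #|A|.
  case: ls {cX} a2 a3 sz hE odds => [//|l1 [//|l2 ls]] /= /and3P[h1 h2 _] /and3P[k1 k2 _] _ hE odds.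
  have o1 : odd l1 by apply: odds; rewrite inE eqxx.
  have o2 : odd l2 by apply: odds; rewrite !inE eqxx orbT.
  move: hE; rewrite !halves_cons; clear -h1 h2 k1 k2 o1 o2; lia.
have [l lls] : exists l, l \in ls.
  by case: ls {a2 a3 cX odds} hE => [//|l ls] _; exists l; rewrite mem_head.
have l5 : 4 < l.
  have := allP a2 l lls; have := allP a3 l lls; have := odds l lls; clear; lia.
have lE := odd_double_half l; rewrite odds // in lE.
have path3 z1 z2 z3 b : z1 \in U :\: A -> z2 \in U :\: A -> z3 \in U :\: A -> z1 != z3 ->
    e z1 z2 -> e z2 z3 -> b \in A -> e z1 b -> forest e U ls.
  rewrite !inZ => /andP[z1U z1A] /andP[z2U z2A] /andP[z3U z3A] n13 e12 e23 bA zb.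
  have n12 := edge_neq e12; have n23 := edge_neq e23.
  apply: (@forest_prefix_rem [:: z2; z1] l (l./2).-1 ls U A A X z3) => //.
  - by rewrite /= [e z3 _]esym e23 esym e12.
  - by rewrite /= !inE negb_or [z3 == _]eq_sym n23 [z3 == _]eq_sym n13 [z2 == _]eq_sym n12.
  - by move=> z; rewrite !inE => /or3P[]/eqP->.
  - by move=> z; rewrite !inE => /or3P[]/eqP->.
  - by exists b.
  - rewrite /=; clear -lE l5; lia.
  - rewrite hE; clear -l5; lia.
  - clear; lia.
  - have := fsz [:: z3; z2; z1]; rewrite [size [:: z3; z2; z1]]/=; clear -cX lE l5; lia.
have [/existsP[z1 /existsP[z2 /existsP[z3 /and5P[z1Z z2Z z3Z n13 /and3P[e12 e23 t1]]]]]|no3] :=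
  boolP [exists z1, exists z2, exists z3, [&& z1 \in U :\: A, z2 \in U :\: A,
     z3 \in U :\: A, z1 != z3 & [&& e z1 z2, e z2 z3 & touch z1]]].
  by left; case/existsP: t1 => b /andP[bA zb]; apply: (path3 z1 z2 z3 b).
have allT z : z \in U :\: A -> touch z.
  (* A vertex [x] off [A] without neighbour in [A] has two neighbours [y], [y'] off [A]. If [y]
     touched [A], then [y x y'] would be a path excluded by [no3]; so the set of such [x] is
     detached. *)
  pose S := [set z in U :\: A | ~~ touch z].
  have [S0|S0] := eqVneq S set0.
    by move=> zZ; apply: contraT => nt; move/setP: S0 => /(_ z); rewrite inE zZ nt inE.
  have SU : S = U.
    apply: cU => //; first by apply/subsetP => x; rewrite inE inZ => /andP[/andP[]].
    move=> x y; rewrite inE => /andP[xZ ntx]; rewrite inE => /andP[yS yU].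
    apply/negP => exy.
    have yA : y \notin A by apply: contra ntx => yA; apply/existsP; exists y; rewrite yA.
    have yZ : y \in U :\: A by rewrite inZ yU.
    have ty : touch y by apply: contraNT yS => ty; rewrite inE yZ.
    have xU : x \in U by move: xZ; rewrite inZ => /andP[].
    have [y' y'y y'N] : exists2 y', y' != y & y' \in nbr e U x.
      have : 1 < #|nbr e U x| by apply: leq_trans (dU x xU); apply: ltnW.
      rewrite (cardsD1 y) inE yU exy ltnS => /card_gt0P[y']; rewrite in_setD1 => /andP[h1 h2].
      by exists y'.
    move: y'N; rewrite inE => /andP[y'U exy'].
    have y'A : y' \notin A by apply: contra ntx => y'A; apply/existsP; exists y'; rewrite y'A.
    case/negP: no3; apply/existsP; exists y; apply/existsP; exists x; apply/existsP; exists y'.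
    by rewrite yZ xZ inZ y'U y'A eq_sym y'y esym exy exy' ty.
  have : a0 \in S by rewrite SU AUi.
  by rewrite inE inZ a0A andbF.
have matching x y y' : x \in U :\: A -> y \in U :\: A -> y' \in U :\: A ->
    e x y -> e x y' -> y = y'.
  move=> xZ yZ y'Z exy exy'; apply/eqP; apply: contraNT no3 => n.
  apply/existsP; exists y; apply/existsP; exists x; apply/existsP; exists y'.
  by rewrite yZ xZ y'Z n esym exy exy' allT.
have [/existsP[u' /existsP[v' /and4P[u'Z v'Z uv' n']]]|none] := boolP [exists u', exists v',
   [&& u' \in U :\: A, v' \in U :\: A, e u' v' & ~~ ((u' == u) && (v' == v) || (u' == v) && (v' == u))]];
   last first.
  right; exists u, v => x y xZ yZ exy; rewrite /=.
  apply: contraNT none => n; apply/existsP; exists x; apply/existsP; exists y.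
  by rewrite xZ yZ exy.
left.
have vu : e v u by rewrite esym.
have vu' : e v' u' by rewrite esym.
have nuu : u' != u.
  by apply: contra n' => /eqP E; rewrite E eqxx -(matching u v v') ?eqxx // -E.
have nuv : u' != v.
  by apply: contra n' => /eqP E; rewrite E eqxx -(matching v u v') ?eqxx ?orbT // -E.
have nvu : v' != u.
  by apply: contra nuv => /eqP E; rewrite -(matching u v u') // -E.
have nvv : v' != v.
  by apply: contra nuu => /eqP E; rewrite -(matching v u u') // -E.
have cA x y : x \in U :\: A -> y \in U :\: A -> e x y -> #|A| <= #|nbr e A x|.+1.
  move=> xZ yZ exy; have xU : x \in U by move: xZ; rewrite inZ => /andP[].
  apply: leq_trans (dU x xU) _.
  apply: leq_trans (_ : #|y |: nbr e A x| <= _); last by rewrite cardsU1; case: (_ \notin _).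
  apply: subset_leq_card; apply/subsetP => z; rewrite !inE => /andP[zU exz].
  have [zA|zA] := boolP (z \in A); first by rewrite exz orbT.
  by rewrite (matching x z y) ?eqxx // inZ zU.
(* The edges off [A] form a matching, so [u] and [u'] each miss at most one of the at least three
   vertices of [A]. *)
have [b bA [ub u'b]] : exists2 b, b \in A & e u b /\ e u' b.
  have : 0 < #|nbr e A u :&: nbr e A u'|.
    have := cardsUI (nbr e A u) (nbr e A u').
    have : #|nbr e A u :|: nbr e A u'| <= #|A|.
      by apply: subset_leq_card; rewrite subUset !nbr_sub.
    have := cA u v uZ vZ uv; have := cA u' v' u'Z v'Z uv'; clear -A3; lia.
  by case/card_gt0P => b; rewrite !inE => /andP[/andP[bA h1] /andP[_ h2]]; exists b.
have [b' b'A [b'b v'b']] : exists2 b', b' \in A & b' != b /\ e v' b'.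
  have : 1 < #|nbr e A v'| by have := cA v' u' v'Z u'Z vu'; clear -A3; lia.
  rewrite (cardsD1 b) => h.
  have : 0 < #|nbr e A v' :\ b| by move: h; case: (_ \in _) => /=; clear; lia.
  by case/card_gt0P => b'; rewrite !inE => /and3P[h1 h2 h3]; exists b'.
move: (u'Z) (v'Z); rewrite !inZ => /andP[u'U u'A] /andP[v'U v'A].
have nA x : x \notin A -> b != x by move=> xA; apply: contraNneq xA => <-.
(* The start [v u b u' v'] spends one vertex of [A] on five places; with the [l./2 - 2] used
   afterwards this is one less than [l./2]. *)
apply: (@forest_prefix_rem [:: u; b; u'; v'] l (l./2 - 2) ls U A (A :\ b) X v) => //.
- by rewrite /= vu ub [e b _]esym u'b uv'.
- rewrite /= !inE !negb_or (edge_neq vu) (edge_neq uv') (nA u') // (nA v') //.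
  rewrite [v == b]eq_sym (nA v) // [u == b]eq_sym (nA u) // [v == _]eq_sym nuv.
  by rewrite [v == _]eq_sym nvv [u == _]eq_sym nuu [u == _]eq_sym nvu.
- by move=> z; rewrite !inE => /or4P[||/eqP->|/orP[]]; try (by move/eqP->); exact: AUi.
- exact: subsetDl.
- move=> z; rewrite !inE => /or4P[||/eqP->|/orP[]]; try (by rewrite eqxx);
  by move/eqP->; rewrite ?(negPf vA) ?(negPf uA) ?(negPf u'A) ?(negPf v'A) ?andbF.
- by exists b'; rewrite // !inE b'b.
- rewrite /=; clear -lE l5; lia.
- rewrite hE (cardsD1 b A) bA; clear -l5; lia.
- clear; lia.
- have bX : b \notin X by rewrite (disjointFr dAX bA).
  have : size [seq z <- [:: v; u; b; u'; v'] | z \in X] <= 4.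
    rewrite size_filter /= (negPf bX).
    by case: (v \in X); case: (u \in X); case: (u' \in X); case: (v' \in X).
  clear -cX lE l5; lia.
Qed.

End Structure.

(** * Marks spread out along a sequence *)

Section Spacing.
Variables (T : Type) (f g : pred T) (q : nat).
Hypothesis q2 : 1 < q.
Implicit Types w s : seq T.

(** Models the neighbours [f] and [g], on a longest path, of the two ends of a path with [q]
    vertices off it: passing through the side path must not lengthen the longest path, nor may a
    single end be inserted between consecutive vertices. *)
Definition spaced w := [/\
  forall s1 a s2, w = s1 ++ a :: s2 -> f a || g a -> q <= size s2,
  forall s1 a s2 b s3, w = s1 ++ a :: s2 ++ b :: s3 -> f a && g b || g a && f b -> q <= size s2 &
  forall s1 a b s2, w = s1 ++ a :: b :: s2 -> ~~ (f a && f b || g a && g b)].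

Lemma spaced_cat s w : spaced (s ++ w) -> spaced w.
Proof.
move=> [h1 h2 h3]; split.
- by move=> s1 a s2 E; apply: (h1 (s ++ s1)); rewrite E catA.
- by move=> s1 a s2 b s3 E; apply: (h2 (s ++ s1) a s2 b s3); rewrite E catA.
- by move=> s1 a b s2 E; apply: (h3 (s ++ s1) a b s2); rewrite E catA.
Qed.

Let fg := predU f g.
(** A place marked once weighs 2, a place marked twice 3. The former matches the two places that a
    step between equal single marks takes at least; any other step takes at least [q + 1 >= 3]
    places. *)
Definition spacing_weight w := count f w + count g w + count fg w.

Lemma weight_none s : ~~ has fg s -> [/\ count f s = 0, count g s = 0 & count fg s = 0].
Proof.
move=> nh; have c0 : count fg s = 0 by apply/eqP; rewrite -leqn0 leqNgt -has_count.
have sub (p : pred T) : subpred p fg -> count p s = 0.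
  by move=> sp; apply/eqP; rewrite -leqn0 -c0; apply: sub_count.
by split=> //; apply: sub => z /= ->; rewrite ?orbT.
Qed.

(** The first bound uses the [q] free places after the last mark. If both marks occur, at two places
    or more, some step passes from one kind to the other and takes another [q] places, which gives
    the second. *)
Lemma spaced_weight_aux a s : spaced (a :: s) -> f a || g a ->
  spacing_weight (a :: s) + q <= (size (a :: s)).+2 /\
  (0 < count f (a :: s) -> 0 < count g (a :: s) -> 1 < count fg (a :: s) ->
    spacing_weight (a :: s) + q.*2 <= (size (a :: s)).+4).
Proof.
have [n] := ubnP (size s); elim: n a s => [//|n IH] a s; rewrite ltnS => sn sp na.
have [hs|/weight_none[cf cg cfg]] := boolP (has fg s); last first.
  have [h1 _ _] := sp; have qs := h1 [::] a s erefl na.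
  rewrite /spacing_weight /= cf cg cfg !addn0; split.
    by case: (f a) (g a) na => [] [] //= _; lia.
  by rewrite na.
have [z [b [s' [E nz nb]]]] : exists z b s', [/\ s = z ++ b :: s', ~~ has fg z & f b || g b].
  by case/split_find: hs => b z s' nb nz; exists z, b, s'; rewrite cat_rcons.
have [h1 h2 h3] := sp.
have szs : size s' < n by apply: leq_trans sn; rewrite E size_cat /=; lia.
have spb : spaced (b :: s') by apply: (@spaced_cat (a :: z)); rewrite /= -E.
have [I1 I2] := IH b s' szs spb nb.
have [cf cg cfg] := weight_none nz.
have cE (p : pred T) : count p z = 0 -> count p (a :: s) = p a + count p (b :: s').
  by move=> c0; rewrite E [count p (a :: _)]/= count_cat c0.
have szE : size (a :: s) = (size z + size (b :: s')).+1 by rewrite E /= size_cat.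
move: I1 I2; rewrite /spacing_weight !cE // szE.
move: (size (b :: s')) => k; have cge : count fg (b :: s') <= count f (b :: s') + count g (b :: s').
  elim: (b :: s') => [//|c t IHt] /=; by case: (f c) (g c) IHt => [] [] /=; lia.
move: nb => nb.
have fb : f b <= count f (b :: s') by rewrite /=; lia.
have gb : g b <= count g (b :: s') by rewrite /=; lia.
have cfgb : count fg (b :: s') = count g (b :: s') + count (predD f g) (b :: s').
  elim: (b :: s') => [//|c t IHt] /=; by case: (f c) (g c) IHt => [] [] /=; lia.
have fgb : (f b && ~~ g b) <= count (predD f g) (b :: s') by rewrite /= andbC; lia.
have cfgb' : count fg (b :: s') = count f (b :: s') + count (predD g f) (b :: s').
  elim: (b :: s') => [//|c t IHt] /=; by case: (f c) (g c) IHt => [] [] /=; lia.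
have gfb : (g b && ~~ f b) <= count (predD g f) (b :: s') by rewrite /= andbC; lia.
have [mix|nmix] := boolP (f a && g b || g a && f b).
  have := h2 [::] a z b s'; rewrite /= -E => /(_ erefl mix) qz.
  move: (count f _) (count g _) (count fg _) => x y u I1 _; rewrite /fg /=.
  have : f a + g a + (f a || g a) <= 3 by case: (f a); case: (g a).
  by move: (f a + g a + _) => ? ?; split; lia.
have z1 : 0 < size z.
  case: z E nz {cE szE cf cg cfg} => [/= E _|//].
  have := h3 [::] a b s'; rewrite /= -E => /(_ erefl).
  by move: na nb nmix; case: (f a); case: (g a); case: (f b); case: (g b).
move: fb gb fgb gfb cfgb cfgb' cge z1 q2.
move: (count f _) (count g _) (count fg _) (count (predD f g) _) (count (predD g f) _) (size z).
move=> x y u v v' m; rewrite /fg /=; move: na nb nmix.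
by case: (f a); case: (g a); case: (f b); case: (g b) => //= _ _ _; clear; lia.
Qed.

(** Three stretches of [q] places are free: before the first mark, after the last, and where the
    kind changes. The weight is at least [2 * count f w + count g w]. *)
Lemma spaced_size w : spaced w -> (forall s1 a s2, w = s1 ++ a :: s2 -> f a || g a -> q <= size s1) ->
  1 < count f w -> 0 < count g w -> 3 * q + 2 * count f w + count g w <= size w + 4.
Proof.
move=> sp mg cf cg.
have hs : has fg w by rewrite has_count; apply: leq_trans (sub_count _ w) => //; [exact: ltnW cf | move=> z /= ->].
case/split_find: hs sp mg cf cg => a z s na nz; rewrite cat_rcons => sp mg.
have qz := mg z a s erefl na.
have [c1 c2 c3] := weight_none nz.
rewrite !count_cat c1 c2 !add0n size_cat => cf cg.
have u2 : 1 < count fg (a :: s) by apply: leq_trans cf (sub_count _ _) => t /= ->.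
have [_ /(_ (ltnW cf) cg u2)] := spaced_weight_aux (spaced_cat sp) na.
rewrite /spacing_weight.
have : count f (a :: s) <= count fg (a :: s) by apply: sub_count => t /= ->.
move: (count f _) (count g _) (count fg _) (size (a :: s)) => x y u k.
by move: qz; clear; lia.
Qed.

End Spacing.

(** * Detours from a longest path *)

Section Detours.
Variables (T : finType) (e : rel T).
Hypotheses (esym : symmetric e) (eirr : irreflexive e).
Implicit Types (U : {set T}) (x y z a b : T) (w s : seq T).

(** Otherwise exchanging [s2] for [x :: s] would lengthen [w]. *)
Lemma detour U w x s s1 a s2 b s3 : maxpth e U w -> pth e U (x :: s) ->
  (forall z, z \in x :: s -> z \notin w) -> w = s1 ++ a :: s2 ++ b :: s3 ->
  e a x -> e (last x s) b -> size (x :: s) <= size s2.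
Proof.
move=> [pw mw] /pthP[sQ uQ QU] dis E ax yb.
have /pthP[sw uw wU] := pw.
have [sA sB] : sorted e (rcons s1 a) /\ sorted e (b :: s3).
  move: sw; rewrite E sorted_cat_consE => /andP[-> h]; split=> //.
  by move: h; rewrite -cat_cons sorted_cat_consE => /andP[].
have pc : perm_eq w (s2 ++ (rcons s1 a ++ b :: s3)).
  by rewrite E -cat_rcons perm_catCA.
have : size (rcons s1 a ++ (x :: s) ++ b :: s3) <= size w.
  apply: mw; apply/pthP; split.
  - apply: (@sorted_catI _ _ x) => //; last by rewrite last_rcons.
    by apply: (@sorted_catI _ _ x).
  - rewrite uniq_catCA cat_uniq uQ /=.
    move: uw; rewrite (perm_uniq pc) cat_uniq => /and3P[_ _ ->]; rewrite andbT.
    apply/hasPn => z zw; apply/negP => /dis; rewrite (perm_mem pc) mem_cat zw orbT //.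
  - move=> z; rewrite mem_cat mem_cat orbCA => /orP[/QU//|]; rewrite -mem_cat => h.
    by apply: wU; rewrite (perm_mem pc) mem_cat h orbT.
by rewrite (perm_size pc) !size_cat addnCA leq_add2r.
Qed.

Lemma tail_detour U w x s s1 a s2 : maxpth e U w -> pth e U (x :: s) ->
  (forall z, z \in x :: s -> z \notin w) -> w = s1 ++ a :: s2 ->
  e a x -> size (x :: s) <= size s2.
Proof.
move=> [pw mw] /pthP[sQ uQ QU] dis E ax.
have /pthP[sw uw wU] := pw.
have sA : sorted e (rcons s1 a) by move: sw; rewrite E sorted_cat_consE => /andP[].
have pc : perm_eq w (s2 ++ rcons s1 a) by rewrite E -cat_rcons perm_catC.
have : size (rcons s1 a ++ (x :: s)) <= size w.
  apply: mw; apply/pthP; split.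
  - by apply: (@sorted_catI _ _ x) => //; rewrite last_rcons.
  - rewrite uniq_catC cat_uniq uQ /=.
    move: uw; rewrite (perm_uniq pc) cat_uniq => /and3P[_ _ ->]; rewrite andbT.
    apply/hasPn => z zw; apply/negP => /dis; rewrite (perm_mem pc) mem_cat zw orbT //.
  - move=> z; rewrite mem_cat orbC => /orP[/QU//|] h.
    by apply: wU; rewrite (perm_mem pc) mem_cat h orbT.
by rewrite (perm_size pc) !size_cat addnC leq_add2r.
Qed.

Lemma head_detour U w x s s1 a s2 : maxpth e U w -> pth e U (x :: s) ->
  (forall z, z \in x :: s -> z \notin w) -> w = s1 ++ a :: s2 ->
  e a x -> size (x :: s) <= size s1.
Proof.
move=> mw pQ dis E ax; rewrite -(size_rev s1).
apply: (tail_detour (maxpth_rev esym mw) pQ _ _ ax).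
  by move=> z /dis; rewrite mem_rev.
by rewrite E rev_cat rev_cons cat_rcons.
Qed.

Lemma insert1 U w x s1 a b s2 : maxpth e U w -> x \in U -> x \notin w ->
  w = s1 ++ a :: b :: s2 -> ~~ (e x a && e x b).
Proof.
move=> mw xU xw E; apply/negP => /andP[xa xb].
have px : pth e U [:: x] by apply/pthP; split=> // y; rewrite inE => /eqP->.
have : size [:: x] <= size (Nil T).
  apply: (@detour U w x [::] s1 a [::] b s2) => //; last by rewrite esym.
  by move=> z; rewrite inE => /eqP->.
by [].
Qed.

(* The ends of the path off [w] have many neighbours on [w], and these are far apart, since
   detours through that path do not produce a longer path than [w]. *)
Lemma side_path_size U h w x s : {in U, forall z, h <= #|nbr e U z|.+1} ->
  {in U &, forall y z, e y z -> (h <= #|nbr e U y|) || (h <= #|nbr e U z|)} ->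
  maxpth e U w -> maxpth e (U :\: [set z in w]) (x :: s) -> 0 < size s -> size (x :: s) < h ->
  3 * h <= size w + 2.
Proof.
move=> dU pU mw mQ s0 qh; set R := U :\: _ in mQ.
have [pQ mxQ] := mQ; have /pthP[sQ uQ QR] := pQ.
have RU : R \subset U by apply: subsetDl.
have pQU := pth_sub RU pQ.
have QU z : z \in x :: s -> z \in U by move/QR; apply: (subsetP RU).
have dis z : z \in x :: s -> z \notin w by move/QR; rewrite !inE => /andP[].
have [pw _] := mw; have /pthP[sw uw wU] := pw.
set y := last x s.
have mQ' : maxpth e R (y :: rev (belast x s)).
  by rewrite -rev_rcons -lastI; apply: maxpth_rev.
have pQ' : pth e U (y :: rev (belast x s)).
  by rewrite -rev_rcons -lastI pth_rev.
have dis' z : z \in y :: rev (belast x s) -> z \notin w.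
  by rewrite -rev_rcons -lastI mem_rev; apply: dis.
have lQ' : last y (rev (belast x s)) = x.
  by rewrite -[last _ _]/(last x (y :: rev (belast x s))) -rev_rcons -lastI last_rev.
have sQ' : size (y :: rev (belast x s)) = size (x :: s) by rewrite /= size_rev size_belast.
have degE z : (forall v, v \in R -> e z v -> v \in x :: s) -> #|nbr e U z| = count (e z) (w ++ x :: s).
  move=> H; apply: card_nbr => //.
  - by rewrite cat_uniq uw uQ andbT; apply/hasPn => v /dis.
  - by move=> v; rewrite mem_cat => /orP[/wU|/QU].
  - move=> v; rewrite inE => /andP[vU zv]; rewrite mem_cat.
    by have [//|vw] := boolP (v \in w); apply: H => //; rewrite !inE vw.
have dx : #|nbr e U x| = count (e x) w + count (e x) s.
  rewrite degE ?count_cat /= ?eirr // => v vR xv; exact: (maxpth_nbr esym mQ vR xv).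
have dy : #|nbr e U y| = count (e y) w + count (e y) (belast x s).
  rewrite degE.
    by rewrite count_cat lastI -cats1 count_cat /= -/y eirr !addn0.
  move=> v vR yv; have := maxpth_nbr esym mQ' vR yv.
  by rewrite -rev_rcons -lastI mem_rev.
have cx : count (e x) s <= size s by apply: count_size.
have cy : count (e y) (belast x s) <= size s by rewrite -[size s](size_belast x) count_size.
have xU : x \in U by apply: QU; rewrite mem_head.
have yU : y \in U by apply: QU; rewrite mem_last.
have hx := dU x xU; have hy := dU y yU.
have sp1 : spaced (e x) (e y) (size (x :: s)) w.
  split.
  - move=> s1 a s2 E /orP[] ea.
      by apply: (tail_detour mw pQU dis E); rewrite esym.
    by rewrite -sQ'; apply: (tail_detour mw pQ' dis' E); rewrite esym.
  - move=> s1 a s2 b s3 E /orP[]/andP[h1 h2].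
      by apply: (detour mw pQU dis E) => //; rewrite esym.
    by rewrite -sQ'; apply: (detour mw pQ' dis' E); rewrite ?lQ' // esym.
  - move=> s1 a b s2 E; rewrite negb_or; apply/andP; split.
      by apply: (insert1 mw xU _ E); apply: dis; rewrite mem_head.
    by apply: (insert1 mw yU _ E); apply: dis; rewrite mem_last.
have mg s1 a s2 : w = s1 ++ a :: s2 -> e x a || e y a -> size (x :: s) <= size s1.
  move=> E /orP[] ea.
    by apply: (head_detour mw pQU dis E); rewrite esym.
  by rewrite -sQ'; apply: (head_detour mw pQ' dis' E); rewrite esym.
have sp2 : spaced (e y) (e x) (size (x :: s)) w.
  case: sp1 => h1 h2 h3; split.
  - by move=> s1 a s2 E; rewrite orbC; apply: h1 E.
  - by move=> s1 a s2 b s3 E; rewrite orbC; apply: h2 E.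
  - by move=> s1 a b s2 E; rewrite orbC; apply: h3 E.
have mg2 s1 a s2 : w = s1 ++ a :: s2 -> e y a || e x a -> size (x :: s) <= size s1.
  by rewrite orbC; apply: mg.
have q2 : 1 < size (x :: s) by [].
move: qh; rewrite [size (x :: s)]/= => qh.
(* With [q = size s + 1], at least [h - size s] neighbours of one end on [w] and [h - 1 - size s] of
   the other, [spaced_size] reads [3h + 2 <= size w + 4]. *)
have [big|small] := leqP h (count (e x) w + size s).
  have := spaced_size q2 sp1 mg; move: hy; rewrite dy [size (x :: s)]/=.
  move: (count (e x) w) (count (e y) w) big => a b big hy H.
  have a2 : 1 < a by move: big qh; clear; lia.
  have b1 : 0 < b by move: hy cy qh; clear; lia.
  move: (H a2 b1) hy cy big; clear; lia.
have [big|small'] := leqP h (count (e y) w + size s).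
  have := spaced_size q2 sp2 mg2; move: hx; rewrite dx [size (x :: s)]/=.
  move: (count (e x) w) (count (e y) w) big => a b big hx H.
  have a2 : 1 < b by move: big qh; clear; lia.
  have b1 : 0 < a by move: hx cx qh; clear; lia.
  move: (H a2 b1) hx cx big; clear; lia.
(* Now both ends have degree exactly [h - 1], so [x] sees all of [s] and in particular [y], against
   [pU]. *)
have exy : e x y.
  have : all (e x) s.
    rewrite all_count eqn_leq cx; move: hx small; rewrite dx; clear; lia.
  by move/allP; apply; rewrite /y; case: (s) s0 => // z s' _; exact: (mem_last z s').
have := pU x y xU yU exy; rewrite dx dy; move: small small' cx cy.
by move: (count _ _) (count _ _) (count _ _) (count _ _); clear; lia.
Qed.

End Detours.

(** * Longest paths with independent complement *)

Section Independent.
Variables (T : finType) (e : rel T).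
Hypotheses (esym : symmetric e) (eirr : irreflexive e).
Implicit Types (U A B X S Z Y : {set T}) (x y z a b c d v : T) (w s t p : seq T) (ls : seq nat).

(** Dropping [s1] and moving [v], flanked by [x] and [x'], between [c] and [d] gains two vertices
    and loses [size s1]. *)
Lemma crossing_insert U w s1 v t1 c d t2 x x' : pth e U w ->
  w = s1 ++ v :: t1 ++ c :: d :: t2 -> x \in U :\: [set z in w] -> x' \in U :\: [set z in w] ->
  x != x' -> e x v -> e x' v -> e x c -> e x' d -> pth e U (t1 ++ c :: x :: v :: x' :: d :: t2).
Proof.
move=> /pthP[sw uw wU] E; rewrite !inE => /andP[xw xU] /andP[x'w x'U] n xv x'v xc x'd.
have [sA sB] : sorted e (rcons t1 c) /\ sorted e (d :: t2).
  move: sw; rewrite E => /cat_sorted2[_]; rewrite -cat_cons => /(@sorted_mid T)[h _ h'].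
  by split=> //; apply: path_sorted h.
have pc : perm_eq w (s1 ++ (t1 ++ [:: c, v, d & t2])).
  rewrite E perm_cat2l -cat1s perm_catCA perm_cat2l.
  by rewrite -[[:: c, d & t2]]/([:: c] ++ (d :: t2)) perm_catCA.
have pn : perm_eq (t1 ++ [:: c, x, v, x', d & t2]) ([:: x; x'] ++ (t1 ++ [:: c, v, d & t2])).
  apply/permP => f; rewrite /= !count_cat /=.
  move: (count f t1) (count f t2) => i j.
  by case: (f c); case: (f x); case: (f v); case: (f x'); case: (f d) => /=; clear; lia.
apply/pthP; split.
- rewrite sorted_cat_consE sA /= [e c x]esym xc xv [e v x']esym x'v x'd /=; exact: sB.
- rewrite (perm_uniq pn) cat_uniq; apply/and3P; split; first by rewrite /= inE n.
    apply/hasPn => z zt; rewrite !inE; apply/negP => zx.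
    have : z \in w by rewrite (perm_mem pc) mem_cat zt orbT.
    by case/orP: zx => /eqP->; [rewrite (negPf xw)|rewrite (negPf x'w)].
  by move: uw; rewrite (perm_uniq pc) cat_uniq => /and3P[].
- move=> z; rewrite (perm_mem pn) mem_cat => /orP[|h].
    by rewrite !inE => /orP[]/eqP->.
  by apply: wU; rewrite (perm_mem pc) mem_cat h orbT.
Qed.

(* If two consecutive vertices of [w] had neighbours in [Y], one could insert these two into [w]
   next to [v], at the expense of the at most two vertices before [v]: the new path would be longer,
   or as long and avoid an edge. *)
Lemma common_nbr_noconsec U w s1 v s2 Y : maxpth e U w ->
  (forall w', maxpth e U w' -> {in U :\: [set z in w'] &, forall x y, ~~ e x y}) ->
  w = s1 ++ v :: s2 -> 0 < size s1 <= 2 -> Y \subset U :\: [set z in w] ->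
  {in Y, forall x, e x v} -> noconsec [pred b | [exists x, (x \in Y) && e x b]] w.
Proof.
move=> mw ind E s1s YR Yv; have [pw mx] := mw.
have inY x : x \in Y -> [/\ x \in U :\: [set z in w], x \in U & x \notin w].
  by move=> /(subsetP YR) xR; have /setDP[h1 h2] := xR; rewrite inE in h2.
apply: sorted_splitI => t1 c d t2 E2; apply/negP => /andP[].
move=> /existsP[x /andP[xY xc]] /existsP[x' /andP[x'Y x'd]].
have [xR xU xw] := inY x xY; have [x'R x'U x'w] := inY x' x'Y.
have n : x != x'.
  apply: contraTneq xc => xx; have := insert1 esym mw x'U x'w E2.
  by rewrite xx x'd andbT.
have head_out s : w = c :: s -> False.
  move=> E3; have := @maxpth_nbr _ _ esym U c s x; rewrite -E3 (negPf xw) => /(_ mw xU).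
  by rewrite esym xc => /(_ isT).
case: (ltngtP (size t1) (size s1)) => [lt|gt|eq].
- have [t10|t11] : t1 = [::] \/ exists a, t1 = [:: a].
    by case: t1 lt {E2} => [|a [|b t1]] /= lt; [left|right; exists a|move: s1s lt; clear; lia].
    by apply: (head_out (d :: t2)); rewrite E2 t10.
  case: t11 => a t1E; have dv : d = v.
    move: E2 lt; rewrite E t1E; case: (s1) s1s => [|a1 [|a2 [|? ?]]] //= _.
    by case=> _ _ ->.
  by have := insert1 esym mw xU xw E2; rewrite xc dv Yv.
- have [t1' [t1E s2E]] : exists t1', t1 = s1 ++ v :: t1' /\ s2 = t1' ++ c :: d :: t2.
    move: E2; rewrite E -(cat_take_drop (size s1) t1) -catA.
    move/eqP; rewrite eqseq_cat ?size_takel // ?(ltnW gt) // => /andP[/eqP <- /eqP].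
    have : 0 < size (drop (size s1) t1) by rewrite size_drop; move: gt; clear; lia.
    by case: (drop _ _) => [//|b t1'] _ [-> ->]; exists t1'.
  have E3 : w = s1 ++ v :: t1' ++ c :: d :: t2 by rewrite E s2E.
  have pn := crossing_insert pw E3 xR x'R n (Yv x xY) (Yv x' x'Y) xc x'd.
  have szn : size (t1' ++ [:: c, x, v, x', d & t2]) + size s1 = (size w).+2.
    by rewrite E3 !size_cat /= !size_cat /=; clear; lia.
  case: s1 E3 s1s szn {E E2 t1E gt} => [|a1 [|a2 [|? ?]]] //= E3 _ szn.
    have := mx _ pn; move: szn; clear; lia.
  have mn : maxpth e U (t1' ++ [:: c, x, v, x', d & t2]).
    by split=> // w' /mx; move: szn; clear; lia.
  have /pthP[sw uw wU] := pw.
  have eaa : e a1 a2 by move: sw; rewrite E3 /= => /andP[].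
  have out a : a \in [:: a1; a2] -> a \in U :\: [set z in t1' ++ [:: c, x, v, x', d & t2]].
    move=> ain; have aw : a \in w by rewrite E3 -[a1 :: _]/([:: a1; a2] ++ _) mem_cat ain.
    rewrite !inE wU // andbT.
    have : a \notin v :: t1' ++ [:: c, d & t2].
      move: uw; rewrite E3 -[a1 :: _]/([:: a1; a2] ++ _) cat_uniq => /and3P[_ /hasPn h _].
      by apply/negP => /h; rewrite ain.
    rewrite inE mem_cat !inE !negb_or => /and5P[h1 h2 h3 h4 h5].
    rewrite mem_cat !inE !negb_or h1 h2 h3 h4 h5 /= andbT.
    by apply/andP; split; [apply: contraNneq xw => <-|apply: contraNneq x'w => <-].
  have := ind _ mn a1 a2 (out _ _) (out _ _); rewrite eaa !inE !eqxx ?orbT.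
  by move=> /(_ isT isT).
- have [cE dE] : v = c /\ s2 = d :: t2.
    by move: E2; rewrite E => /eqP; rewrite eqseq_cat // => /andP[_ /eqP[-> ->]].
  have := insert1 esym mw x'U x'w E2; rewrite -cE Yv //= x'd //.
Qed.

(** If [scan] gets stuck, every vertex of [X'] has at least [delta_F] neighbours, all on [w] and
    none its first vertex; so it sees the second or the third vertex of [w]. At least half of [X'],
    the set [Y], sees the same one of the two. By [common_nbr_noconsec] the union [A] of the
    neighbourhoods of [Y] then contains no consecutive vertices, so the bound from [scan] applies to
    the whole union. It equals the minimum degree, and therefore all these neighbourhoods coincide
    with [A]. *)
Lemma independent_structure U w ls : conn e U -> maxpth e U w ->
  (forall w', maxpth e U w' -> {in U :\: [set z in w'] &, forall x y, ~~ e x y}) ->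
  all (fun l => 2 <= l) ls -> all (fun l => l != 3) ls -> 1 < size ls ->
  {in U, forall z, halves ls <= #|nbr e U z|.+1} -> 2 < size w ->
  (sumn ls - halves ls).+1.*2 + size ls + size w <= #|U| ->
  forest e U ls \/ exists A u v, [/\ A \subset U, (#|A|).+1 = halves ls &
     {in U :\: A &, forall x y, e x y ->
     all odd ls && ((x == u) && (y == v) || (x == v) && (y == u))}].
Proof.
move=> cU mw ind a2 a3 sz dU w3 cU2; have [pw mx] := mw; have /pthP[sw uw wU] := pw.
set R := U :\: [set z in w].
have cardR : #|U| <= #|R| + size w.
  rewrite /R -(cardsID [set z in w] U) addnC leq_add2l -(card_uniqP uw).
  by apply: subset_leq_card; apply/subsetP => z; rewrite !inE => /andP[].
have Rw x : x \in R -> x \notin w by rewrite !inE => /andP[].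
have RU x : x \in R -> x \in U by rewrite !inE => /andP[].
have pwT : pth e setT w by apply: pth_sub pw; apply: subsetT.
case: (scan esym a2 a3 pwT Rw) => [f|[X' [X'R cX' H]]].
  left; apply: forest_sub f; rewrite subUset subsetDl.
  by apply/subsetP => z; rewrite inE => /wU.
have nbrw x : x \in R -> {subset nbr e U x <= w}.
  move=> xR z; rewrite inE => /andP[zU xz]; apply: contraTT xz => zw.
  by apply: (ind w mw) => //; rewrite !inE zw.
have cnt x : x \in R -> #|nbr e U x| = count (e x) w.
  by move=> xR; apply: card_nbr => //; apply: nbrw.
have ncx x : x \in R -> noconsec (e x) w.
  move=> xR; apply: sorted_splitI => s1 a b s2 E.
  by apply: (insert1 esym mw _ _ E); [apply: RU | apply: Rw].
have lastx x : x \in R -> last_out (e x) w.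
  move=> xR s z E; apply/negP => xz.
  have := @maxpth_nbr _ _ esym U z (rev s) x; rewrite -rev_rcons -E mem_rev (negPf (Rw x xR)).
  by move=> /(_ (maxpth_rev esym mw) (RU x xR)); rewrite esym xz => /(_ isT).
have headx x a s : x \in R -> w = a :: s -> ~~ e x a.
  move=> xR E; apply/negP => xz.
  have := @maxpth_nbr _ _ esym U a s x; rewrite -E (negPf (Rw x xR)).
  by move=> /(_ mw (RU x xR)); rewrite esym xz => /(_ isT).
have [a [b [c [w' wE]]]] : exists a b c w', w = [:: a, b, c & w'].
  by case: (w) w3 => [|a [|b [|c w']]] // _; exists a, b, c, w'.
have touch x : x \in X' -> e x b || e x c.
  move=> xX'; have xR : x \in R by apply: (subsetP X'R).
  have Bx z : e x z -> exists2 x0, x0 \in X' & e x0 z by exists x.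
  have [_ h] := H (e x) Bx (ncx x xR) (lastx x xR).
  apply: contraTT (dU x (RU x xR)) => /norP[nb nc]; rewrite (cnt x xR) -ltnNge.
  apply: h => // z; rewrite wE /= take0 !inE => /or3P[]/eqP-> //.
  by apply: (headx x a [:: b, c & w']).
have [s1 [v [s2 [Y [E s1s YX' Yv cY]]]]] : exists s1 v s2 Y, [/\ w = s1 ++ v :: s2,
    0 < size s1 <= 2, Y \subset X', {in Y, forall x, e x v} & #|X'| <= (#|Y|).*2].
  pose Yb := [set x in X' | e x b]; pose Yc := [set x in X' | e x c].
  have : #|X'| <= #|Yb| + #|Yc|.
    rewrite -cardsUI; apply: leq_trans (leq_addr _ _); apply: subset_leq_card.
    by apply/subsetP => x xX'; rewrite !inE xX' /=; apply: touch.
  have [h|h] := leqP #|Yb| #|Yc| => h'.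
    exists [:: a; b], c, w', Yc; split=> //; last by move: h h'; clear; lia.
      by apply/subsetP => x; rewrite inE => /andP[].
    by move=> x; rewrite inE => /andP[].
  exists [:: a], b, (c :: w'), Yb; split=> //; last by move: h h'; clear; lia.
    by apply/subsetP => x; rewrite inE => /andP[].
  by move=> x; rewrite inE => /andP[].
have YR : Y \subset R by apply: subset_trans YX' X'R.
pose B := [pred b | [exists x, (x \in Y) && e x b]].
have ncB : noconsec B w := common_nbr_noconsec mw ind E s1s YR Yv.
have loB : last_out B w.
  move=> s z E'; apply/existsP => -[x /andP[xY]]; apply/negP.
  by apply: (lastx x _ s) => //; apply: (subsetP YR).
have BX b' : B b' -> exists2 x, x \in X' & e x b'.
  by case/existsP => x /andP[xY xb]; exists x => //; apply: (subsetP YX').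
have [cB _] := H B BX ncB loB.
pose A := [set z in w | B z].
have cA : #|A| = count B w.
  rewrite -size_filter -(card_uniqP (filter_uniq _ uw)); apply: eq_card => z.
  by rewrite in_set mem_filter andbC.
have AU : A \subset U by apply/subsetP => z; rewrite in_set => /andP[/wU].
have hm := halves_le ls.
(* In the hypothesis on [#|U|], the doubling pays for passing from [X'] to [Y], and [size ls] for
   the vertices used up by [scan]. *)
have Ybig : sumn ls < #|Y| + halves ls.
  move: cU2 cardR cX' cY hm; move: (sumn ls) (halves ls) (size ls) (size w) #|U| #|R| #|X'| #|Y|.
  by clear; lia.
have nA x : x \in Y -> nbr e U x \subset A.
  move=> xY; have xR := subsetP YR x xY; apply/subsetP => z zN.
  rewrite in_set (nbrw x xR z zN) /=; apply/existsP; exists x; rewrite xY.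
  by move: zN; rewrite inE => /andP[].
have [x0 x0Y] : exists x, x \in Y.
  by apply/set0Pn; rewrite -card_gt0; move: Ybig hm; clear; lia.
have hA : halves ls = #|A|.+1.
  have := subset_leq_card (nA x0 x0Y); have := dU x0 (RU x0 (subsetP YR x0 x0Y)).
  by rewrite cA; move: cB; clear; lia.
have bip : {in A & Y, forall a' x, e a' x}.
  move=> a' x a'A xY; have : nbr e U x == A.
    rewrite eqEcard (nA x xY) /=; have := dU x (RU x (subsetP YR x xY)).
    by rewrite hA ltnS.
  by move/eqP => nE; move: a'A; rewrite -nE inE esym => /andP[].
have dAY : [disjoint A & Y].
  rewrite disjoint_subset; apply/subsetP => z; rewrite in_set => /andP[zw _].
  by apply/negP => /(subsetP YR)/Rw; rewrite zw.
have YU : Y \subset U by apply/subsetP => x /(subsetP YR)/RU.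
have dU' : {in U, forall x, #|A| <= #|nbr e U x|}.
  by move=> x /dU; rewrite hA.
case: (bip_structure esym eirr cU AU YU dAY bip a2 a3 sz hA dU' Ybig) => [|[u [v' h]]]; first by left.
by right; exists A, u, v'; split.
Qed.

End Independent.

(** * Two odd paths of equal length *)

Section Exceptional.
Variables (T : finType) (e : rel T).
Hypotheses (esym : symmetric e) (eirr : irreflexive e).
Implicit Types (U S H R : {set T}) (x y z a b c d u v : T) (w s t Q W : seq T).

Lemma path_detached S U W z : detached e S U -> pth e U W -> z \in W -> z \in S ->
  {subset W <= S}.
Proof.
move=> det pW zW zS.
have step s y : sorted e (y :: s) -> {subset y :: s <= U} -> y \in S -> {subset y :: s <= S}.
  elim: s y => [|b s IH] y /=; first by move=> _ _ yS v; rewrite inE => /eqP->.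
  move=> /andP[yb sb] sU yS v; rewrite inE => /orP[/eqP->//|]; apply: IH => //.
    by move=> v' v's; apply: sU; rewrite inE v's orbT.
  apply: contraTT yb => bS; apply: det => //; rewrite inE bS sU //= !inE eqxx orbT //.
have /pthP[sW uW WU] := pW; case/splitPr: zW sW WU => s1 s2 sW WU.
have h2 : {subset z :: s2 <= S}.
  apply: step => //; first by case/cat_sorted2: sW.
  by move=> v vs; apply: WU; rewrite mem_cat vs orbT.
have h1 : {subset z :: rev s1 <= S}.
  apply: step => //.
    by move: sW; rewrite sorted_cat_consE => /andP[h _]; rewrite -rev_rcons sorted_revE.
  move=> v; rewrite -rev_rcons mem_rev mem_rcons => h; apply: WU; rewrite mem_cat inE.
  by move: h; rewrite inE => /orP[]->; rewrite ?orbT.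
move=> v; rewrite mem_cat => /orP[vs|/h2//]; apply: h1.
by rewrite inE mem_rev vs orbT.
Qed.

Lemma conn_reach U x (B : pred T) b0 : conn e U -> x \in U -> b0 \in U -> B b0 ->
  exists s b, [/\ pth e U (rcons s b), head b (rcons s b) = x, B b & ~~ has B s].
Proof.
move=> cU xU b0U Bb0.
pose r := [rel a b | [&& e a b, a \in U & b \in U]].
pose S := [set z in U | connect r x z].
have SU : S = U.
  apply: cU; first by apply/subsetP => z; rewrite inE => /andP[].
    by apply/set0Pn; exists x; rewrite inE xU connect0.
  move=> a b; rewrite !inE => /andP[aU xa] /andP[nb bU]; apply: contra nb => ab.
  rewrite bU; apply: connect_trans xa _; apply: connect1; by rewrite /= ab aU.
have : b0 \in S by rewrite SU.
rewrite inE => /andP[_ /connectP[p0 pr b0E]].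
case: (shortenP pr) b0E => p {p0 pr} pr up _ b0E.
have pp : pth e U (x :: p).
  apply/pthP; split=> //.
    by rewrite /=; apply: sub_path pr => a b /and3P[].
  move=> z; rewrite inE => /orP[/eqP->//|zp].
  elim: p (x) pr zp {up b0E} => [//|y p IH] x' /= /andP[/and3P[_ _ yU] pr].
  by rewrite inE => /orP[/eqP->//|]; apply: IH pr.
have hB : has B (x :: p) by apply/hasP; exists b0; rewrite // b0E mem_last.
have [s [b [s' [E Bb ns]]]] : exists s b s', [/\ x :: p = s ++ b :: s', B b & ~~ has B s].
  by case/split_find: hB => b s s' Bb ns; exists s, b, s'; rewrite cat_rcons.
exists s, b; split=> //; first by move: pp; rewrite E -cat_rcons => /pth_cat[].
by case: s {ns} E => [|y s] /= [->].
Qed.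

(** Walk from [u] to the first vertex [b] of [Q] and follow [Q] along its longer side. *)
Lemma long_from U Q u : conn e U -> pth e U Q -> 0 < size Q -> u \in U ->
  exists2 s, pth e U (u :: s) & size Q < (size (u :: s)).*2.
Proof.
move=> cU pQ Q0 uU; have [q0 q0Q] : exists q0, q0 \in Q by case: (Q) Q0 => // q ? _; exists q; rewrite mem_head.
have /pthP[sQ uQ QU] := pQ.
have [t [b [pt hd bQ nt]]] := @conn_reach U u (mem Q) q0 cU uU (QU _ q0Q) q0Q.
have go s1 s2 : Q = s1 ++ b :: s2 \/ rev Q = s1 ++ b :: s2 -> size s1 <= size s2 ->
    exists2 s, pth e U (u :: s) & size Q < (size (u :: s)).*2.
  move=> E le.
  have [sb nb inb] : [/\ sorted e (b :: s2), uniq (b :: s2) & {subset b :: s2 <= Q}].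
    case: E => E.
      move: sQ uQ; rewrite E => /cat_sorted2[_ ->]; rewrite cat_uniq => /and3P[_ _ ->].
      by split=> // z zs; rewrite mem_cat zs orbT.
    have sQr : sorted e (rev Q) by rewrite sorted_revE.
    have uQr : uniq (rev Q) by rewrite rev_uniq.
    move: sQr uQr; rewrite E => /cat_sorted2[_ ->]; rewrite cat_uniq => /and3P[_ _ ->].
    by split=> // z zs; rewrite -mem_rev E mem_cat zs orbT.
  have szQ : size Q = size s1 + (size s2).+1.
    by case: E => E; [|rewrite -size_rev]; rewrite E size_cat.
  have /pthP[st ut tU] := pt.
  have pp : pth e U (t ++ b :: s2).
    apply/pthP; split; first by rewrite sorted_cat_consE st.
      move: ut; rewrite rcons_uniq cat_uniq => /andP[bt ->]; rewrite nb andbT andTb.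
      by apply/hasPn => z /inb; apply: contraL => zt; move/hasPn: nt => /(_ z zt).
    move=> z; rewrite mem_cat => /orP[zt|/inb/QU//].
    by apply: tU; rewrite mem_rcons inE zt orbT.
  have E2 : exists s, t ++ b :: s2 = u :: s.
    by case: t hd {pt nt st ut tU pp} => [|y t] /= ->; [exists s2|exists (t ++ b :: s2)].
  case: E2 => s E2; exists s; first by rewrite -E2.
  by rewrite -E2 size_cat szQ /=; move: le; clear; lia.
case/splitPr: {1}Q / bQ (erefl Q) => s1 s2 E.
have [le|lt] := leqP (size s1) (size s2); first by apply: (go s1 s2) => //; left.
apply: (go (rev s2) (rev s1)); last by rewrite !size_rev ltnW.
by right; rewrite -E rev_cat rev_cons cat_rcons.
Qed.

Lemma forest_pair U w1 w2 l : pth e U w1 -> pth e U w2 -> l <= size w1 -> l <= size w2 ->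
  [disjoint [set z in w1] & [set z in w2]] -> forest e U [:: l; l].
Proof.
move=> p1 p2 l1 l2 dis.
have f1 : forest e [set z in w1] [:: l] by apply: forest_pth p1 _; rewrite /= addn0.
have f2 : forest e [set z in w2] [:: l] by apply: forest_pth p2 _; rewrite /= addn0.
apply: forest_sub (forest_cat dis f1 f2).
have /pthP[_ _ h1] := p1; have /pthP[_ _ h2] := p2.
by rewrite subUset; apply/andP; split; apply/subsetP => z; rewrite inE; [apply: h1|apply: h2].
Qed.

Lemma disjoint_seqs (s t : seq T) : (forall z, z \in s -> z \notin t) ->
  [disjoint [set z in s] & [set z in t]].
Proof. by move=> H; rewrite disjoint_subset; apply/subsetP => z; rewrite !inE => /H. Qed.

(* The component of [Q] off [w] is attached to a single vertex [c]. *)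
Lemma cut_vertex U w Q l : conn e U -> odd l -> 4 < l -> ~ forest e U [:: l; l] ->
  {in U, forall z, l.-2 <= #|nbr e U z|} -> maxpth e U w -> l.*2 <= (size w).+3 ->
  maxpth e (U :\: [set z in w]) Q -> size Q = l.-1 ->
  exists2 c, c \in U & forall W, pth e (U :\ c) W -> size W < l.
Proof.
move=> cU ol l4 nF dU mw wl mQ Ql; set R := U :\: _ in mQ.
have [pw mx] := mw; have /pthP[sw uw wU] := pw; have [pQ mxQ] := mQ.
have RU : R \subset U by apply: subsetDl.
have Rw z : z \in R -> z \notin w by rewrite !inE => /andP[].
have Rfree W : pth e R W -> size W < l by move=> /mxQ; rewrite Ql; move: l4; clear; lia.
have lE := odd_double_half l; rewrite ol in lE.
have [g gE] : {g | l./2 = g} by exists l./2.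
rewrite gE in lE.
case: Q pQ mxQ mQ Ql => [|x s] pQ mxQ mQ Ql; first by move: Ql l4; rewrite /=; clear; lia.
have /pthP[sQ uQ QR] := pQ.
have [Ds [_ pDs cov _]] := components esym R.
have [H HDs xH] : exists2 H, H \in Ds & x \in H by apply: cov; apply: QR; rewrite mem_head.
have [cH H0 HR dH] := pDs H HDs.
have HU z : z \in H -> z \in U by move=> zH; apply: (subsetP RU); apply: (subsetP HR).
have Hw z : z \in H -> z \notin w by move=> zH; apply: Rw; apply: (subsetP HR).
have sHU : H \subset U by apply/subsetP.
have QH : {subset x :: s <= H} := path_detached dH pQ (mem_head x s) xH.
have pQH : pth e H (x :: s) by apply/pthP.
have mQH : maxpth e H (x :: s) by split=> // W /(pth_sub HR)/mxQ.
have outH z y : z \in H -> y \in U -> e z y -> y \notin w -> y \in H.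
  move=> zH yU zy yw; apply: contraTT zy => yH; apply: dH => //.
  by rewrite in_setD yH in_setD in_set yw.
have [u [c [uH cw uc]]] : exists u c, [/\ u \in H, c \in w & e u c].
  have w0 : 0 < size w by move: wl l4; clear; lia.
  have [y0 y0w] : exists y, y \in w by case: (w) w0 => // y ? _; exists y; rewrite mem_head.
  have HnU : H != U by apply: contraTneq (wU _ y0w) => <-; apply: contraL y0w => /Hw.
  have [u [y [uH /setDP[yU yH] uy]]] := conn_edge cU sHU H0 HnU.
  by exists u, y; split=> //; apply: contraNT yH; apply: outH uy.
have attL w' u1 v L M : maxpth e U w' -> w' =i w -> w' = L ++ v :: M -> u1 \in H -> e u1 v ->
    size L < l /\ forall t, pth e H (u1 :: t) -> size (u1 :: t) <= size L.
  move=> mw' ww E u1H uv; have vu : e v u1 by rewrite esym.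
  have dis t : pth e H (u1 :: t) -> forall z, z \in u1 :: t -> z \notin w'.
    by case/pthP => _ _ tH z /tH/Hw; rewrite ww.
  have small t : pth e H (u1 :: t) -> size (u1 :: t) <= size L.
    by move=> pt; apply: (head_detour esym mw' (pth_sub sHU pt) (dis t pt) E vu).
  split=> //; rewrite ltnNge; apply/negP => lL; apply: nF.
  (* If [L] held a [P_l], a second one would consist of more than half of [size Q = l - 1] vertices
     in [H], then [v], then [M], which is at least as long as the part in [H] because [w] is
     longest. *)
  have [t pt tl] := long_from cH pQH isT u1H.
  have tM := tail_detour mw' (pth_sub sHU pt) (dis t pt) E vu.
  have [pw' _] := mw'.
  have [pL pM] : pth e U L /\ pth e U (v :: M) by apply: pth_cat; rewrite -E.
  have /pthP[st ut tH] := pt; have /pthP[sM uM MU] := pM.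
  apply: (@forest_pair _ L (rev (u1 :: t) ++ v :: M)) => //.
  - apply/pthP; split.
    + apply: (@sorted_catI _ _ u1) => //; first by rewrite sorted_revE.
      by rewrite last_rev /= uv.
    + rewrite cat_uniq rev_uniq ut uM andbT andTb; apply/hasPn => z zM.
      apply/negP; rewrite /= mem_rev => /(dis t pt); rewrite E mem_cat negb_or zM.
      by rewrite andbF.
    + by move=> z; rewrite mem_cat mem_rev => /orP[/tH/HU|/MU].
  - rewrite size_cat size_rev; move: tl tM; rewrite [size (v :: M)]/= Ql -lE.
    by move: (size _) (size _) => i j; clear; lia.
  - apply: disjoint_seqs => z zL; rewrite mem_cat mem_rev negb_or; apply/andP; split.
      by apply: contraL zL => /(dis t pt); rewrite E mem_cat negb_or => /andP[].
    have /pthP[_ uw' _] := pw'; move: uw'; rewrite E cat_uniq => /and3P[_ /hasPn h _].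
    by apply: contraL zL => /h.
have attR u1 v L M : w = L ++ v :: M -> u1 \in H -> e u1 v -> size M < l.
  move=> E u1H uv; have [] := @attL (rev w) u1 v (rev M) (rev L).
  - exact: maxpth_rev.
  - by move=> z; rewrite mem_rev.
  - by rewrite E rev_cat rev_cons cat_rcons.
  - by [].
  - by [].
  - by rewrite size_rev.
have gap u1 u2 v1 v2 L K M : w = L ++ v1 :: K ++ v2 :: M -> u1 \in H -> u2 \in H ->
    e u1 v1 -> e u2 v2 -> u1 = u2 /\ size L + size K < l.-1.
  move=> E u1H u2H e1 e2; have E2 : w = (L ++ v1 :: K) ++ v2 :: M by rewrite E -catA.
  have h1 := attR u1 v1 L (K ++ v2 :: M) E u1H e1.
  have [h2 _] := attL w u2 v2 (L ++ v1 :: K) M mw (fun z => erefl _) E2 u2H e2.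
  have szw : size w = size L + size K + size M + 2.
    by rewrite E !size_cat /= size_cat /=; clear; lia.
  move: h1 h2; rewrite !size_cat /= => h1 h2.
  (* Fewer than [l] vertices precede [v2] and fewer than [l] follow [v1]; [K] is counted twice, and
     [w] has at least [2l - 3] vertices. *)
  have K1 : size K <= 1 by move: h1 h2 wl szw l4; clear; lia.
  split; last by move: h2; clear; lia.
  apply/eqP; apply: contraT => n.
  have [t [b [pt hd /eqP bE nt]]] := @conn_reach H u1 (pred1 u2) u2 cH u1H u2H (eqxx _).
  have [t' tE] : exists t', rcons t b = u1 :: t'.
    by case: (t) hd => [|y t'] /= ->; [exists [::]|exists (rcons t' b)].
  rewrite tE in pt; have /pthP[_ _ tH] := pt.
  have dis z : z \in u1 :: t' -> z \notin w by move/tH/Hw.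
  have lb : last u1 t' = b by rewrite -[last u1 t']/(last u1 (u1 :: t')) -tE last_rcons.
  have := detour mw (pth_sub sHU pt) dis E; rewrite lb bE esym e1 e2 => /(_ isT isT).
  have : 1 < size (u1 :: t').
    by case: (t') lb => //= E3; move: n; rewrite E3 bE eqxx.
  by move: K1; move: (size _) (size _); clear; lia.
have gap' u1 u2 v1 v2 : v1 \in w -> v2 \in w -> v1 != v2 -> u1 \in H -> u2 \in H ->
    e u1 v1 -> e u2 v2 -> u1 = u2.
  move=> v1w v2w n u1H u2H e1 e2; case/splitPr: {1}w / v1w (erefl w) => L M E.
  move: v2w; rewrite -E mem_cat inE [v2 == _]eq_sym (negPf n) /= => /orP[v2L|v2M].
    case/splitPr: {1}L / v2L (erefl L) => L1 L2 EL.
    have E2 : w = L1 ++ v2 :: L2 ++ v1 :: M by rewrite -E -EL -catA.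
    by have [->] := gap u2 u1 v2 v1 _ _ _ E2 u2H u1H e2 e1.
  case/splitPr: {1}M / v2M (erefl M) => M1 M2 EM.
  have E2 : w = L ++ v1 :: M1 ++ v2 :: M2 by rewrite -E -EM.
  by have [->] := gap u1 u2 v1 v2 _ _ _ E2 u1H u2H e1 e2.
(* If [u] had two neighbours on [w], it would be the only vertex of [H] attached to [w]. Vertices of
   [H :\ u] would keep degree at least [l - 3] there, so [u] would start a path on [l - 1] vertices
   in [H], too long for [L]. *)
have two v v' L K M : w = L ++ v :: K ++ v' :: M -> e u v -> e u v' -> False.
  move=> E uv uv'.
  have vw : v \in w by rewrite E mem_cat mem_head orbT.
  have v'w : v' \in w by rewrite E mem_cat inE mem_cat mem_head !orbT.
  have n : v != v'.
    move: uw; rewrite E cat_uniq => /and3P[_ _] /= /andP[h _].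
    by apply: contraNneq h => ->; rewrite mem_cat mem_head orbT.
  have only z v2 : z \in H -> v2 \in w -> e z v2 -> z = u.
    move=> zH v2w zv; have [E2|n2] := eqVneq v2 v.
      by apply: (gap' z u v2 v') => //; rewrite E2.
    exact: (gap' z u v2 v).
  have [y [yH uy]] : exists y, y \in H :\ u /\ e u y.
    have [u' [y [u'u yH uy]]] : exists a b, [/\ a \in [set u], b \in H :\: [set u] & e a b].
      apply: (conn_edge cH); first by rewrite sub1set.
        by apply/set0Pn; exists u; rewrite inE.
      apply: contraTneq (pth_size pQH) => <-; rewrite cards1 Ql -ltnNge.
      by move: l4; clear; lia.
    by exists y; split=> //; move: u'u uy; rewrite inE => /eqP->.
  have dH' z : z \in H :\ u -> l - 3 <= #|nbr e (H :\ u) z|.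
    rewrite !inE => /andP[zu zH]; have := dU z (HU z zH).
    have sub : nbr e U z \subset u |: nbr e (H :\ u) z.
      apply/subsetP => y'; rewrite !inE => /andP[y'U zy'].
      have [//|y'u] := eqVneq y' u; rewrite zy' andbT /=.
      apply: (outH z) => //; apply/negP => y'w; move: zu.
      by rewrite (only z y' zH y'w zy') eqxx.
    have := subset_leq_card sub; rewrite cardsU1.
    by move: l4; case: (_ \notin _) => /=; move: #|_| #|_|; clear; lia.
  have [t pt tl] := greedy_path eirr yH dH'.
  have /pthP[st ut tH] := pt.
  have put : pth e H (u :: y :: t).
    apply/pthP; split; first by rewrite /= uy.
      by rewrite cons_uniq ut andbT; apply/negP => /tH; rewrite !inE eqxx.
    by move=> z; rewrite inE => /orP[/eqP->//|/tH]; rewrite inE => /andP[].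
  have [_ sm] := attL w u v L (K ++ v' :: M) mw (fun z => erefl _) E uH uv.
  have [_ lt] := gap u u v v' L K M E uH uH uv uv'.
  have := sm _ put; rewrite /= tl; move: lt l4; move: (size L) (size K); clear; lia.
have only z v2 : z \in H -> v2 \in w -> e z v2 -> v2 = c.
  move=> zH v2w zv; apply/eqP; apply: contraT => n.
  have zu := gap' z u v2 c v2w cw n zH uH zv uc; rewrite zu in zv.
  case/splitPr: {1}w / cw (erefl w) => L M E.
  move: v2w; rewrite -E mem_cat inE (negPf n) /= => /orP[v2L|v2M].
    case/splitPr: {1}L / v2L (erefl L) => L1 L2 EL.
    have E2 : w = L1 ++ v2 :: L2 ++ c :: M by rewrite -E -EL -catA.
    by case: (two _ _ _ _ _ E2 zv uc).
  case/splitPr: {1}M / v2M (erefl M) => M1 M2 EM.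
  have E2 : w = L ++ c :: M1 ++ v2 :: M2 by rewrite -E -EM.
  by case: (two _ _ _ _ _ E2 uc zv).
have dH' z : z \in H -> l - 3 <= #|nbr e H z|.
  move=> zH; have := dU z (HU z zH).
  have sub : nbr e U z \subset c |: nbr e H z.
    apply/subsetP => y'; rewrite !inE => /andP[y'U zy'].
    have [//|y'c] := eqVneq y' c; rewrite zy' andbT /=.
    apply: (outH z) => //; apply: contra y'c => y'w; by rewrite (only z y' zH y'w zy').
  have := subset_leq_card sub; rewrite cardsU1.
  by move: l4; case: (_ \notin _) => /=; move: #|_| #|_|; clear; lia.
have yH : last x s \in H by apply: QH; apply: mem_last.
have hx := dH' x xH; have hy := dH' _ yH.
have sl : size s = l.-2 by move: Ql => /= <-.
(* The ends of [Q] have degree at least [l - 3] in [H], and [2(l - 3) > l - 2]. So [Q] covers [H],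
   and it closes to a cycle. *)
have Hl : #|H| <= l.-1.
  rewrite -Ql leqNgt; apply/negP => /(maxpth_ends esym eirr cH mQH).
  by rewrite sl; move: hx hy l4; clear; lia.
have [|c' pc' cyc] := maxpth_crossing esym eirr mQH.
  by rewrite sl; move: hx hy l4; clear; lia.
have HE : H = [set z in x :: s].
  apply/eqP; rewrite eq_sym eqEcard; apply/andP; split.
    by apply/subsetP => z; rewrite in_set => /QH.
  by rewrite cardsE (card_uniqP uQ) Ql.
have uc' : u \in c' by rewrite (perm_mem pc'); move: uH; rewrite HE in_set.
case/rot_to: uc' => i c'' E.
have pr : perm_eq (u :: c'') (x :: s) by rewrite -E perm_rot.
have cycE : cycle e (u :: c'') by rewrite -E rot_cycle.
(* The cycle through [H], opened at [u] and prolonged by [c], has exactly [l] vertices; a [P_l] off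
   [c] does not fit into [H] and would thus be disjoint from it. *)
have pcu : pth e U (c :: u :: c'').
  apply/pthP; split.
  - rewrite /= esym uc /=; move: cycE; rewrite /= rcons_path => /andP[] //.
  - rewrite cons_uniq (perm_uniq pr) uQ andbT (perm_mem pr).
    by apply/negP => /QH/Hw; rewrite cw.
  - by move=> z; rewrite inE (perm_mem pr) => /orP[/eqP->|/QH/HU//]; apply: wU.
exists c; first exact: wU.
move=> W pW; rewrite ltnNge; apply/negP => lW; apply: nF.
have sUc : U :\ c \subset U by apply: subsetDl.
have dHc : detached e H (U :\ c).
  move=> z y zH; rewrite !inE => /and3P[nyH yc yU]; apply: contra nyH => zy.
  by apply: (outH z) => //; apply: contra yc => yw; rewrite (only z y zH yw zy).
have WH z : z \in W -> z \notin H.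
  move=> zW; apply/negP => zH.
  have WsubH := path_detached dHc pW zW zH.
  have /pthP[sW uW _] := pW.
  have : pth e H W by apply/pthP.
  by move/pth_size; move: lW Hl l4; clear; lia.
apply: (@forest_pair U W (c :: u :: c'')) => //; first exact: pth_sub pW.
  by move: (perm_size pr); rewrite /= => ->; rewrite sl; move: l4; clear; lia.
apply: disjoint_seqs => z zW; rewrite inE (perm_mem pr) negb_or; apply/andP; split.
  by have /pthP[_ _ /(_ z zW)] := pW; rewrite !inE => /andP[].
by apply: contra (WH z zW) => /QH.
Qed.

(* Off [c] there are many components with long paths from each of their vertices; rerouting [W]
   leaves one of them free for the second path. *)
Lemma cut_vertex_extend U c l : conn e U -> 4 < l -> ~ forest e setT [:: l; l] ->
  {in U, forall z, l.-2 <= #|nbr e U z|} -> c \in U -> 3 * l.-1 + 1 < #|U| ->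
  (forall W, pth e (U :\ c) W -> size W < l) ->
  forall W, pth e (setT :\ c) W -> size W < l.
Proof.
move=> cU l4 nF dU cU' bigU free W pW; rewrite ltnNge; apply/negP => lW; apply: nF.
have [Ds [dDs pDs cov sumDs]] := components esym (U :\ c).
have degD D x : D \in Ds -> x \in D -> l - 3 <= #|nbr e D x|.
  move=> DDs xD; have [_ _ DU dD] := pDs D DDs.
  have := subsetP DU x xD; rewrite !inE => /andP[xc xU].
  rewrite (nbr_detached DU dD xD); have := dU x xU.
  have sub : nbr e U x \subset c |: nbr e (U :\ c) x.
    by apply/subsetP => y; rewrite !inE => /andP[-> ->]; case: (y == c).
  have := subset_leq_card sub; rewrite cardsU1.
  by move: l4; case: (_ \notin _) => /=; move: #|_| #|_|; clear; lia.
have smallD D : D \in Ds -> #|D| <= l.-1.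
  move=> DDs; have [cD _ DU _] := pDs D DDs.
  have [w pw szw] := conn_long_path esym eirr cD (fun x => @degD D x DDs).
  have := free w (pth_sub DU pw); rewrite szw; move: l4; move: #|_|; clear; lia.
(* Rerouting spoils at most two of the four components; two others, joined through [c], host the
   second path. *)
have manyD : 3 < size Ds.
  have := sum_card_le smallD.
  rewrite sumDs => h; have cu : #|U| = #|U :\ c|.+1 by rewrite (cardsD1 c) cU'.
  rewrite ltnNge; apply/negP => h2.
  have h3 : size Ds * l.-1 <= 3 * l.-1 by rewrite leq_mul2r h2 orbT.
  move: bigU h h3; rewrite cu; move: (size Ds * l.-1) (3 * l.-1) #|_|; clear; lia.
have longD : {in Ds, forall D : {set T}, {in D, forall x, exists2 s, pth e D (x :: s) & size s = l - 3}}.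
  move=> D DDs x xD; apply: (greedy_path eirr xD) => y yD; exact: degD.
have DTc : {in Ds, forall D : {set T}, D \subset setT :\ c}.
  move=> D DDs; have [_ _ DU _] := pDs D DDs; apply: subset_trans DU _.
  by apply: setSD; apply: subsetT.
have [W' [D1 [D2 [pW' szW' disW']]]] : exists W' D1 D2, [/\ pth e (setT :\ c) W', size W' = l &
    forall D, D \in Ds -> D != D1 -> D != D2 -> [disjoint D & [set z in W']]].
  have pt := pth_take l pW; have szt : size (take l W) = l by rewrite size_takel.
  have [|W' [D1 [D2 [h1 h2 h3]]]] := reroute esym dDs DTc longD pt.
    by rewrite szt; move: l4; clear; lia.
  by exists W', D1, D2; split; rewrite // h2.
have [uDs disDs] := dDs.
have [D3 [D4 [D3Ds D4Ds n34 [d3 d4]]]] : exists D3 D4, [/\ D3 \in Ds, D4 \in Ds, D3 != D4 &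
    [disjoint D3 & [set z in W']] /\ [disjoint D4 & [set z in W']]].
  pose Ds' := [seq D <- Ds | (D != D1) && (D != D2)].
  have h : 1 < size Ds'.
    have : size Ds <= size Ds' + (count_mem D1 Ds + count_mem D2 Ds).
      rewrite size_filter -(count_predC (fun D => (D != D1) && (D != D2)) Ds) leq_add2l.
      elim: (Ds) => [//|D Ds0 IH] /=; move: IH; case: (D == D1); case: (D == D2) => /=; clear; lia.
    by rewrite !count_uniq_mem //; move: manyD; case: (_ \in _); case: (_ \in _) => /=; clear; lia.
  have uDs' : uniq Ds' by apply: filter_uniq.
  have inDs D : D \in Ds' -> D \in Ds /\ [disjoint D & [set z in W']].
    by rewrite mem_filter => /andP[/andP[h1 h2] h3]; split=> //; apply: disW'.
  case E : Ds' h uDs' inDs => [|D3 [|D4 Ds'']] //= _ /andP[n _] inDs.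
  have [h3 d3] := inDs D3 (mem_head _ _).
  have [|h4 d4] := inDs D4; first by rewrite !inE eqxx orbT.
  by exists D3, D4; split=> //; apply: contraNneq n => ->; rewrite mem_head.
have att D : D \in Ds -> exists2 t, pth e D t & [/\ size t = l - 2, sorted e (c :: t) & uniq (c :: t)].
  move=> DDs; have [cD D0 DU dD] := pDs D DDs.
  have DU' : D \subset U by apply: subset_trans DU (subsetDl _ _).
  have cD' : c \notin D by apply/negP => /(subsetP DU); rewrite !inE eqxx.
  have DnU : D != U by apply: contraNneq cD' => ->.
  have [x [y [xD /setDP[yU yD] xy]]] := conn_edge cU DU' D0 DnU.
  have yc : y = c.
    apply/eqP; apply: contraTT xy => yc; apply: dD => //; by rewrite !inE yD yc.
  have [t pt tl] := longD D DDs x xD; exists (x :: t) => //.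
  have /pthP[st ut tD] := pt.
  split; first by rewrite /= tl; move: l4; clear; lia.
    by rewrite /= -yc esym xy.
  by rewrite cons_uniq ut andbT; apply: contra cD' => /tD.
have [t3 p3 [z3 s3 u3]] := att D3 D3Ds; have [t4 p4 [z4 s4 u4]] := att D4 D4Ds.
have /pthP[_ _ t3D] := p3; have /pthP[_ _ t4D] := p4.
have pp : pth e setT (rev t3 ++ c :: t4).
  apply/pthP; split; last by move=> z _; rewrite inE.
    by rewrite sorted_cat_consE s4 andbT -rev_cons sorted_revE.
  rewrite cat_uniq u4 andbT rev_uniq; move: u3; rewrite cons_uniq => /andP[ct3 ->].
  rewrite andTb; apply/hasPn => z zc; apply/negP; rewrite /= mem_rev => zt3.
  move: zc; rewrite inE => /orP[/eqP zc|/t4D zD4]; first by rewrite -zc zt3 in ct3.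
  by have := disjointFr (disDs D3 D4 D3Ds D4Ds n34) (t3D z zt3); rewrite zD4.
have pWT : pth e setT W' by apply: pth_sub pW'; apply: subsetT.
apply: (forest_pair pWT pp); first by rewrite szW'.
  by rewrite size_cat size_rev /= z3 z4; move: l4; clear; lia.
apply: disjoint_seqs => z zW; rewrite mem_cat mem_rev inE !negb_or; apply/and3P; split.
- by apply: contraL zW => /t3D zD; have := disjointFr d3 zD; rewrite in_set => ->.
- by have /pthP[_ _ /(_ z zW)] := pW'; rewrite !inE => /andP[].
- by apply: contraL zW => /t4D zD; have := disjointFr d4 zD; rewrite in_set => ->.
Qed.

End Exceptional.

(** * Structure of dense graphs without the forest *)

(** Once 3 is excluded, an odd length is at least 5 and adds at least 2 to [halves]. *)
Lemma double_odd_count ls : all (fun l => 2 <= l) ls -> all (fun l => l != 3) ls ->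
  (count odd ls).*2 <= halves ls.
Proof.
elim: ls => [//|l ls IH] /= /andP[l2 a2] /andP[l3 a3]; rewrite halves_cons.
have := IH a2 a3; move: l2 l3; clear; case E : (odd l) => /=; lia.
Qed.

Lemma size_le_halves ls : all (fun l => 2 <= l) ls -> size ls <= halves ls.
Proof.
elim: ls => [//|l ls IH] /= /andP[l2 a2]; rewrite halves_cons.
have := IH a2; move: l2; clear; lia.
Qed.

(** The two paths [l1] and [l] alone contribute at least [2 * l./2 >= l - 1] to a sum below [l],
    which leaves no room for a third path, a longer first one or an even [l]. *)
Lemma exceptional_shape l1 ls l : all (fun l => 2 <= l) ls -> l \in ls -> l <= l1 ->
  halves (l1 :: ls) < l -> odd l /\ l1 :: ls = [:: l; l].
Proof.
case: ls => [//|b [|b' t]] a2 lls le.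
  move: lls le; rewrite inE => /eqP <- le; rewrite !halves_cons /halves /= addn0 => hl.
  have ol : odd l by move: hl le; clear; lia.
  split=> //; congr [:: _; _]; move: hl le ol; clear; lia.
move=> hl; exfalso; move: hl; rewrite 3!halves_cons => hl.
have b0 : 0 < b./2 by move: a2 => /= /and3P[h2 _]; move: h2; clear; lia.
have b0' : 0 < b'./2 by move: a2 => /= /and3P[_ h2 _]; move: h2; clear; lia.
have : l./2 < b./2 + (b'./2 + halves t).
  move: lls; rewrite inE => /orP[/eqP->|]; first by move: b0'; clear; lia.
  rewrite inE => /orP[/eqP->|lt]; first by move: b0; clear; lia.
  have : l./2 <= halves t.
    elim: (t) lt => [//|a t' IH]; rewrite inE halves_cons => /orP[/eqP->|/IH]; clear; lia.
  by move: b0; clear; lia.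
by move: hl le; clear; lia.
Qed.

Section DenseStructure.
Variables (T : finType) (e : rel T).
Hypotheses (esym : symmetric e) (eirr : irreflexive e).
Implicit Types (U S D A : {set T}) (x y z c u v : T) (w s t Q W : seq T) (ls : seq nat).

Variables (l1 : nat) (ls : seq nat) (h : nat).
Let F := l1 :: ls.
Hypotheses (soF : sorted geq F) (a2 : all (fun l => 2 <= l) F) (a3 : all (fun l => l != 3) F).
Hypotheses (ls0 : 0 < size ls) (hE : halves F = h).

Lemma others_le : all (fun l => l <= l1) ls.
Proof.
have gt : transitive geq by move=> a b c' /= h1 h2; apply: leq_trans h2 h1.
by move: soF; rewrite /F /= (path_sortedE gt) => /andP[].
Qed.

Lemma halves_rest : 0 < halves ls.
Proof. by apply: halves_gt0 => //; move: a2 => /= /andP[]. Qed.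

Lemma halves_mem l : l \in ls -> l./2 <= halves ls.
Proof.
by elim: (ls) => [//|a t IH]; rewrite inE halves_cons => /orP[/eqP->|/IH]; clear; lia.
Qed.

Lemma others_le_h : all (fun l => l <= h.+1) ls.
Proof.
apply/allP => l lls; have := allP others_le l lls; have := halves_mem lls.
move: hE; rewrite /F halves_cons /=; clear; lia.
Qed.

Lemma first_lt : l1 < h.*2.
Proof. have := halves_rest; move: hE; rewrite /F halves_cons; clear; lia. Qed.

Lemma h_gt1 : 1 < h.
Proof.
have := halves_rest; move: hE a2; rewrite /F halves_cons /= => H /andP[h1 _].
move: H h1; clear; lia.
Qed.

Variable U : {set T}.
Hypotheses (nF : ~ forest e setT F)
  (dU : {in U, forall z, h <= #|nbr e U z|.+1})
  (pU : {in U &, forall y z, e y z -> (h <= #|nbr e U y|) || (h <= #|nbr e U z|)}).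

Lemma path_bound V w : pth e V w -> size w < sumn F.
Proof.
move=> pw; rewrite ltnNge; apply/negP => le; apply: nF.
by apply: forest_sub (forest_pth pw le); apply: subsetT.
Qed.

Lemma no_two_paths V w1 w2 : pth e V w1 -> pth e V w2 ->
  [disjoint [set z in w1] & [set z in w2]] -> h.*2 <= (size w1).+1 -> h <= size w2 ->
  all (fun l => l <= size w2) ls -> False.
Proof.
move=> p1 p2 dis s1 s2 al; apply: nF.
apply: (@forest_sub _ _ V); first exact: subsetT.
apply: (@forest_two_paths _ _ V w1 w2 l1 ls h) => //.
by rewrite -hE; apply: double_odd_count.
Qed.

Lemma connected_structure : conn e U -> 4 * (sumn F).-1 <= #|U| ->
  (exists A u v, [/\ A \subset U, (#|A|).+1 = h &
     {in U :\: A &, forall x y, e x y ->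
     all odd F && ((x == u) && (y == v) || (x == v) && (y == u))}]) \/
  (exists l c, [/\ odd l, F = [:: l; l] & forall W, pth e (setT :\ c) W -> size W < l]).
Proof.
move=> cU bigU; have [w mw] := maxpth_exists e U; have [pw mx] := mw.
have h1 := h_gt1; have tot := sumn_halves F; rewrite hE in tot.
have od := double_odd_count a2 a3; rewrite hE in od.
have long w' : maxpth e U w' -> h.*2 <= (size w').+1.
  move=> [pw' mx']; have [|w0 pw0 sz0] := @conn_long_path _ _ esym eirr U h.-1 cU.
    by move=> x /dU; clear; lia.
  have := mx' _ pw0; rewrite sz0.
  have := path_bound pw'; move: bigU h1 tot; move: #|U| (size w') (sumn F) (count odd F).
  clear; lia.
have nU w' : pth e U w' -> size w' < #|U|.
  move=> /path_bound; move: bigU h1 tot; move: #|U| (size w') (sumn F) (count odd F).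
  clear; lia.
pose dep w' := [exists x, exists y, [&& x \in U :\: [set z in w'], y \in U :\: [set z in w'] & e x y]].
have side w' : maxpth e U w' -> dep w' ->
    exists l c, [/\ odd l, F = [:: l; l] & forall W, pth e (setT :\ c) W -> size W < l].
  move=> mw' /existsP[x /existsP[y /and3P[xR yR xy]]].
  have [Q mQ] := maxpth_exists e (U :\: [set z in w']); have [pQ mxQ] := mQ.
  have RU : U :\: [set z in w'] \subset U by apply: subsetDl.
  have [pw' _] := mw'.
  have Q2 : 1 < size Q.
    have : pth e (U :\: [set z in w']) [:: x; y].
      apply/pthP; split; first by rewrite /= xy.
        by rewrite /= inE (edge_neq eirr xy).
      by move=> z; rewrite !inE => /orP[]/eqP->; move: xR yR; rewrite !inE.
    by move/mxQ.
  have dis : [disjoint [set z in w'] & [set z in Q]].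
    rewrite disjoint_sym; apply: disjoint_seqs => z zQ.
    by have /pthP[_ _ /(_ z zQ)] := pQ; rewrite !inE => /andP[].
  have two := no_two_paths pw' (pth_sub RU pQ) dis (long w' mw').
  have [lt|ge] := ltnP (size Q) h.
    (* With [o] odd lengths, [3h - 2 <= size w' < 2h + o] and [2o <= h] would give [h <= 2], but
       [1 < size Q < h]. *)
    exfalso; case: Q mQ Q2 lt {pQ mxQ dis two} => [//|x0 s] mQ s0 lt.
    have := side_path_size esym eirr dU pU mw' mQ s0 lt.
    have := path_bound pw'; move: lt s0 tot od; rewrite /=; move: (size w') (size s) (sumn F) (count odd F).
    clear; lia.
  have [al|/allPn[l lls lQ]] := boolP (all (fun l => l <= size Q) ls).
    by case: (two ge al).
  have hl : h < l by rewrite -ltnNge in lQ; apply: leq_ltn_trans ge lQ.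
  have a2' : all (fun l => 2 <= l) ls by move: a2 => /= /andP[].
  have [ol FE] : odd l /\ F = [:: l; l].
    by apply: (exceptional_shape a2' lls (allP others_le l lls)); rewrite -/F hE.
  have lh : l = h.+1 by have := allP others_le_h l lls; move: hl; clear; lia.
  have Qh : size Q = l.-1 by move: lQ; rewrite lh -ltnNge /=; move: ge; clear; lia.
  have l4 : 4 < l.
    have l3 : l != 3 by move: a3; rewrite FE /= => /andP[].
    by move: h1 ol l3; rewrite lh; clear; lia.
  have szF : sumn F = l.*2 by rewrite FE /= addn0 addnn.
  have nFl : ~ forest e U [:: l; l].
    by move=> f; apply: nF; rewrite FE; apply: forest_sub f; apply: subsetT.
  have dl : {in U, forall z, l.-2 <= #|nbr e U z|}.
    by move=> z /dU; rewrite lh; clear; lia.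
  have lw : l.*2 <= (size w').+3 by have := long w' mw'; rewrite lh; clear; lia.
  have [c cinU cut] := cut_vertex esym eirr cU ol l4 nFl dl mw' lw mQ Qh.
  exists l, c; split=> //; apply: (cut_vertex_extend esym eirr cU l4 _ dl cinU _ cut).
    by rewrite -FE.
  by move: bigU; rewrite szF; move: l4; move: #|U|; clear; lia.
(* [independent_structure] replaces the longest path by others, so independence is needed off every
   longest path, not only off [w]. *)
have [/existsP[t /andP[pt dt]]|none] :=
  boolP [exists t : (size w).-tuple T, pth e U t && dep t].
  right; apply: (side t) => //; split=> // w' /mx; by rewrite size_tuple.
left.
have ind w' : maxpth e U w' -> {in U :\: [set z in w'] &, forall x y, ~~ e x y}.
  move=> [pw' mx'] x y xR yR; apply: contra none => xy.
  have sz : size w' = size w by apply/eqP; rewrite eqn_leq mx // mx'.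
  have szb : size w' == size w by rewrite sz.
  apply/existsP; exists (Tuple szb); rewrite /= pw' /=.
  by apply/existsP; exists x; apply/existsP; exists y; rewrite xR yR.
have w3 : 2 < size w by have := long w mw; move: h1; clear; lia.
have cnt : (sumn F - halves F).+1.*2 + size F + size w <= #|U|.
  have := path_bound pw; have := size_le_halves a2; rewrite hE.
  move: bigU h1 tot; move: #|U| (size w) (sumn F) (size F) (count odd F); clear; lia.
have dU' : {in U, forall z, halves F <= #|nbr e U z|.+1} by rewrite hE.
have szF : 1 < size F by rewrite /F /= ltnS.
case: (independent_structure esym eirr cU mw ind a2 a3 szF dU' w3 cnt) => [f|].
  by case: nF; apply: forest_sub f; apply: subsetT.
by move=> [A [u [v [h2 h3 h4]]]]; exists A, u, v; rewrite -hE.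
Qed.

Lemma dense_structure : 4 * (sumn F).-1 <= #|U| ->
  [\/ forall W, pth e setT W -> size W < l1,
   exists A u v, [/\ A \subset U, (#|A|).+1 = h &
     {in U :\: A &, forall x y, e x y ->
     all odd F && ((x == u) && (y == v) || (x == v) && (y == u))}] |
   exists l c, [/\ odd l, F = [:: l; l] & forall W, pth e (setT :\ c) W -> size W < l]].
Proof.
move=> bigU; have [Ds [dDs pDs cov sumDs]] := components esym U.
have h1 := h_gt1; have tot := sumn_halves F; rewrite hE in tot.
have degD D x : D \in Ds -> x \in D -> h.-1 <= #|nbr e D x|.
  move=> DDs xD; have [_ _ DU dD] := pDs D DDs.
  by rewrite (nbr_detached DU dD xD); have := dU (subsetP DU x xD); clear; lia.
(* [D] contains an edge, and by [pU] one of its ends has at least [h] neighbours, all of them in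
   [D]. *)
have bigD D : D \in Ds -> h < #|D|.
  move=> DDs; have [cD D0 DU dD] := pDs D DDs; case/set0Pn: D0 => x xD.
  have lt z : z \in D -> h <= #|nbr e D z| -> h < #|D|.
    move=> zD hz; apply: leq_ltn_trans hz _; apply: proper_card; apply/properP.
    by split; [apply: nbr_sub|exists z; rewrite // inE eirr andbF].
  have [y yN] : exists y, y \in nbr e D x.
    by apply/set0Pn; rewrite -card_gt0; have := degD D x DDs xD; move: h1; clear; lia.
  move: yN; rewrite inE => /andP[yD xy].
  have := pU (subsetP DU x xD) (subsetP DU y yD) xy.
  by rewrite -!(nbr_detached DU dD) // => /orP[]; apply: lt.
have pathD D : D \in Ds -> exists2 w, pth e D w & size w = minn #|D| (h.*2).-1.
  move=> DDs; have [cD _ _ _] := pDs D DDs.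
  have [w pw sz] := conn_long_path esym eirr cD (fun x => @degD D x DDs).
  by exists w; rewrite // sz; congr minn; move: h1; clear; lia.
have [uDs disDs] := dDs.
have [/hasP[D DDs /= bD]|small] := boolP (has (fun D : {set T} => h.*2 <= #|D|.+1) Ds).
  have [/hasP[D' D'Ds nD]|one] := boolP (has (fun D' => D' != D) Ds).
    have [w1 p1 z1] := pathD D DDs; have [w2 p2 z2] := pathD D' D'Ds.
    have [_ _ DU _] := pDs D DDs; have [_ _ D'U _] := pDs D' D'Ds.
    have hw2 : h < size w2 by rewrite z2; have := bigD D' D'Ds; move: h1; move: #|D'|; clear; lia.
    case: (no_two_paths (pth_sub DU p1) (pth_sub D'U p2)).
    - apply: disjoint_seqs => z; have /pthP[_ _ s1] := p1; have /pthP[_ _ s2] := p2.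
      move/s1 => zD; apply/negP => /s2 zD'.
      by have := disjointFr (disDs D' D D'Ds DDs nD) zD'; rewrite zD.
    - by rewrite z1; move: bD; move: #|D|; clear; lia.
    - exact: ltnW.
    - by apply: sub_all others_le_h => l /leq_trans; apply.
  have UD : U = D.
    have [_ _ DU _] := pDs D DDs; apply/eqP; rewrite eqEsubset DU andbT.
    apply/subsetP => x xU; have [D' D'Ds xD'] := cov x xU.
    by have := hasPn one D' D'Ds; rewrite negbK => /eqP <-.
  have cU : conn e U by rewrite UD; have [] := pDs D DDs.
  by case: (connected_structure cU bigU) => h'; [apply: Or32|apply: Or33].
have smallD D : D \in Ds -> #|D| <= h.*2 - 2.
  by move=> DDs; have := hasPn small D DDs; rewrite -ltnNge; move: #|D|; clear; lia.
have [W mW] := maxpth_exists e setT; have [pW mxW] := mW.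
have [lt|ge] := ltnP (size W) l1.
  by apply: Or31 => W' /mxW h'; apply: leq_ltn_trans h' lt.
case: nF.
have longD : {in Ds, forall D : {set T}, {in D, forall x, exists2 s, pth e D (x :: s) & size s = h.-1}}.
  by move=> D DDs x xD; apply: (greedy_path eirr xD) => y yD; exact: degD.
have DT : {in Ds, forall D : {set T}, D \subset setT} by move=> D _; apply: subsetT.
have szt : size (take l1 W) = l1 by rewrite size_takel.
have [|W' [D1 [D2 [pW' szW' disW']]]] := reroute esym dDs DT longD (pth_take l1 pW).
  by rewrite szt; have := first_lt; move: h1; clear; lia.
rewrite szt in szW'.
pose Ds' := [seq D <- Ds | (D != D1) && (D != D2)].
have inDs D : D \in Ds' -> D \in Ds /\ [disjoint D & [set z in W']].
  by rewrite mem_filter => /andP[/andP[h2 h3] h4]; split=> //; apply: disW'.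
have dDs' : disjoint_family Ds'.
  split; first by apply: filter_uniq.
  by move=> D D' /inDs[h2 _] /inDs[h3 _]; apply: disDs.
(* A component with at most [2h - 2] vertices has a Hamiltonian path by [conn_long_path]. *)
have pathD' : {in Ds', forall D, exists2 w, pth e D w & size w = #|D|}.
  move=> D /inDs[DDs _]; have [w pw sz] := pathD D DDs; exists w; rewrite // sz.
  by have := smallD D DDs; move: h1; move: #|D|; clear; lia.
(* The two spoiled components have at most [4h - 4] vertices together. Of the [4|F| - 4] in [U] at
   least [2|F|] remain, since [|F| >= 2h], and [forest_bins] needs no more. *)
have sumDs' : #|U| <= \sum_(D <- Ds') #|D| + (h.*2 - 2).*2.
  have one D0 : \sum_(D <- Ds | D == D0) #|D| <= h.*2 - 2.
    have [D0Ds|nD0] := boolP (D0 \in Ds).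
      have pe : perm_eq [seq D <- Ds | D == D0] [:: D0].
        apply: uniq_perm => //; first exact: filter_uniq.
        by move=> D; rewrite inE mem_filter; case: eqVneq => // ->; rewrite D0Ds.
      by rewrite -big_filter (perm_big _ pe) big_seq1; apply: smallD.
    rewrite big_seq_cond big1 // => D /andP[DDs /eqP E]; by rewrite -E DDs in nD0.
  rewrite -sumDs /Ds' big_filter (bigID (fun D => (D != D1) && (D != D2))) /= leq_add2l -addnn.
  apply: leq_trans (leq_add (one D1) (one D2)).
  rewrite [X in X <= _]big_mkcond [X in _ <= X + _]big_mkcond [X in _ <= _ + X]big_mkcond /=.
  rewrite -big_split /=; apply: leq_sum => D _.
  by case: (D == D1); case: (D == D2) => /=; clear; lia.
have [ws [sws uws subws szws sumws]] := family_paths dDs' pathD'.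
have f1 : forest e [set z in W'] [:: l1] by rewrite -szW'; apply: forest_pth1 pW'.
have f2 : forest e [set z in flatten ws] ls.
  apply: (@forest_bins _ _ ls ws) => //.
  - by move: soF; rewrite /F /= => /path_sorted.
  - by move=> z; rewrite in_set.
  - apply/allP => w /szws[D /inDs[DDs _] ->].
    apply: leq_trans (bigD D DDs); have := others_le_h; case: (ls) => [//|a t] /= /andP[] //.
  - rewrite sumws; move: sumDs' bigU; rewrite /F /=; move: tot; rewrite /F [sumn _]/=.
    have : 0 < l1 by move: a2 => /= /andP[h2 _]; move: h2; clear; lia.
    move: #|U| (\sum_(D <- _) _) h1 (sumn ls) (count odd _); clear; lia.
rewrite /F -cat1s.
apply: (@forest_sub _ _ ([set z in W'] :|: [set z in flatten ws])); first exact: subsetT.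
apply: forest_cat => //; apply: disjoint_seqs => z zW; apply/negP => /subws[D /inDs[_ dD] zD].
by have := disjointFr dD zD; rewrite in_set zW.
Qed.

End DenseStructure.

(** * Upper bounds for clique numbers *)

Lemma bin_double b j : 2 ^ j * 'C(b, j) <= 'C(b.*2, j).
Proof.
elim: j => [|j IH]; first by rewrite !bin0.
rewrite -(leq_pmul2l (ltn0Sn j)) mulnCA !mul_bin_left expnS mulnACA.
by apply: leq_mul IH; rewrite mulnBr mul2n leq_sub2l // mul2n -addnn leq_addr.
Qed.

(** Since [2 ^ j >= j + 1]. The factor [j + 1] cancels against the one in [mul_bin_diag], which is
    what the deletion steps below require. *)
Lemma bin_half a b j : b.*2 <= a -> j.+1 * 'C(b, j) <= 'C(a, j).
Proof.
move=> le; apply: leq_trans (leq_bin2l j le); apply: leq_trans (bin_double b j).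
by rewrite leq_mul2r ltn_expl ?orbT.
Qed.

Lemma bin_ge n j : 0 < j < n -> n <= 'C(n, j).
Proof.
elim: n j => [|n IH] [|j] //= jn; rewrite binS.
have [->|j0] := posnP j; first by rewrite bin1 bin0 addn1.
move: jn; rewrite ltnS leq_eqVlt => /orP[/eqP E|lt]; last first.
  apply: leq_trans (_ : 'C(n, j.+1) + 1 <= _); first by rewrite addn1 ltnS IH.
  by rewrite leq_add2l bin_gt0; apply: ltnW; apply: ltnW.
by rewrite -E binn add1n ltnS binSn.
Qed.

(** [C(c, j+1) / c = C(c-1, j) / (j+1)] is monotone in [c]. *)
Lemma bin_ratio c M j : c <= M -> M * 'C(c, j.+1) <= c * 'C(M, j.+1).
Proof.
case: c => [|c]; first by rewrite bin0n muln0.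
case: M => [//|M] le; rewrite -(leq_pmul2l (ltn0Sn j)).
rewrite mulnCA [X in _ <= X]mulnCA -!mul_bin_diag mulnCA leq_mul2l leq_mul2l.
by rewrite leq_bin2l ?orbT.
Qed.

Lemma bin_ratio2 c M j : c <= M -> M * 'C(c.+1, j.+2) <= c * 'C(M.+1, j.+2).
Proof.
move=> le; rewrite -(leq_pmul2l (ltn0Sn j.+1)) mulnCA [X in _ <= X]mulnCA -!mul_bin_diag.
rewrite [X in X <= _]mulnCA [X in _ <= X]mulnCA; apply: leq_mul => //.
exact: bin_ratio.
Qed.

Section Counting.
Variables (T : finType) (e : rel T).
Hypotheses (esym : symmetric e) (eirr : irreflexive e).
Implicit Types (U A S Z V : {set T}).

Lemma cl_strip U Z d j : Z \subset U -> {in Z, forall z, #|nbr e U z| <= d} ->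
  cl e U j.+2 <= cl e (U :\: Z) j.+2 + #|Z| * 'C(d, j.+1).
Proof.
have [n] := ubnP #|Z|; elim: n U Z => [//|n IH] U Z; rewrite ltnS => Zn ZU dZ.
have [->|/set0Pn[z zZ]] := eqVneq Z set0; first by rewrite setD0 leq_addr.
have zU := subsetP ZU z zZ.
have cZ : #|Z| = #|Z :\ z|.+1 by rewrite (cardsD1 z) zZ.
have cl1 := cl_del_le esym eirr j zU (dZ z zZ).
have h1 : #|Z :\ z| < n by rewrite -cZ.
have h2 : {in Z :\ z, forall y, #|nbr e (U :\ z) y| <= d}.
  move=> y; rewrite inE => /andP[_ yZ]; apply: leq_trans (dZ y yZ).
  by apply: subset_leq_card; apply: nbr_mono; apply: subsetDl.
have := IH (U :\ z) (Z :\ z) h1 (setSD _ ZU) h2.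
have -> : (U :\ z) :\: (Z :\ z) = U :\: Z.
  apply/setP => y; rewrite !inE; case: eqVneq => [->|_] /=; last by [].
  by rewrite zZ.
move: cl1; rewrite cZ mulSn; clear; lia.
Qed.

(** For true [b], strip the vertices off [A] other than [u] and [v]; at most [#|A| + 2] vertices are
    left, and Pascal's rule applied twice to [C(#|A| + 2, j+2)] yields the terms. *)
Lemma cl_structure U A u v (b : bool) j : A \subset U ->
  {in U :\: A &, forall x y, e x y -> b && ((x == u) && (y == v) || (x == v) && (y == u))} ->
  cl e U j.+2 <= (#|U| - #|A|) * 'C(#|A|, j.+1) + 'C(#|A|, j.+2) + b * 'C(#|A|, j).
Proof.
move=> AU H; have cU := card_split AU.
have nbrA z : z \in U :\: A -> (b -> z != u /\ z != v) -> nbr e U z \subset A.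
  move=> zZ zb; apply/subsetP => y; rewrite inE => /andP[yU zy].
  apply: contraT => yA; have yZ : y \in U :\: A by rewrite inE yA.
  have := H z y zZ yZ zy; case: b zb {H} => //= /(_ isT)[zu zv].
  by rewrite (negPf zu) (negPf zv).
case: b nbrA {H} => nbrA; last first.
  have h : {in U :\: A, forall z, #|nbr e U z| <= #|A|}.
    by move=> z zZ; apply: subset_leq_card; apply: nbrA.
  have := cl_strip j (subsetDl U A) h.
  have -> : U :\: (U :\: A) = A by rewrite setDDr setDv set0U (setIidPr AU).
  have := cl_le e A j.+2; rewrite mul0n -cU addKn.
  clear; lia.
pose Z := (U :\: A) :\: [set u; v].
have ZU : Z \subset U by apply: subset_trans (subsetDl _ _) (subsetDl _ _).
have h : {in Z, forall z, #|nbr e U z| <= #|A|}.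
  move=> z; rewrite in_setD in_set2 negb_or => /andP[/andP[zu zv] zZ].
  by apply: subset_leq_card; apply: nbrA.
have := cl_strip j ZU h; have := cl_le e (U :\: Z) j.+2.
have cZ := card_split ZU.
have [k [k2 kE]] : exists k, k <= 2 /\ #|U :\: Z| = #|A| + k.
  exists (#|U :\: Z| - #|A|).
  have sub : U :\: Z \subset A :|: [set u; v].
    apply/subsetP => z; rewrite !inE.
    by case: (z \in A); case: (z \in U); case: (z == u); case: (z == v).
  have sub2 : A \subset U :\: Z.
    by apply/subsetP => z zA; rewrite !inE zA (subsetP AU) //= andbF.
  have := subset_leq_card sub; have := subset_leq_card sub2.
  have := cardsUI A [set u; v]; have : #|[set u; v]| <= 2 by rewrite cards2; case: (_ != _).
  move: #|_| #|_| #|_| #|_| #|_|; clear; lia.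
rewrite kE -cU => c1 c2; have {cU cZ} zE : #|Z| = #|U :\: A| - k by move: cZ; rewrite kE -cU; clear; lia.
have kU : k <= #|U :\: A|.
  have := card_split ZU; rewrite kE; have := card_split AU; move: #|_| #|_| #|_| #|_|; clear; lia.
rewrite addKn mul1n; apply: leq_trans c2 _; rewrite zE.
apply: leq_trans (leq_add c1 (leqnn _)) _.
have le : 'C(#|A| + k, j.+2) <= 'C(#|A|, j.+2) + k * 'C(#|A|, j.+1) + 'C(#|A|, j).
  case: k k2 {kE c1 zE kU} => [|[|[|//]]] _; rewrite ?addn0 ?addn1 ?addn2 ?binS ?mul0n ?mul1n; try by clear; lia.
have : k * 'C(#|A|, j.+1) + (#|U :\: A| - k) * 'C(#|A|, j.+1) = #|U :\: A| * 'C(#|A|, j.+1).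
  by rewrite -mulnDl subnKC.
move: le; clear; lia.
Qed.

Lemma cl_split_le S V s : 0 < s -> S \subset V -> detached e S V ->
  cl e V s <= cl e S s + cl e (V :\: S) s.
Proof. by move=> s0 SV dS; rewrite (cl_detached dS s0 SV). Qed.

(* Luo's bound. *)
Lemma pathfree_cl M j U : 0 < M -> (forall w, pth e U w -> size w <= M) ->
  M * cl e U j.+2 <= #|U| * 'C(M, j.+2).
Proof.
move=> M0 free.
apply: (@pathfree_bound _ _ esym eirr (fun V => M * cl e V j.+2) (fun a => a * 'C(M, j.+2)) M.+1 U) => //.
- by move=> S V SV dS /=; rewrite -mulnDr leq_mul2l cl_split_le ?orbT.
- move=> V; rewrite ltnS => VM /=; apply: leq_trans (bin_ratio j.+1 VM).
  by rewrite leq_mul2l cl_le orbT.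
- move=> V x xV lV dx /= IH; have := cl_del_le esym eirr j xV dx.
  rewrite -(leq_pmul2l M0) mulnDr => h; apply: leq_trans h _.
  have -> : #|V| * 'C(M, j.+2) = #|V|.-1 * 'C(M, j.+2) + 'C(M, j.+2).
    by rewrite -mulSnr prednK //; apply: leq_trans lV.
  apply: leq_add IH _; rewrite -(leq_pmul2l (ltn0Sn j.+1)) mulnCA.
  case: (M) M0 => [//|M'] _; rewrite -mul_bin_diag leq_mul2l /=.
  apply: bin_half; rewrite subSS subn1 /=; clear; lia.
- by move=> a b /=; rewrite -mulnDl.
Qed.

Lemma cl_apex c s : cl e setT s.+1 <= cl e (setT :\ c) s.+1 + cl e (setT :\ c) s.
Proof.
rewrite (@cl_del _ _ esym setT c s) ?inE ?eirr // leq_add2l; apply: cl_mono.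
by apply/subsetP => z; rewrite !inE andTb andbT; apply: contraTneq => ->; rewrite eirr.
Qed.

Lemma apex_del_le V x j d : x \in V -> #|nbr e V x| <= d ->
  cl e V j.+2 + cl e V j.+1 <= cl e (V :\ x) j.+2 + cl e (V :\ x) j.+1 + 'C(d.+1, j.+1).
Proof.
move=> xV dx; rewrite !(@cl_del _ _ esym V x) ?eirr // binS.
have := cl_le e (nbr e V x) j.+1; have := cl_le e (nbr e V x) j.
have := leq_bin2l j dx; have := leq_bin2l j.+1 dx.
by clear; lia.
Qed.

(** The sum counts the cliques of size [j + 2] after a vertex joined to all of [U] is added. A
    component [K_(l-1)] of [U] then becomes [K_l], which explains [C(l, j+2)]. *)
Lemma pathfree_apex l j U : odd l -> 1 < l -> (forall w, pth e U w -> size w < l) ->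
  l.-1 * (cl e U j.+2 + cl e U j.+1) <= #|U| * 'C(l, j.+2).
Proof.
move=> ol l1 free.
apply: (@pathfree_bound _ _ esym eirr (fun V => l.-1 * (cl e V j.+2 + cl e V j.+1))
   (fun a => a * 'C(l, j.+2)) l U) => //.
- move=> S V SV dS /=; rewrite -mulnDr leq_mul2l; apply/orP; right.
  have := @cl_split_le S V j.+2 isT SV dS; have := @cl_split_le S V j.+1 isT SV dS.
  by clear; lia.
- move=> V Vl /=; case: l l1 Vl {ol free} => [//|l] _; rewrite ltnS => Vl.
  apply: leq_trans (bin_ratio2 j Vl); rewrite leq_mul2l binS; apply/orP; right.
  by apply: leq_add; apply: cl_le.
- move=> V x xV lV dx /= IH; have := apex_del_le j xV dx.
  have M0 : 0 < l.-1 by move: l1; clear; lia.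
  rewrite -(leq_pmul2l M0) [X in _ <= X]mulnDr => h; apply: leq_trans h _.
  have -> : #|V| * 'C(l, j.+2) = #|V|.-1 * 'C(l, j.+2) + 'C(l, j.+2).
    by rewrite -mulSnr prednK //; apply: leq_trans lV; apply: ltnW.
  apply: leq_add IH _; rewrite -(leq_pmul2l (ltn0Sn j.+1)).
  case: (l) l1 ol => [//|l'] l1 ol; rewrite -mul_bin_diag mulnCA /=.
  (* For odd [l], [2((l - 2)./2 + 1) = l - 1]. *)
  apply: leq_mul => //; apply: bin_half; move: ol l1; rewrite subSS; clear; lia.
- by move=> a b /=; rewrite -mulnDl.
Qed.

(* The extremal number in the case [s = delta_F + 1], as a function of [a = n - 1]. *)
Definition apexf l a := a %/ l.-1 * l + (a %% l.-1 == l.-2).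

(** If the remainders carry, the quotient gains [l], more than the at most two units lost. Otherwise
    a remainder [l - 2] forces the other one to be 0, and its unit survives. *)
Lemma apexfD l a b : 2 < l -> apexf l a + apexf l b <= apexf l (a + b).
Proof.
move=> l2; rewrite /apexf.
have M0 : 0 < l.-1 by move: l2; clear; lia.
have abE : a + b = (a %/ l.-1 + b %/ l.-1) * l.-1 + (a %% l.-1 + b %% l.-1).
  by rewrite {1}(divn_eq a l.-1) {1}(divn_eq b l.-1) mulnDl addnACA.
rewrite abE divnMDl // modnMDl.
have := ltn_pmod a M0; have := ltn_pmod b M0.
move: (a %/ _) (a %% _) (b %/ _) (b %% _) => q r q' r' r'M rM.
have [lt|ge] := ltnP (r + r') l.-1.
  rewrite (divn_small lt) (modn_small lt) addn0 mulnDl.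
  move: (q * l) (q' * l) => x y; move: lt l2; clear.
  by case: eqP; case: eqP; case: eqP => /=; lia.
have [t tE] : exists t, r + r' = l.-1 + t by exists (r + r' - l.-1); move: ge; clear; lia.
rewrite tE divnDl ?modnDl ?dvdnn // divnn M0 !mulnDl.
move: (q * l) (q' * l) (t %/ _ * l) => x y z; rewrite mul1n; move: tE l2 rM r'M; clear.
by case: eqP; case: eqP; case: eqP => /=; lia.
Qed.

(** A vertex of degree at most [(l - 2)./2] lies in no clique of size [l - 1] or [l - 2]. Its
    deletion costs nothing, so the induction preserves an integral bound with rounding. *)
Lemma pathfree_apexf l U : odd l -> 4 < l -> (forall w, pth e U w -> size w < l) ->
  cl e U l.-1 + cl e U l.-2 <= apexf l #|U|.
Proof.
move=> ol l4 free.
have [j lE] : exists j, l = j.+3 by exists (l - 3); move: l4; clear; lia.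
rewrite lE /= -lE.
apply: (@pathfree_bound _ _ esym eirr (fun V => cl e V j.+2 + cl e V j.+1) (apexf l) l U) => //.
- by move: l4; clear; lia.
- move=> S V SV dS /=.
  have := @cl_split_le S V j.+2 isT SV dS; have := @cl_split_le S V j.+1 isT SV dS.
  by clear; lia.
- move=> V Vl /=; apply: leq_trans (leq_add (cl_le _ _ _) (cl_le _ _ _)) _.
  rewrite -binS /apexf lE /=; move: Vl; rewrite lE ltnS leq_eqVlt => /orP[/eqP->|].
    by rewrite divnn /= modnn binSn mul1n leq_addr.
  rewrite ltnS leq_eqVlt => /orP[/eqP->|lt].
    by rewrite binn divn_small // modn_small // eqxx.
  by rewrite bin_small.
- move=> V x xV lV dx /= IH; have := apex_del_le j xV dx.
  rewrite bin_small ?addn0 => [h|]; last by move: l4; rewrite lE; clear; lia.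
  apply: leq_trans h _; apply: leq_trans IH _.
  have -> : #|V| = #|V|.-1 + 1 by rewrite addn1 prednK //; apply: leq_trans lV; move: l4; clear; lia.
  apply: leq_trans (apexfD _ _ _); first by rewrite addn1 /= leq_addr.
  by move: l4; clear; lia.
- by move=> a b; apply: apexfD; move: l4; clear; lia.
Qed.

End Counting.

(** * The hypothesis on n when few vertices survive *)

Lemma bin_mul_le M d j : d.*2 < M -> M * 'C(d, j.+1) <= 'C(M, j.+2).
Proof.
case: M => [//|M]; rewrite ltnS => le; rewrite -(leq_pmul2l (ltn0Sn j.+1)) -mul_bin_diag.
by rewrite mulnCA leq_mul2l bin_half ?orbT.
Qed.

(* The case of few vertices surviving the cleaning: [N'] and [n'] are the numbers of cliques
   and vertices after it, [N] and [n] those before it. *)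
Lemma threshold_small M d j n n' N N' : j <= d -> d.+1.*2 < M -> d.+1 <= n -> n' <= n ->
  5 * 'C(M, j.+2) ^ 2 <= M * 'C(d.+1, j.+1) * (n - d.+1) -> n' < 4 * M ->
  M * N' <= n' * 'C(M, j.+2) -> N.*2 <= N'.*2 + (n - n') * ('C(d, j.+1).*2 + 'C(d, j)) ->
  N <= 'C(d.+1, j.+1) * (n - d.+1).
Proof.
move=> jd dM dn n'n thr n'M luo clean.
have rel := mul_bin_diag d.+1 j; rewrite [d.+1.-1]/= in rel.
have bM := @bin_mul_le M d.+1 j dM.
have C0E := binS d j.
have [Y YE] : {Y | n - d.+1 = Y} by exists (n - d.+1).
have nE : n = Y + d.+1 by rewrite -YE subnK.
rewrite YE in thr *.
have M0 : 0 < M by move: dM; clear; lia.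
(* Multiply the claim by [2M]: compared with [clean], there is a surplus [C(d, j)] for each deleted
   vertex, and [K] says that it covers Luo's bound for the survivors. *)
suff K : (n' * 'C(M, j.+2)).*2 + M * ('C(d, j.+1).*2 + 'C(d, j)) * d.+1 <=
    M * 'C(d, j) * Y + M * ('C(d, j.+1).*2 + 'C(d, j)) * n'.
  rewrite -(leq_pmul2l M0) -leq_double.
  have h1 : (M * N).*2 <= (n' * 'C(M, j.+2)).*2 + M * ((n - n') * ('C(d, j.+1).*2 + 'C(d, j))).
    rewrite doubleMr; apply: leq_trans (leq_mul (leqnn M) clean) _.
    by rewrite mulnDr leq_add2r -doubleMr leq_double.
  apply: leq_trans h1 _.
  rewrite C0E; move: K; rewrite nE in n'n *; move: n'n; move: 'C(d, j.+1) 'C(d, j) => x c n'n.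
  have [k kE] : exists k, Y + d.+1 = n' + k by exists (Y + d.+1 - n'); move: n'n; clear; lia.
  rewrite kE addKn; have : M * (x.*2 + c) * (n' + k) = M * (x.*2 + c) * (Y + d.+1) by rewrite kE.
  move: (n' * _); clear; nia.
have n'M' : n' <= 4 * M - 1 by move: n'M; clear; lia.
(* For [s = 2] the hypothesis on [n] is too weak for the crude estimate [key] below, so there the
   terms with [n'] are compared jointly. *)
case: j jd thr luo clean rel bM C0E => [|j] jd thr luo _ rel bM _.
  rewrite !bin1 bin0 in thr rel *.
  have B2 : ('C(M, 2)).*2 = M * M.-1.
    rewrite bin2 -[RHS](odd_double_half) oddM; case: (M) M0 => [//|M'] _.
    by rewrite /= andNb add0n.
  have [o oE] : exists o, M = d.+1.*2 + 1 + o by exists (M - (d.+1.*2 + 1)); move: dM; clear; lia.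
  rewrite doubleMr B2.
  have thr4 : 5 * (M * M.-1) ^ 2 <= 4 * (M * d.+1 * Y).
    by rewrite -B2; move: thr; move: 'C(M, 2) (M * _ * _); clear; nia.
  have thr5 : 5 * (M * M.-1 ^ 2) <= 4 * (d.+1 * Y).
    rewrite -(leq_pmul2l M0); move: thr4; rewrite !expnS !expn0 !muln1; move: M.-1; clear; nia.
  have MpE : M.-1 = d.+1.*2 + o by rewrite oE; clear; lia.
  have Yge : 5 * M * (d.+1 + o) <= Y.
    have p : 0 < 4 * d.+1 by [].
    rewrite -(leq_pmul2l p); apply: leq_trans (_ : 5 * (M * M.-1 ^ 2) <= _); last first.
      by move: thr5; clear; nia.
    rewrite MpE; have : 4 * d.+1 * (d.+1 + o) <= (d.+1.*2 + o) ^ 2 by rewrite expnS expn1; clear; nia.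
    by move: (_ ^ 2) => q; clear; nia.
  have -> : n' * (M * M.-1) = M * (n' * M.-1) by rewrite mulnCA.
  have -> : M * (d.*2 + 1) * d.+1 = M * ((d.*2 + 1) * d.+1) by rewrite mulnA.
  have -> : M * 1 * Y + M * (d.*2 + 1) * n' = M * (Y + (d.*2 + 1) * n') by rewrite muln1 [in RHS]mulnDr mulnA.
  rewrite -mulnDr leq_pmul2l // MpE.
  have h : n' * o.+1 + (d.*2 + 1) * d.+1 <= Y.
    apply: leq_trans Yge; apply: leq_trans (_ : (4 * M - 1) * o.+1 + (d.*2 + 1) * d.+1 <= _).
      by rewrite leq_add2r leq_mul2r n'M' orbT.
    by rewrite oE; clear; nia.
  by move: h; clear; nia.
(* The 8 is twice the 4 in [n' < 4 * M]: the surplus alone pays for Luo's bound. *)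
have key : 8 * 'C(M, j.+3) <= 'C(d, j.+1) * Y.
  have d0 : 0 < d.+1 * M by rewrite muln_gt0 M0.
  rewrite -(leq_pmul2l d0).
  have e1 : d.+1 * M * ('C(d, j.+1) * Y) = j.+2 * (M * 'C(d.+1, j.+2) * Y).
    by rewrite mulnACA rel -mulnA; congr (_ * _); rewrite mulnA ['C(_, _) * M]mulnC.
  rewrite e1; apply: leq_trans (leq_mul (leqnn j.+2) thr).
  have -> : d.+1 * M * (8 * 'C(M, j.+3)) = (8 * (M * d.+1)) * 'C(M, j.+3).
    by rewrite [d.+1 * M]mulnC mulnA; congr (_ * _); rewrite mulnC.
  have -> : j.+2 * (5 * 'C(M, j.+3) ^ 2) = (5 * j.+2 * 'C(M, j.+3)) * 'C(M, j.+3).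
    by rewrite expnS expn1 !mulnA [j.+2 * 5]mulnC.
  rewrite leq_mul2r; apply/orP; right.
  rewrite -(leq_pmul2l (ltn0Sn j.+2)).
  have -> : j.+3 * (5 * j.+2 * 'C(M, j.+3)) = 5 * (j.+2 * (j.+3 * 'C(M, j.+3))).
    by rewrite mulnCA -!mulnA; congr (5 * _); rewrite mulnCA.
  case: (M) dM => [//|[//|M2]] dM.
  have -> : j.+2 * (j.+3 * 'C(M2.+2, j.+3)) = M2.+2 * (M2.+1 * 'C(M2, j.+1)).
    by rewrite -(mul_bin_diag M2.+2 j.+2) mulnCA -(mul_bin_diag M2.+1 j.+1).
  have h1 : d.+1.*2.-1 <= 'C(M2, j.+1).
    apply: leq_trans (_ : 'C(d.+1.*2.-1, j.+1) <= _); last by apply: leq_bin2l; move: dM; clear; lia.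
    by apply: bin_ge; move: jd; clear; lia.
  have -> : j.+3 * (8 * (M2.+2 * d.+1)) = M2.+2 * (8 * j.+3 * d.+1) by clear; nia.
  have -> : 5 * (M2.+2 * (M2.+1 * 'C(M2, j.+1))) = M2.+2 * (5 * (M2.+1 * 'C(M2, j.+1))) by rewrite mulnCA.
  rewrite leq_pmul2l //; apply: leq_trans (_ : 5 * (d.+1.*2 * d.+1.*2.-1) <= _).
    by move: jd; clear; nia.
  by rewrite leq_mul2l leq_mul //; move: dM; clear; lia.
have sm : (n' * 'C(M, j.+3)).*2 + M * ('C(d, j.+2).*2 + 'C(d, j.+1)) * d.+1 <=
    M * (8 * 'C(M, j.+3)) + M * ('C(d, j.+2).*2 + 'C(d, j.+1)) * n'.
  have [le|lt] := leqP d.+1 n'.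
    apply: leq_add; last by rewrite leq_mul2l le orbT.
    by move: n'M; move: 'C(_, _); clear; nia.
  apply: leq_trans (leq_addr _ _).
  have A2 : M * ('C(d, j.+2).*2 + 'C(d, j.+1)) <= 'C(M, j.+3).*2.
    apply: leq_trans (_ : (M * 'C(d.+1, j.+2)).*2 <= _); last by rewrite leq_double.
    rewrite doubleMr leq_mul2l binS doubleD; apply/orP; right; clear; lia.
  move: A2 lt dM; move: 'C(M, j.+3) (M * (_ + _)); clear; nia.
apply: leq_trans sm _; rewrite leq_add2r -mulnA leq_mul2l key orbT //.
Qed.

(** * Extremal graphs *)

Section GrowCliques.
Variables (T : finType) (e : rel T).
Hypotheses (esym : symmetric e) (eirr : irreflexive e).
Implicit Types (A V W : {set T}).

(** Every vertex added to [W] sees all of the clique [A], hence completes at least [C(#|A|, j+1)]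
    new cliques. *)
Lemma cl_grow A W V j : A \subset W -> W \subset V -> clique e A ->
  (forall x a, x \notin A -> a \in A -> e x a) ->
  cl e W j.+2 + (#|V| - #|W|) * 'C(#|A|, j.+1) <= cl e V j.+2.
Proof.
move=> AW + cA join; have [n] := ubnP #|V|; elim: n V => [//|n IH] V; rewrite ltnS => Vn WV.
have [->|WnV] := eqVneq V W; first by rewrite subnn mul0n addn0.
have [x /setDP[xV xW]] : exists x, x \in V :\: W.
  by apply/set0Pn; rewrite setD_eq0; apply: contra WnV => VW; rewrite eqEsubset VW.
have xA : x \notin A by apply: contra xW => /(subsetP AW).
have cV : #|V| = #|V :\ x|.+1 by rewrite (cardsD1 x) xV.
have WVx : W \subset V :\ x by rewrite subsetD1 WV.
rewrite (@cl_del _ _ esym V x) ?eirr // cV subSn ?subset_leq_card // mulSn.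
have h := IH (V :\ x) _ WVx; rewrite addnCA addnC; apply: leq_add.
  by apply: h; rewrite -cV.
rewrite -(cl_clique _ cA); apply: cl_mono; apply/subsetP => a aA.
by rewrite inE (subsetP WV) ?(subsetP AW) //= join.
Qed.

End GrowCliques.

Lemma card_interval n a b : a <= b <= n -> #|[set u : 'I_n | a <= u < b]| = b - a.
Proof.
move=> /andP[ab bn]; rewrite -sum1_card.
rewrite (eq_bigl (fun u : 'I_n => (a <= u) && (u < b))); last by move=> u; rewrite inE.
rewrite -(big_mkord (fun i => (a <= i) && (i < b)) (fun _ => 1)).
have -> : \sum_(0 <= i < n | (a <= i) && (i < b)) 1 = \sum_(a <= i < b) 1.
  rewrite [RHS](big_nat_widen a b n) // [RHS]big_nat_cond [LHS]big_nat_cond.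
  rewrite (big_nat_widenl a 0) //; apply: eq_bigl => i /=.
  by case: (a <= i); case: (i < b); rewrite ?andbF ?andbT.
by rewrite sum_nat_const_nat muln1.
Qed.

Section ExtremalGraph.
Variables (ls : seq nat) (n : nat).
Hypotheses (a2 : all (fun l => 2 <= l) ls) (h0 : 0 < halves ls).
Let d := deltaF ls.
Local Notation G := (GF ls n).

Lemma deltaF_halves : d.+1 = halves ls.
Proof. by rewrite /d /deltaF -/(halves ls) subn1 prednK. Qed.

Lemma GF_sym : symmetric G.
Proof. by move=> u v; rewrite /GF eq_sym minnC maxnC. Qed.

Lemma GF_irr : irreflexive G.
Proof. by move=> u; rewrite /GF eqxx. Qed.

Lemma consec_split (T : Type) (B : pred T) w : ~~ noconsec B w ->
  exists s1 a b s2, [/\ w = s1 ++ a :: b :: s2, B a & B b].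
Proof.
case: w => [//|x w]; elim: w x => [//|y w IH] x; rewrite /noconsec /= negb_and negbK.
case/orP => [/andP[Bx By]|h]; first by exists [::], x, y, w.
by have [s1 [a [b [s2 [-> Ba Bb]]]]] := IH y h; exists (x :: s1), a, b, s2.
Qed.

(** Consecutive vertices both outside the [K_d] can only span the extra edge. Cutting the path there
    gives two parts without such consecutive pairs; as the total is odd, one part is even and
    rounding up costs no more than for the whole. *)
Lemma GF_path w : sorted G w -> uniq w -> (odd (size w) || ~~ all odd ls) ->
  (size w)./2 <= count (fun u : 'I_n => u < d) w.
Proof.
move=> sw uw ow; pose B := fun u : 'I_n => d <= u.
have cB : count (fun u : 'I_n => u < d) w + count B w = size w.
  rewrite -(count_predC (fun u : 'I_n => u < d) w); congr (_ + _).
  by apply: eq_count => u /=; rewrite /B leqNgt.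
have uh := uphalf_half (size w).
suff : count B w <= uphalf (size w) by move: cB uh; rewrite -{1 2}(odd_double_half (size w)); clear; lia.
have [nc|] := boolP (noconsec B w); first exact: noconsec_count.
case/consec_split => s1 [a [b [s2 [E Ba Bb]]]].
have high u v : G u v -> B u -> B v -> all odd ls /\
    (u = d :> nat /\ v = d.+1 :> nat \/ u = d.+1 :> nat /\ v = d :> nat).
  move=> /andP[_ /orP[h|/and3P[od mn mx]]] Bu Bv.
    by exfalso; move: h Bu Bv; rewrite /B -/d; clear; lia.
  by split=> //; move: mn mx Bu Bv; rewrite /B -/d; clear; lia.
have [sa gab sb] : [/\ sorted G (rcons s1 a), G a b & sorted G (b :: s2)].
  by apply: sorted_mid; rewrite -E.
have [od ab] := high a b gab Ba Bb.
have osz : odd (size w) by move: ow; rewrite od orbF.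
have pair u v : G u v -> B u -> B v -> (b == u) || (b == v).
  move=> guv Bu Bv; have [_ uv] := high u v guv Bu Bv.
  by rewrite -!val_eqE /=; move: ab uv; clear; lia.
have pair' u v : G u v -> B u -> B v -> (a == u) || (a == v).
  move=> guv Bu Bv; have [_ uv] := high u v guv Bu Bv.
  by rewrite -!val_eqE /=; move: ab uv; clear; lia.
have [u1 u2] : b \notin rcons s1 a /\ a \notin b :: s2.
  move: uw; rewrite E -cat_rcons cat_uniq => /and3P[_ /hasPn h _]; split.
    by apply: h; rewrite mem_head.
  by apply/negP => /h; rewrite /= mem_rcons mem_head.
have n1 : noconsec B (rcons s1 a).
  apply: sorted_splitI => t1 c c' t2 E'; apply/negP => /andP[Bc Bc'].
  have gcc : G c c' by have [] := @sorted_mid _ G t1 c c' t2; rewrite -?E'.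
  by case/negP: u1; rewrite E' mem_cat !inE; case/orP: (pair _ _ gcc Bc Bc') => ->; rewrite ?orbT.
have n2 : noconsec B (b :: s2).
  apply: sorted_splitI => t1 c c' t2 E'; apply/negP => /andP[Bc Bc'].
  have gcc : G c c' by have [] := @sorted_mid _ G t1 c c' t2; rewrite -?E'.
  by case/negP: u2; rewrite E' mem_cat !inE; case/orP: (pair' _ _ gcc Bc Bc') => ->; rewrite ?orbT.
have := noconsec_count n1; have := noconsec_count n2; move: osz.
rewrite E -cat_rcons count_cat size_cat; move: (count _ _) (count _ _) (size _) (size _).
by clear; lia.
Qed.

(** By [GF_path] each path uses at least [l./2] of the [delta_F] dominating vertices, in total one
    more than there are. *)
Lemma GF_free : ~ forest G setT ls.
Proof.
case=> ws [sz so un _].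
have : halves ls <= count (fun u : 'I_n => u < d) (flatten ws).
  have od : forall w, w \in ws -> odd (size w) || ~~ all odd ls.
    move=> w wws; case: (boolP (all odd ls)) => [/allP h|_]; last by rewrite orbT.
    by rewrite h // -sz; apply/mapP; exists w.
  rewrite -{1}sz; elim: (ws) so un od => [//|w ws' IH] /= /andP[sw so] un od.
  move: un; rewrite cat_uniq => /and3P[uw _ un].
  rewrite halves_cons count_cat; apply: leq_add.
    by apply: GF_path => //; apply: od; rewrite mem_head.
  by apply: IH => // w' w'in; apply: od; rewrite inE w'in orbT.
rewrite -size_filter -(card_uniqP (filter_uniq _ un)) -deltaF_halves ltnNge; apply/negP.
rewrite negbK; apply: leq_trans (_ : #|[set u : 'I_n | 0 <= u < minn d n]| <= _).
  by apply: subset_leq_card; apply/subsetP => u; rewrite mem_filter inE => /andP[ud _]; rewrite /= leq_min ud ltn_ord.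
by rewrite card_interval ?geq_minr // subn0 geq_minl.
Qed.

Lemma GF_count j : d.+2 <= n ->
  (n - d) * 'C(d, j.+1) + 'C(d, j.+2) + all odd ls * 'C(d, j) <= Ncliques G j.+2.
Proof.
move=> dn; rewrite Ncliques_cl.
pose A := [set u : 'I_n | 0 <= u < d].
have dn' : d <= n by move: dn; clear; lia.
have cA : #|A| = d by rewrite card_interval ?subn0.
have adj (u v : 'I_n) : u != v -> u < d -> G u v.
  by move=> n0 ud; rewrite /GF n0 gtn_min -/d ud.
have clA : clique G A.
  by apply/cliqueP => u v; rewrite !inE /= => ud _ n0; apply: adj.
have join u v : u \notin A -> v \in A -> G u v.
  rewrite !inE /= => ud vd; rewrite GF_sym; apply: adj => //.
  by apply: contraNneq ud => <-.
have [od|nod] := boolP (all odd ls); last first.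
  have := cl_grow GF_sym GF_irr j (subxx A) (subsetT A) clA join.
  by rewrite cl_clique // cA cardsT card_ord mul0n addn0 addnC.
pose W := [set u : 'I_n | 0 <= u < d.+2].
have AW : A \subset W by apply/subsetP => u; rewrite !inE /=; clear; lia.
have cW : #|W| = d.+2 by rewrite card_interval ?subn0.
have clW : clique G W.
  apply/cliqueP => u v; rewrite !inE /= => ud vd n0.
  have [h|h] := ltnP u d; first exact: adj.
  have [h'|h'] := ltnP v d; first by rewrite GF_sym; apply: adj; rewrite // eq_sym.
  rewrite /GF n0 od /=; apply/orP; right; rewrite -/d.
  by move: n0; rewrite -val_eqE /= => n0; move: n0 ud vd h h'; clear; lia.
have := cl_grow GF_sym GF_irr j AW (subsetT W) clA join.
rewrite cl_clique // cA cW cardsT card_ord mul1n.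
rewrite !binS; have -> : n - d = (n - d.+2) + 2 by move: dn; clear; lia.
by rewrite mulnDl; clear; lia.
Qed.

End ExtremalGraph.

(* Extremal for [2P_(m+1)] and cliques of size [m], i.e. [s = delta_F + 1]. *)
Definition windmill (m n : nat) : rel 'I_n :=
  fun u v => (u != v) && [|| u == 0 :> nat, v == 0 :> nat | u.-1 %/ m == v.-1 %/ m].

Section Windmill.
Variables (m n : nat).
Hypotheses (m2 : 1 < m) (n0 : 0 < n).
Local Notation G := (@windmill m n).

Lemma windmill_sym : symmetric G.
Proof.
move=> u v; rewrite /windmill eq_sym [v.-1 %/ _ == _]eq_sym; congr (_ && _).
by case: (_ == 0); case: (_ == 0).
Qed.

Lemma windmill_irr : irreflexive G.
Proof. by move=> u; rewrite /windmill eqxx. Qed.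

(** A path avoiding the hub [0] stays in one block of [m] vertices. Hence every [P_(m+1)] meets the
    hub, and no two of them are disjoint. *)
Lemma windmill_path (w : seq 'I_n) : sorted G w -> uniq w ->
  (forall u : 'I_n, u \in w -> 0 < u) -> size w <= m.
Proof.
move=> sw uw pos; have m0 : 0 < m by apply: ltnW.
have [q qE] : exists q, forall u : 'I_n, u \in w -> u.-1 %/ m = q.
  case: w sw pos {uw} => [_ _|x w]; first by exists 0.
  elim: w x => [|y w IH] x /=; first by exists (x.-1 %/ m) => u; rewrite inE => /eqP->.
  move=> /andP[xy sw] pos; have [u uw|q qE] := IH y sw; first by apply: pos; rewrite inE uw orbT.
  exists q => u; rewrite inE => /orP[/eqP->|/qE//]; rewrite -(qE y (mem_head _ _)).
  move: xy => /andP[_ /or3P[/eqP h|/eqP h|/eqP//]].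
    by have := pos x (mem_head _ _); rewrite h.
  by have := pos y; rewrite h !inE eqxx orbT => /(_ isT).
have um : uniq [seq (u : 'I_n).-1 %% m | u <- w].
  rewrite map_inj_in_uniq // => u v uin vin E; apply: val_inj => /=.
  have := divn_eq u.-1 m; rewrite (qE u uin) E -(qE v vin) -divn_eq.
  by have := pos u uin; have := pos v vin; clear; lia.
have := uniq_leq_size um (s2 := iota 0 m); rewrite size_map size_iota; apply.
by move=> z /mapP[u _ ->]; rewrite mem_iota ltn_pmod.
Qed.

Lemma windmill_free : ~ forest G setT [:: m.+1; m.+1].
Proof.
case=> ws [sz so un _].
case: ws sz so un => [|w1 [|w2 [|? ?]]] //= [s1 s2] /and3P[so1 so2 _].
rewrite cats0 cat_uniq => /and3P[u1 /hasPn dis u2].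
have short w : sorted G w -> uniq w -> size w = m.+1 -> exists2 u : 'I_n, u \in w & u = 0 :> nat.
  move=> so u sz; have [/hasP[z zw /eqP z0]|/hasPn h] := boolP (has (fun u : 'I_n => u == 0 :> nat) w).
    by exists z.
  have := windmill_path so u; rewrite sz ltnn => H.
  by suff : false by []; apply: H => z /h; rewrite lt0n.
have [x xw x0] := short w1 so1 u1 s1; have [y yw y0] := short w2 so2 u2 s2.
have xy : x = y by apply: val_inj; rewrite /= x0 y0.
by have /negP := dis y yw; rewrite /= -xy xw.
Qed.

Definition blade a b := [set u : 'I_n | (u < 1) || (a <= u < b)].

Lemma card_blade a b : 0 < a <= b -> b <= n -> #|blade a b| = (b - a).+1.
Proof.
move=> /andP[a0 ab] bn.
have -> : blade a b = [set u : 'I_n | 0 <= u < 1] :|: [set u : 'I_n | a <= u < b].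
  by apply/setP => u; rewrite !inE.
rewrite cardsU !card_interval ?ab // (_ : _ :&: _ = set0) ?cards0.
  by rewrite subn0 add1n.
by apply/setP => u; rewrite !inE; move: a0; clear; lia.
Qed.

Lemma blade_clique q b : b <= q.+1 * m + 1 -> clique G (blade (q * m + 1) b).
Proof.
move=> bq; apply/cliqueP => u v; rewrite !inE => hu hv uv; rewrite /windmill uv /=.
have m0 : 0 < m by apply: ltnW.
have blk (z : 'I_n) : q * m + 1 <= z < b -> z.-1 %/ m = q.
  move=> /andP[h1 h2]; apply/eqP; rewrite eqn_leq -ltnS ltn_divLR // leq_divRL //.
  by move: h1 h2 bq; move: (_ * m) (_ * m); clear; lia.
case/orP: hu => hu; first by rewrite -leqn0 -ltnS hu.
case/orP: hv => hv; first by rewrite -[v == 0 :> nat]leqn0 -ltnS hv orbT.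
by rewrite (blk u hu) (blk v hv) eqxx !orbT.
Qed.

(** The new blade shares only the hub with the earlier vertices, so for [m > 1] no clique of size
    [m] is counted twice. *)
Lemma windmill_grow q b : q * m + 1 <= b -> b <= n -> b <= q.+1 * m + 1 ->
  cl G [set u : 'I_n | u < q * m + 1] m + 'C((b - (q * m + 1)).+1, m) <= cl G [set u : 'I_n | u < b] m.
Proof.
move=> qb bn bq.
have <- : #|blade (q * m + 1) b| = (b - (q * m + 1)).+1 by apply: card_blade bn; rewrite qb addn1.
rewrite -(cl_clique _ (blade_clique bq)).
have E : [set u : 'I_n | u < b] = [set u : 'I_n | u < q * m + 1] :|: blade (q * m + 1) b.
  apply/setP => u; rewrite !inE; move: qb; move: (q * m); clear; lia.
rewrite E; apply: cl_super; apply: leq_ltn_trans m2.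
apply: leq_trans (_ : #|[set u : 'I_n | 0 <= u < 1]| <= 1); last by rewrite card_interval.
apply: subset_leq_card.
by apply/subsetP => u; rewrite !inE; move: (q * m); clear; lia.
Qed.

Lemma windmill_count : apexf m.+1 n.-1 <= Ncliques G m.
Proof.
rewrite Ncliques_cl /apexf /=; have m0 : 0 < m by apply: ltnW.
have full q : q * m + 1 <= n -> q * m.+1 <= cl G [set u : 'I_n | u < q * m + 1] m.
  elim: q => [//|q IH] qn; have le : q * m + 1 <= q.+1 * m + 1 by rewrite leq_add2r leq_mul2r leqnSn orbT.
  have := windmill_grow le qn (leqnn _); apply: leq_trans.
  have -> : (q.+1 * m + 1 - (q * m + 1)).+1 = m.+1 by rewrite subnDr mulSn addnK.
  by rewrite binSn mulSn addnC leq_add2r IH // (leq_trans le).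
have nE := divn_eq n.-1 m; have rm := ltn_pmod n.-1 m0.
move: nE rm; move: (_ %/ _) (_ %% _) => q r nE rm.
have qn : q * m + 1 <= n by move: nE n0; move: (q * m); clear; lia.
have bq : n <= q.+1 * m + 1 by rewrite mulSn; move: nE rm n0; move: (q * m); clear; lia.
have := windmill_grow qn (leqnn n) bq.
have -> : [set u : 'I_n | u < n] = setT by apply/setP => u; rewrite !inE ltn_ord.
apply: leq_trans; apply: leq_add (full q qn) _.
case: eqP => // rE; have -> : (n - (q * m + 1)).+1 = m by move: nE rE n0 m2; move: (q * m); clear; lia.
by rewrite binn.
Qed.

End Windmill.

(** * Extremal numbers *)

Import Order.TTheory GRing.Theory Num.Theory.

Lemma Ncliques_ext (T : finType) (e e' : rel T) s : e =2 e' -> Ncliques e s = Ncliques e' s.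
Proof.
move=> ee; rewrite /Ncliques; congr #|pred_of_set _|; apply/setP => A; rewrite !inE.
by congr (_ && _); apply: eq_forallb_in => x xA; apply: eq_forallb_in => y yA; rewrite ee.
Qed.

Lemma simplebP (T : finType) (e : rel T) : reflect (irreflexive e /\ symmetric e) (simpleb e).
Proof.
apply: (iffP andP) => -[h1 h2]; split.
- by move=> x; apply/negbTE/(forallP h1).
- by move=> x y; apply/eqP/(forallP (forallP h2 x)).
- by apply/forallP => x; rewrite h1.
- by apply/forallP => x; apply/forallP => y; rewrite h2.
Qed.

Lemma ex_le n s ls k : 0 < sumn ls ->
  (forall e : rel 'I_n, symmetric e -> irreflexive e -> ~ forest e setT ls -> Ncliques e s <= k) ->
  ex n s (lf_graph ls) <= k.
Proof.
move=> pos H; apply/bigmax_leqP => g /andP[/simplebP[gi gs] gF]; apply: H => //.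
by move=> f; case/negP: gF; apply/containsb_forest.
Qed.

Lemma ex_ge n s ls (e : rel 'I_n) : 0 < sumn ls -> symmetric e -> irreflexive e ->
  ~ forest e setT ls -> Ncliques e s <= ex n s (lf_graph ls).
Proof.
move=> pos es ei nF; pose g := [ffun p : 'I_n * 'I_n => e p.1 p.2].
have ge : (fun x y => g (x, y)) =2 e by move=> x y; rewrite ffunE.
rewrite -(Ncliques_ext s ge); apply: (@leq_bigmax_cond _ _ _ g).
apply/andP; split; first by apply/simplebP; split=> [x|x y]; rewrite !ge.
apply/negP => /containsb_forest h; apply: nF.
have gs : symmetric (fun x y => g (x, y)) by move=> x y; rewrite !ge.
have [ws [h1 h2 h3 h4]] := h gs pos.
exists ws; split=> //; apply: sub_all h2 => w; by rewrite (eq_sorted ge).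
Qed.

Lemma Ncliques1 (T : finType) (e : rel T) : Ncliques e 1 = #|T|.
Proof.
rewrite /Ncliques -(card_imset predT (@set1_inj T)); apply: eq_card => A; rewrite !inE.
apply/andP/imsetP => [[/cards1P[x ->] _]|[x _ ->]]; first by exists x.
rewrite cards1; split=> //; apply/forall_inP => y; rewrite inE => /eqP->.
by apply/forall_inP => z; rewrite inE => /eqP->; rewrite eqxx.
Qed.

Lemma rat_threshold (a b d n : nat) : 0 < b ->
  (a%:R / b%:R + d%:R <= n%:R :> rat)%R -> d <= n /\ a <= b * (n - d).
Proof.
move=> b0 le; have b0' : (0 < b%:R :> rat)%R by rewrite ltr0n.
have dn : d <= n.
  rewrite -(ler_nat rat); apply: Order.POrderTheory.le_trans le.
  by rewrite lerDr divr_ge0 ?ler0n.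
split=> //; move: le; rewrite -lerBrDr -natrB // ler_pdivrMr // -natrM ler_nat.
by rewrite mulnC.
Qed.

(** [bin_mul_le] bounds both factors of the square from below, one of them further by [M]. *)
Lemma threshold_large M d j Y : j <= d -> d.+1.*2 < M ->
  5 * 'C(M, j.+2) ^ 2 <= M * 'C(d.+1, j.+1) * Y -> 5 * M <= Y.
Proof.
move=> jd dM thr; have bM := @bin_mul_le M d.+1 j dM.
have C0 : 0 < 'C(d.+1, j.+1) by rewrite bin_gt0.
have p : 0 < M * 'C(d.+1, j.+1) by rewrite muln_gt0 C0; move: dM; clear; lia.
rewrite -(leq_pmul2l p); apply: leq_trans thr.
rewrite expnS expn1 mulnCA leq_mul2l /=; apply: leq_mul; first exact: bM.
apply: leq_trans bM; exact: leq_pmulr.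
Qed.

Section UpperBound.
Variables (T : finType) (e : rel T).
Hypotheses (esym : symmetric e) (eirr : irreflexive e).

Lemma clique_upper_bound l1 ls d j : sorted geq (l1 :: ls) ->
  all (fun l => 2 <= l) (l1 :: ls) -> all (fun l => l != 3) (l1 :: ls) -> 0 < size ls ->
  halves (l1 :: ls) = d.+2 -> j <= d -> d.+1 <= #|T| ->
  5 * 'C((sumn (l1 :: ls)).-1, j.+2) ^ 2 <=
    (sumn (l1 :: ls)).-1 * 'C(d.+1, j.+1) * (#|T| - d.+1) ->
  ~ forest e setT (l1 :: ls) ->
  [\/ Ncliques e j.+2 <= (#|T| - d.+1) * 'C(d.+1, j.+1) + 'C(d.+1, j.+2) +
         all odd (l1 :: ls) * 'C(d.+1, j),
   forall W, pth e setT W -> size W < l1 |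
   exists l c, [/\ odd l, l1 :: ls = [:: l; l] & forall W, pth e (setT :\ c) W -> size W < l]].
Proof.
move=> so a2 a3 ls0 hE jd dn thr nF; rewrite Ncliques_cl.
have tot := sumn_halves (l1 :: ls); rewrite hE in tot.
set M := (sumn (l1 :: ls)).-1 in thr *.
have dM : d.+1.*2 < M by rewrite /M tot; clear; lia.
have [U [_ dU pU clean]] := cleaning esym eirr d j setT; rewrite cardsT in clean.
have free W : pth e setT W -> size W <= M.
  move=> pW; rewrite /M -ltnS prednK; last by rewrite tot; clear; lia.
  rewrite ltnNge; apply/negP => le; apply: nF.
  by apply: forest_sub (forest_pth pW le); apply: subsetT.
have [small|big] := ltnP #|U| (4 * M).
  apply: Or31; rewrite -addnA; apply: leq_trans (leq_addr _ _); rewrite mulnC.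
  apply: (threshold_small jd dM dn (max_card _) thr small _ clean).
  apply: pathfree_cl => //; first by move: dM; clear; lia.
  by move=> w /(pth_sub (subsetT U)); apply: free.
have dU' : {in U, forall z, d.+2 <= #|nbr e U z|.+1} by move=> z /dU.
case: (dense_structure esym eirr so a2 a3 ls0 hE nF dU' pU big) => [h|[A [u [v [AU cA H]]]]|h].
- exact: Or32.
- apply: Or31; case: cA => cA; have := cl_structure esym eirr j AU H; rewrite cA => h.
  have Un : #|U| <= #|T| by apply: max_card.
  have AUc : d.+1 <= #|U| by rewrite -cA; apply: subset_leq_card.
  have h2 : (#|T| - #|U|) * ('C(d, j.+1).*2 + 'C(d, j)) <= ((#|T| - #|U|) * 'C(d.+1, j.+1)).*2.
    by rewrite doubleMr leq_mul2l binS doubleD leq_add2l -addnn leq_addr orbT.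
  have h3 : (#|T| - d.+1) * 'C(d.+1, j.+1) =
      (#|T| - #|U|) * 'C(d.+1, j.+1) + (#|U| - d.+1) * 'C(d.+1, j.+1).
    by rewrite -mulnDl; congr (_ * _); move: Un AUc; clear; lia.
  by rewrite h3; move: clean h h2; clear; lia.
- exact: Or33.
Qed.

End UpperBound.

(** For [s <= delta_F] the bound of [pathfree_apex] stays below the count in G_F(n);
    [s = delta_F + 1] is left to the windmill. *)
Lemma windmill_lt_GF l j n : odd l -> 4 < l -> j.+4 <= l -> l.*2 <= n - l.-2 ->
  (n.-1) * 'C(l, j.+2) <= l.-1 * ('C(l.-2, j.+1) * (n - l.-2)).
Proof.
move=> ol l4 jl Yl; case: l ol l4 jl Yl => [//|[//|l]] ol l4 jl; rewrite [l.+2.-2]/= [l.+2.-1]/= => Yl.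
have e1 : j.+2 * ((l.+1 - j.+1) * 'C(l.+2, j.+2)) = l.+2 * (l.+1 * 'C(l, j.+1)).
  by rewrite mulnCA -mul_bin_diag mulnCA -mul_bin_down.
(* [(j + 2)(l - j)] is concave in [j] and equals [2l] at both ends [j = 0] and [j = l - 2] of the
   range. *)
have q : (2 * l) * 'C(l.+2, j.+2) <= l.+2 * (l.+1 * 'C(l, j.+1)).
  rewrite -e1 mulnA leq_mul2r; apply/orP; right; move: jl; clear; nia.
have p : 0 < l.+2 by [].
rewrite -(leq_pmul2l p) mulnA [X in _ <= X](_ : _ = l.+2 * (l.+1 * 'C(l, j.+1)) * (n - l)); last first.
  by rewrite !mulnA.
apply: leq_trans (leq_mul q (leqnn _)).
rewrite [X in _ <= X]mulnAC leq_mul2r; apply/orP; right; move: Yl l4 ol; clear; nia.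
Qed.

(** The central binomial coefficient grows like a power of 2. The quadratic bound obtained ensures
    [(n - 1) / (l - 1) >= l - 1], where the windmill overtakes G_F(n). *)
Lemma threshold_exponential l Y : 4 < l ->
  5 * 'C(l.*2.-1, l.-1) ^ 2 <= l.*2.-1 * Y -> l * l <= Y.
Proof.
move=> l4; case: l l4 => [//|[//|l]] l4; rewrite [l.+2.-1]/= => thr.
have ME : l.+2.*2.-1 = l.+1.*2.+1 by clear; lia.
rewrite ME in thr.
have b1 : l.+1.*2.+1 * 2 ^ l <= 'C(l.+1.*2.+1, l.+1).
  rewrite -(leq_pmul2l (ltn0Sn l)) -mul_bin_diag [_.+1.-1]/= mulnCA leq_mul2l /=.
  apply: leq_trans (bin_double l.+1 l); by rewrite mulnC leq_mul2l binSn leqnn orbT.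
have : l.+1.*2.+1 * (5 * (l.+1.*2.+1 * (2 ^ l * 2 ^ l))) <= l.+1.*2.+1 * Y.
  apply: leq_trans thr; rewrite expnS expn1 mulnCA leq_mul2l /= mulnA mulnACA.
  exact: leq_mul.
rewrite leq_pmul2l // => h; apply: leq_trans h.
have := ltn_expl l (isT : 1 < 2); move: (2 ^ l) => x lx.
apply: leq_trans (_ : 5 * (l.+1.*2.+1 * (l.+1 * l.+1)) <= _); first by clear; nia.
by rewrite !leq_mul2l leq_mul ?orbT.
Qed.

Lemma forest1_pathfree (T : finType) (e : rel T) U l : forest e U [:: l] ->
  exists2 w, pth e U w & size w = l.
Proof.
case=> ws [sz so un sU]; case: ws sz so un sU => [//|w [|//]] /= [sz] /andP[so _].
by rewrite cats0 => un sU; exists w => //; apply/pthP.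
Qed.

Lemma card_ord_D1 n (c : 'I_n) : #|setT :\ c| = n.-1.
Proof. by have := cardsD1 c setT; rewrite in_setT cardsT card_ord => E; rewrite [in RHS]E. Qed.

Lemma ex1_le n ls : 0 < sumn ls -> ex n 1 (lf_graph ls) <= n.
Proof. by move=> pos; apply: ex_le => // e _ _ _; rewrite Ncliques1 card_ord. Qed.

Lemma ex_path_le n s l ls : 0 < l -> ex n s (path_graph l) <= ex n s (lf_graph (l :: ls)).
Proof.
move=> l0; apply: ex_le => [|e es ei nF]; first by rewrite /= addn0.
apply: ex_ge => //; first by rewrite /= addn_gt0 l0.
case=> -[|w ws] [] //= [sz _] /andP[sw _]; rewrite cat_uniq => /andP[uw _] _; apply: nF.
rewrite -sz; apply: forest_sub (subsetT _) (forest_pth1 (U := setT) (w := w) _).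
by apply/pthP; split=> // z; rewrite inE.
Qed.

Lemma ex_regular n l1 ls d j : sorted geq (l1 :: ls) ->
  all (fun l => 2 <= l) (l1 :: ls) -> all (fun l => l != 3) (l1 :: ls) -> 0 < size ls ->
  halves (l1 :: ls) = d.+2 -> j <= d -> d.+3 <= n ->
  5 * 'C((sumn (l1 :: ls)).-1, j.+2) ^ 2 <=
    (sumn (l1 :: ls)).-1 * 'C(d.+1, j.+1) * (n - d.+1) ->
  ~ (exists l, odd l /\ l1 :: ls = [:: l; l]) ->
  ex n j.+2 (lf_graph (l1 :: ls)) <=
  maxn (Ncliques (GF (l1 :: ls) n) j.+2) (ex n j.+2 (path_graph l1)).
Proof.
move=> so a2 a3 ls0 hE jd dn thr reg.
have pos : 0 < sumn (l1 :: ls) by rewrite sumn_halves hE.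
have l10 : 0 < l1 by case/andP: a2; case: (l1).
have dE : deltaF (l1 :: ls) = d.+1.
  by apply/eqP; rewrite -eqSS -hE deltaF_halves ?hE.
apply: ex_le => // e es ei nF.
have thr' : 5 * 'C((sumn (l1 :: ls)).-1, j.+2) ^ 2 <=
    (sumn (l1 :: ls)).-1 * 'C(d.+1, j.+1) * (#|'I_n| - d.+1) by rewrite card_ord.
have dn' : d.+1 <= #|'I_n| by rewrite card_ord; apply: leq_trans dn; apply: leqW.
rewrite leq_max; case: (clique_upper_bound es ei so a2 a3 ls0 hE jd dn' thr' nF) => [h|h|[l [c [ol E _]]]].
- rewrite card_ord -dE in h; apply/orP; left; apply: leq_trans h _.
  by apply: GF_count => //; rewrite ?hE ?dE.
- apply/orP; right; apply: (@ex_ge n j.+2 [:: l1]) => //; first by rewrite /= addn0.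
  by case/forest1_pathfree => w pw E; have := h w pw; rewrite E ltnn.
- by case: reg; exists l.
Qed.

Lemma double_odd_dichotomy n l j (e : rel 'I_n) : odd l -> 4 < l -> j.+3 <= l -> l.-2 < n ->
  5 * 'C(l.*2.-1, j.+2) ^ 2 <= l.*2.-1 * 'C(l.-2, j.+1) * (n - l.-2) ->
  symmetric e -> irreflexive e -> ~ forest e setT [:: l; l] ->
  Ncliques e j.+2 <= (n - l.-2) * 'C(l.-2, j.+1) + 'C(l.-2, j.+2) + 'C(l.-2, j) \/
  exists c, forall W, pth e (setT :\ c) W -> size W < l.
Proof.
move=> ol l4 jl dn thr es ei nF.
have [d lE] : exists d, l = d.+3 by exists (l - 3); move: l4; clear; lia.
have so : sorted geq [:: l; l] by rewrite /= leqnn.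
have a2 : all (fun l => 2 <= l) [:: l; l] by rewrite /= andbT andbb; move: l4; clear; lia.
have a3 : all (fun l => l != 3) [:: l; l] by rewrite /= andbT andbb; move: l4; clear; lia.
have hE : halves [:: l; l] = d.+2.
  by rewrite /halves /= addn0; move: ol lE; clear; lia.
have sE : sumn [:: l; l] = l.*2 by rewrite /= addn0 addnn.
have lE2 : l.-2 = d.+1 by rewrite lE.
have jd : j <= d by move: jl lE; clear; lia.
have dn' : d.+1 <= #|'I_n| by rewrite card_ord -lE2; apply: ltnW.
rewrite lE2 in thr dn *.
have := clique_upper_bound es ei so a2 a3 isT hE jd dn'.
rewrite sE card_ord /= ol mul1n => /(_ thr nF) [h|h|[l' [c [_ [<- _] h]]]].
- by left.
(* If there is no [P_l] at all, any vertex can play the role of [c]. *)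
- have n0 : 0 < n by apply: leq_trans dn.
  by right; exists (Ordinal n0) => W /(pth_sub (subsetT _)); apply: h.
- by right; exists c.
Qed.

Lemma ex_double_odd n l j : odd l -> 4 < l -> j.+4 <= l -> l.*2 <= n - l.-2 ->
  5 * 'C(l.*2.-1, j.+2) ^ 2 <= l.*2.-1 * 'C(l.-2, j.+1) * (n - l.-2) ->
  ex n j.+2 (lf_graph [:: l; l]) <=
  (n - l.-2) * 'C(l.-2, j.+1) + 'C(l.-2, j.+2) + 'C(l.-2, j).
Proof.
move=> ol l4 jl Yl thr; have l1 : 1 < l by apply: leq_trans l4.
apply: ex_le => [|e es ei nF]; first by rewrite /= addn0 addn_gt0 ltnW.
have dn : l.-2 < n by move: Yl l4; clear; lia.
case: (double_odd_dichotomy ol l4 (ltnW jl) dn thr es ei nF) => // -[c free].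
apply: leq_trans (leq_addr _ _); apply: leq_trans (leq_addr _ _).
have l10 : 0 < l.-1 by move: l4; clear; lia.
rewrite Ncliques_cl -(leq_pmul2l l10) [(n - _) * _]mulnC; apply: leq_trans (windmill_lt_GF ol l4 jl Yl).
rewrite -(card_ord_D1 c); apply: leq_trans (pathfree_apex es ei j ol l1 free).
by rewrite leq_mul2l; apply/orP; right; apply: cl_apex.
Qed.

Lemma ex_double_odd_top n l : odd l -> 4 < l -> l.-2 < n ->
  5 * 'C(l.*2.-1, l.-1) ^ 2 <= l.*2.-1 * (n - l.-2) ->
  ex n l.-1 (lf_graph [:: l; l]) = apexf l n.-1.
Proof.
move=> ol l4 dn thr; have l1 : 1 < l by apply: leq_trans l4.
have pos : 0 < sumn [:: l; l] by rewrite /= addn0 addn_gt0 ltnW.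
have big := threshold_exponential l4 thr.
have [j lE] : exists j, l = j.+3 by exists (l - 3); move: l4; clear; lia.
have lE1 : l.-1 = j.+2 by rewrite lE.
have lE2 : l.-2 = j.+1 by rewrite lE.
apply/eqP; rewrite eqn_leq; apply/andP; split; last first.
  have m2 : 1 < l.-1 by rewrite lE1.
  have n0 : 0 < n by move: dn; case: (n).
  have EE : l.-1.+1 = l by rewrite lE.
  have := windmill_count m2 n0; rewrite EE => h; apply: leq_trans h _; apply: ex_ge => //.
  - exact: windmill_sym.
  - exact: windmill_irr.
  - by have := windmill_free (n := n) m2; rewrite EE.
apply: ex_le => // e es ei nF.
have thr' : 5 * 'C(l.*2.-1, j.+2) ^ 2 <= l.*2.-1 * 'C(l.-2, j.+1) * (n - l.-2).
  by rewrite -lE1 -lE2 binn muln1.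
have jl : j.+3 <= l by rewrite lE.
case: (double_odd_dichotomy ol l4 jl dn thr' es ei nF) => [|[c free]].
  have z : 'C(j.+1, j.+2) = 0 by apply: bin_small.
  rewrite lE2 binn z addn0 muln1 binSn -lE1 => h; apply: leq_trans h _.
  have -> : n - j.+1 + j.+1 = n by rewrite subnK // -lE2 ltnW.
  apply: leq_trans (leq_addr _ _).
  have l10 : 0 < l.-1 by rewrite lE1.
  (* The bound from G_F(n) is [n] here. With quotient [q] and remainder [r <= l - 2] of [n - 1],
     [q * l = n - 1 - r + q >= n] as soon as [q >= l - 1]. *)
  have q : l.-1 <= n.-1 %/ l.-1.
    rewrite leq_divRL //; move: big l4; clear; nia.
  have := divn_eq n.-1 l.-1; have := ltn_pmod n.-1 l10.
  have lE' : l.-1.+1 = l by rewrite lE.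
  rewrite -[X in _ -> _ -> _ <= _ * X]lE' mulnS.
  by move: q dn; move: (_ %/ _) (_ %% _) => q r; rewrite mulnC; move: (_ * _) => p; clear; lia.
have := cl_apex es ei c j.+1; have := pathfree_apexf es ei ol l4 free.
by rewrite lE2 lE1 -Ncliques_cl card_ord_D1 => a b; apply: leq_trans b a.
Qed.

Unset Implicit Arguments.

Theorem mainTheorem1 (ls : seq nat) (s n : nat) :
  2 <= size ls ->
  sorted geq ls ->
  all (fun l => 2 <= l) ls ->
  all (fun l => l != 3) ls ->
  0 < s -> s <= (deltaF ls).+1 ->
  ((5 * 'C(lf_order ls - 1, s) ^ 2)%:R
     / ((lf_order ls - 1) * 'C(deltaF ls, s - 1))%:R
     + (deltaF ls)%:R <= (n%:R : rat))%R ->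
  (~ (exists l, odd l /\ ls = [:: l; l]) ->
     ex n s (lf_graph ls) =
     maxn (Ncliques (GF ls n) s) (ex n s (path_graph (head 0 ls)))) /\
  (forall l, odd l -> ls = [:: l; l] ->
     (s <= deltaF ls -> ex n s (lf_graph ls) = Ncliques (GF ls n) s) /\
     (s = (deltaF ls).+1 ->
        ex n s (lf_graph ls) =
        (n - 1) %/ (l - 1) * l + ((n - 1) %% (l - 1) == l - 2))).
Proof.
case: ls => [//|l1 ls]; rewrite [size _]/= ltnS => ls0 so a2 a3 s0 sd.
have hge : 2 <= halves (l1 :: ls) by apply: leq_trans (size_le_halves a2); rewrite /= ltnS.
have [d hE] : exists d, halves (l1 :: ls) = d.+2.
  by exists (halves (l1 :: ls) - 2); move: hge; clear; lia.
have dE : deltaF (l1 :: ls) = d.+1 by apply/eqP; rewrite -eqSS -hE deltaF_halves ?hE.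
have tot := sumn_halves (l1 :: ls); rewrite hE in tot.
have pos : 0 < sumn (l1 :: ls) by rewrite tot.
have dM : d.+1.*2 < (sumn (l1 :: ls)).-1 by rewrite tot; clear; lia.
have l10 : 0 < l1 by case/andP: a2; case: (l1).
rewrite /lf_order !subn1 dE => /rat_threshold thr0.
have GFle : Ncliques (GF (l1 :: ls) n) s <= ex n s (lf_graph (l1 :: ls)).
  apply: ex_ge => //; first exact: GF_sym.
    exact: GF_irr.
  by apply: GF_free; rewrite ?hE.
have five l : odd l -> l1 :: ls = [:: l; l] -> 4 < l /\ l = d.+3.
  move=> ol E; have dE2 := hE; rewrite E /halves /= in dE2; rewrite E /= in a2 a3.
  by case/andP: a2 => h2 _; case/andP: a3 => h3 _; move: ol dE2 h2 h3; clear; lia.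
case: s s0 sd thr0 GFle => [//|[|j]] _ sd thr0 GFle.
  have ub := ex1_le n pos; rewrite Ncliques1 card_ord in GFle *.
  have exn : ex n 1 (lf_graph (l1 :: ls)) = n by apply/eqP; rewrite eqn_leq ub GFle.
  split=> [_|l ol E]; last first.
    (* [s = 1] is never [delta_F + 1], since [delta_F = l - 2 >= 3]. *)
    by split=> // sE; have [h1 h2] := five l ol E; move: h1 h2 sE; rewrite dE; clear; lia.
  rewrite exn; apply/esym/maxn_idPl; apply: ex1_le; by rewrite /= addn0.
have jd : j <= d by move: sd; rewrite dE.
have [|dn thr] := thr0; first by rewrite muln_gt0 bin_gt0; move: jd dM; clear; lia.
rewrite [j.+2.-1]/= in thr.
have Y := threshold_large jd dM thr.
have dn3 : d.+3 <= n by move: Y dM; clear; lia.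
split=> [reg|l ol E].
  apply/eqP; rewrite [head 0 _]/= eqn_leq geq_max GFle ex_path_le // !andbT.
  exact: (ex_regular so a2 a3 ls0 hE jd dn3 thr reg).
have [l4 lE] := five l ol E; rewrite E in thr Y GFle tot *.
have lE2 : l.-2 = d.+1 by rewrite lE.
have sE : sumn [:: l; l] = l.*2 by rewrite /= addn0 addnn.
have dE' : deltaF [:: l; l] = d.+1 by rewrite -E.
rewrite sE -lE2 in thr Y.
split=> [sd'|[jE]].
  have jl : j.+4 <= l by move: sd' lE; clear; lia.
  have Yl : l.*2 <= n - l.-2 by move: Y l4; clear; lia.
  apply/eqP; rewrite eqn_leq GFle andbT; apply: leq_trans (ex_double_odd ol l4 jl Yl thr) _.
  rewrite lE2 -dE' -[X in _ + X]mul1n.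
  have <- : all odd [:: l; l] = 1 :> nat by rewrite /= ol.
  by apply: GF_count; rewrite -?E ?hE ?dE.
have jE' : j = d by [].
have lE1 : l.-1 = j.+2 by rewrite lE jE'.
rewrite -lE1 ex_double_odd_top //.
- by rewrite /apexf !subn1 subn2.
- by move: dn3 lE2; clear; lia.
- by move: thr; rewrite -lE1 lE2 -jE' binn muln1.
Qed.
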